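(* Let $u_0\in \mathcal{E}$, $u_0\not\equiv 0$, be a solution of $$\lambda u_0+\mu \Lambda u_0=\Pi (|u_0|^2u_0)$$ for some $(\lambda,\mu)\in\mathbb{R}^2$. Then, for any $$\eta>\eta_0 := \left( \frac{1}{2} + \frac{1}{2} \frac{\log 2}{\log 3} \right)^{-1} \sim 1.226\dots,$$ there is a constant $C_\eta$ such that $$\forall z\in \mathbb{C},\qquad |u_0(z)| \leq C_\eta\, e^{|z|^\eta-\frac{1}{2}|z|^2}.$$ As a consequence, if $$N(R) = \# \{ z \in \mathbb{C} : u_0(z) = 0 \text{ and } |z|<R \},$$ then for any $\eta > \eta_0$, $$\frac{N(R)}{R^\eta} \longrightarrow 0 \quad \text{as } R \to \infty.$$
   Context: $dL$ is Lebesgue measure on $\mathbb{C}$. The Bargmann–Fock space is $$\mathcal{E}=\{u(z)=e^{-|z|^2/2}f(z): f \text{ entire holomorphic}\}\cap L^2(\mathbb{C}).$$ The orthogonal projection $\Pi$ onto $\mathcal{E}$ is given by $[\Pi u](z)=\frac1\pi e^{-|z|^2/2}\int_{\mathbb{C}} e^{\overline{w}z-|w|^2/2}u(w)\,dL(w)$. The angular momentum operator is $\Lambda=z\partial_z-\overline{z}\,\overline{\partial_z}$, with $\partial_z=\frac12(\partial_x-i\partial_y)$ and $\overline{\partial_z}=\frac12(\partial_x+i\partial_y)$. *)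

(* Defs.v *)
From HB Require Import structures.
From mathcomp Require Import all_boot all_order all_algebra.
From mathcomp Require Import complex.
From mathcomp Require Import all_classical all_reals all_analysis.

Set Implicit Arguments.
Unset Strict Implicit.
Unset Printing Implicit Defensive.

Import Order.TTheory GRing.Theory Num.Theory.
Import numFieldNormedType.Exports.

Local Open Scope classical_set_scope.
Local Open Scope ring_scope.
Local Open Scope complex_scope.

(* The real-valued modulus; the norm `|z| of R[i] takes its values in R[i]. *)
Definition cabs (R : realType) (z : R[i]) : R := @ComplexField.Normc.normc R z.

Definition cexp (R : realType) (z : R[i]) : R[i] :=
  (expR (complex.Re z) * cos (complex.Im z)) +i* (expR (complex.Re z) * sin (complex.Im z)).

(* Complex differentiability: R[i]^o is a normed module over R[i], so the
   increments in the difference quotients are complex. *)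
Definition entire (R : realType) (f : R[i] -> R[i]) : Prop :=
  forall z : R[i]^o, derivable (f : R[i]^o -> R[i]^o) z 1.

(* R[i] carries no measurable structure, so Lebesgue measure on C is the
   product measure on R * R, transported by (x, y) |-> x + i y. *)
Definition dL (R : realType) :=
  ((@lebesgue_measure R) \x (@lebesgue_measure R))%E.

Definition ofpair (R : realType) (p : R * R) : R[i] := p.1 +i* p.2.

Definition cintegral (R : realType) (F : R[i] -> R[i]) : R[i] :=
  (\int[@dL R]_(p in setT) complex.Re (F (ofpair p)))%R +i*
  (\int[@dL R]_(p in setT) complex.Im (F (ofpair p)))%R.

Definition L2C (R : realType) (u : R[i] -> R[i]) : Prop :=
  [/\ measurable_fun [set: measurableTypeR R * measurableTypeR R]
        (fun p => complex.Re (u (ofpair p)) : measurableTypeR R),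
      measurable_fun [set: measurableTypeR R * measurableTypeR R]
        (fun p => complex.Im (u (ofpair p)) : measurableTypeR R) &
      (\int[@dL R]_(p in setT) ((cabs (u (ofpair p)) ^+ 2)%:E) < +oo)%E].

(* Elements are genuine functions, represented by the continuous
   representative e^{-|z|^2/2} f(z) of their L^2 class. *)
Definition bargmann_fock (R : realType) (u : R[i] -> R[i]) : Prop :=
  (exists2 f : R[i] -> R[i], entire f &
     (forall z, u z = (expR (- (cabs z ^+ 2 / 2)))%:C * f z)) /\
  L2C u.

Definition proj_bf (R : realType) (u : R[i] -> R[i]) (z : R[i]) : R[i] :=
  ((pi^-1)%:C * (expR (- (cabs z ^+ 2 / 2)))%:C) *
  cintegral (fun w => cexp (conjc w * z - (cabs w ^+ 2 / 2)%:C) * u w).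

Definition partial_x (R : realType) (u : R[i] -> R[i]) (z : R[i]) : R[i] :=
  (derive1 (fun x : R => complex.Re (u (x +i* complex.Im z)) : R^o) (complex.Re z)) +i*
  (derive1 (fun x : R => complex.Im (u (x +i* complex.Im z)) : R^o) (complex.Re z)).

Definition partial_y (R : realType) (u : R[i] -> R[i]) (z : R[i]) : R[i] :=
  (derive1 (fun y : R => complex.Re (u (complex.Re z +i* y)) : R^o) (complex.Im z)) +i*
  (derive1 (fun y : R => complex.Im (u (complex.Re z +i* y)) : R^o) (complex.Im z)).

Definition d_z (R : realType) (u : R[i] -> R[i]) (z : R[i]) : R[i] :=
  2^-1 * (partial_x u z - (0 +i* 1) * partial_y u z).

Definition d_zbar (R : realType) (u : R[i] -> R[i]) (z : R[i]) : R[i] :=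
  2^-1 * (partial_x u z + (0 +i* 1) * partial_y u z).

Definition Lambda (R : realType) (u : R[i] -> R[i]) (z : R[i]) : R[i] :=
  z * d_z u z - conjc z * d_zbar u z.

(* Number of distinct zeros in the disc |z| < r, equal to +oo if there are
   infinitely many. *)
Definition nb_zeros (R : realType) (u : R[i] -> R[i]) (r : R) : \bar R :=
  counting [set z : R[i] | u z = 0 /\ cabs z < r].

Definition eta0 (R : realType) : R := (2^-1 + 2^-1 * (ln 2 / ln 3))^-1.

(* Main.v *)
From HB Require Import structures.
Require Import Defs.
From mathcomp Require Import all_boot all_order all_algebra.
From mathcomp Require Import complex ring lra zify measurable_realfun.
From mathcomp Require Import all_classical all_reals all_analysis.

Set Implicit Arguments.
Unset Strict Implicit.
Unset Printing Implicit Defensive.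

Import Order.TTheory GRing.Theory Num.Theory.
Import numFieldNormedType.Exports.
Local Open Scope classical_set_scope.
Local Open Scope ring_scope.
Local Open Scope complex_scope.

(** Write [u0 z = exp (- |z| ^ 2 / 2) * f z] with [f = \sum_n a n * z ^ n] entire,
    and let [y n = n! * |a n| ^ 2]. The monomials are orthogonal in the
    Bargmann-Fock space, so that [\sum_n y n] converges, and the left-hand side
    of the equation is diagonal on them. Expanding the kernel of the projection,
    the equation becomes [stationary_coef]:
    [(lambda + mu * n) * n! * a n] is [1 / pi] times the integral of
    [|f| ^ 2 * f * conj w ^ n * exp (- 2 |w| ^ 2)]. The moments of this weight are
    of size [m! / 2 ^ m], and the powers of [2] make the cubic term smoothing.

    Quantitatively, Cauchy-Schwarz estimates turn a bound [A] of
    [\sum_n y n / q ^ n] into a bound [O (A ^ 3)] of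
    [\sum_n (lambda + mu * n) ^ 2 * y n / q' ^ n] as soon as
    [q ^ 2 + q / q' <= 2] ([energy_step]). For small [q] the ratio [k = q' / q] can
    be any number above [1 / 2], at the price of cubing the bound. At [q = 1]
    nothing is gained, and the iteration has to be started differently: the tail
    of [\sum_n y n] beyond [2 M] is at most a multiple of the square of the tail
    beyond [M] plus [(8 / 9) ^ M] ([tail_step]), which forces the tails to decay
    geometrically once they are small. The factor [lambda + mu * n] can be divided
    out, except on finitely many modes, unless [lambda = mu = 0]; in that case all
    cubic moments vanish, so does the integral of
    [|f| ^ 4 * exp (- 2 |w| ^ 2)], and [u0] would be zero. The outcome is
    [stationary_energy]: for every [k > 1 / 2] there are [q] and [D] such that
    [\sum_n y n / (q * k ^ j) ^ n <= D ^ (3 ^ j)] for all [j].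

    By Cauchy-Schwarz against the exponential series,
    [\sum_n |a n| * r ^ n] is then at most of the size of
    [D ^ (3 ^ j) * exp (q * k ^ j * r ^ 2 / 2)]. For [k = 3 ^ (1 - 2 / m)] and
    [3 ^ j] close to [r ^ m] both exponents are [O (r ^ m)], and [k > 1 / 2] means
    [m > eta0]. This is the bound of [u0]. It controls the zeros as well: dividing
    a power series by its roots of modulus at most [r] costs a factor
    [1 / (2 r)] for each root in the absolute sum at radius [3 r], whereas the
    lowest coefficient is divided by at most [r] ([root_count_bound]); so [N]
    roots force this sum to be at least of size [2 ^ N].

    The complex analysis behind the expansion of [f] is the mean value property:
    Goursat's theorem on rectangles in logarithmic coordinates gives it on
    circles, and averaging over the rotations of the plane, products of shears,
    gives it for radial weights. Applied to a translate of [f], it is the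
    reproducing formula [reproducing]; expanding the kernel gives the power
    series, and comparison with monomials the Gaussian moments. *)

(** * The modulus and complex differentiability *)

Lemma cabs_ge0 (R : realType) (z : R[i]) : 0 <= cabs z.
Proof. by case: z => a b; exact: sqrtr_ge0. Qed.

Lemma cabs0 (R : realType) : cabs (0 : R[i]) = 0.
Proof. exact: ComplexField.Normc.normc0. Qed.

Lemma cabsM (R : realType) (z w : R[i]) : cabs (z * w) = cabs z * cabs w.
Proof. exact: ComplexField.Normc.normcM. Qed.

Lemma cabsV (R : realType) (z : R[i]) : cabs z^-1 = (cabs z)^-1.
Proof. exact: ComplexField.Normc.normcV. Qed.

Lemma cabsD (R : realType) (z w : R[i]) : cabs (z + w) <= cabs z + cabs w.
Proof. exact: le_normcD. Qed.

Lemma cabsN (R : realType) (z : R[i]) : cabs (- z) = cabs z.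
Proof. exact: normcN. Qed.

Lemma cabsC (R : realType) (z w : R[i]) : cabs (z - w) = cabs (w - z).
Proof. by rewrite -cabsN opprB. Qed.

Lemma cabsB (R : realType) (z w : R[i]) : cabs (z - w) <= cabs z + cabs w.
Proof. by rewrite -(cabsN w) cabsD. Qed.

Lemma cabs_eq0 (R : realType) (z : R[i]) : (cabs z == 0) = (z == 0).
Proof.
apply/eqP/eqP => [/ComplexField.Normc.eq0_normc//|->]; exact: cabs0.
Qed.

Lemma cabs_gt0 (R : realType) (z : R[i]) : (0 < cabs z) = (z != 0).
Proof. by rewrite lt_def cabs_ge0 andbT cabs_eq0. Qed.

Lemma cabs_sqr (R : realType) (z : R[i]) :
  cabs z ^+ 2 = complex.Re z ^+ 2 + complex.Im z ^+ 2.
Proof. by case: z => a b /=; rewrite sqr_sqrtr// addr_ge0// sqr_ge0. Qed.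

Lemma cabs_real (R : realType) (x : R) : cabs x%:C = `|x|.
Proof. by rewrite /cabs /= expr0n addr0 sqrtr_sqr. Qed.

Lemma cabs_conj (R : realType) (z : R[i]) : cabs (conjc z) = cabs z.
Proof. by case: z => a b; rewrite /cabs /= sqrrN. Qed.

Lemma cabs1 (R : realType) : cabs (1 : R[i]) = 1.
Proof. exact: ComplexField.Normc.normc1. Qed.

Lemma cabsX (R : realType) (z : R[i]) n : cabs (z ^+ n) = cabs z ^+ n.
Proof.
by elim: n => [|n IH]; rewrite ?expr0 ?cabs1// !exprS cabsM IH.
Qed.

Lemma Re_le_cabs (R : realType) (z : R[i]) : `|complex.Re z| <= cabs z.
Proof.
by case: z => a b /=; rewrite -sqrtr_sqr ler_wsqrtr// lerDl sqr_ge0.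
Qed.

Lemma Im_le_cabs (R : realType) (z : R[i]) : `|complex.Im z| <= cabs z.
Proof.
by case: z => a b /=; rewrite -sqrtr_sqr ler_wsqrtr// lerDr sqr_ge0.
Qed.

Lemma cabs_le_ReIm (R : realType) (z : R[i]) :
  cabs z <= `|complex.Re z| + `|complex.Im z|.
Proof.
case: z => a b /=; rewrite -[leRHS]ger0_norm ?addr_ge0// -sqrtr_sqr ler_wsqrtr//.
rewrite sqrrD !real_normK ?num_real// -addrA lerD2l lerDr.
by rewrite mulrn_wge0// mulr_ge0.
Qed.

Lemma cabs_sum (R : realType) (I : Type) (s : seq I) (P : pred I) (F : I -> R[i]) :
  cabs (\sum_(i <- s | P i) F i) <= \sum_(i <- s | P i) cabs (F i).
Proof.
elim/big_rec2: _ => [|i x y _ h]; first by rewrite cabs0.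
by apply: (le_trans (cabsD _ _)); rewrite lerD2l.
Qed.

Lemma mulc_conj (R : realType) (z : R[i]) : conjc z * z = (cabs z ^+ 2)%:C.
Proof. by rewrite cabs_sqr; case: z => a b; simpc; congr (_ +i* _); ring. Qed.

(** The increments are measured by the real modulus, which turns complex
    differentiability into an inequality between real numbers. *)
Definition cderiv (R : realType) (f : R[i] -> R[i]) (z d : R[i]) : Prop :=
  forall e : R, 0 < e -> exists2 del : R, 0 < del &
    forall h : R[i], cabs h < del -> cabs (f (z + h) - f z - d * h) <= e * cabs h.

Lemma entire_cderiv (R : realType) (f : R[i] -> R[i]) :
  entire f -> forall z, exists d, cderiv f z d.
Proof.
move=> fe z; have := fe z => /cvg_ex [d]; move=> /cvgrPdist_le fd; exists d => e e0.
have e0' : 0 < e%:C :> R[i] by rewrite ltcR.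
have := fd _ e0'.
rewrite /dnbhs => /nbhs_ballP [r /= r0 rP].
have [Ir Rr] : complex.Im r = 0 /\ 0 < complex.Re r.
  by move: r0; rewrite ltcE /= => /andP[/eqP -> ->].
have rE : r = (complex.Re r)%:C by case: (r) Ir => a b /= ->.
exists (complex.Re r) => // h hr.
have [->|h0] := eqVneq h 0; first by rewrite addr0 subrr mulr0 subrr cabs0 mulr0.
have hb : ball (0 : R[i]^o) r h.
  by rewrite -ball_normE /= sub0r normrN rE ltcR.
have := rP h hb h0.
rewrite /= /GRing.scale /= mulr1 => hle.
have {hle} : cabs (d - h^-1 * (f (h + z) - f z)) <= e.
  by move: hle; rewrite -[X in X <= _]/((cabs _)%:C) lecR.
have -> : f (z + h) - f z - d * h = - ((d - h^-1 * (f (h + z) - f z)) * h).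
  by rewrite (addrC h z) mulrBl mulrAC mulVf// mul1r opprB.
by rewrite cabsN cabsM => ?; rewrite ler_wpM2r ?cabs_ge0.
Qed.

Lemma cderiv_lip (R : realType) (f : R[i] -> R[i]) (z d : R[i]) : cderiv f z d ->
  exists2 del : R, 0 < del &
    forall h, cabs h < del -> cabs (f (z + h) - f z) <= (cabs d + 1) * cabs h.
Proof.
move=> fd; have [del del0 H] := fd 1 ltr01; exists del => // h /H hh.
rewrite -(subrK (d * h) (f (z + h) - f z)).
apply: (le_trans (cabsD _ _)); rewrite cabsM mulrDl addrC lerD2l.
by [].
Qed.

(** Absorbs the constants produced by the product and chain rules. *)
Lemma cderiv_scaled (R : realType) (f : R[i] -> R[i]) (z d : R[i]) (K : R) :
  (forall e : R, 0 < e -> e <= 1 -> exists2 del : R, 0 < del & forall h : R[i],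
     cabs h < del -> cabs (f (z + h) - f z - d * h) <= K * e * cabs h) ->
  cderiv f z d.
Proof.
move=> H e e0; pose M := `|K| + 1.
have M0 : 0 < M by rewrite /M ltr_wpDl.
have [||del del0 Hd] := H (Num.min 1 (e / M)).
- by rewrite lt_min ltr01 divr_gt0.
- by rewrite ge_min lexx.
exists del => // h /Hd /le_trans; apply; rewrite ler_wpM2r ?cabs_ge0//.
apply: (@le_trans _ _ (M * Num.min 1 (e / M))).
  rewrite ler_wpM2r//; first by rewrite le_min ler01 divr_ge0 ?ltW.
  by rewrite (le_trans (ler_norm _))// /M lerDl.
by rewrite mulrC -ler_pdivlMr// ge_min lexx orbT.
Qed.

Lemma cderivM (R : realType) (f g : R[i] -> R[i]) (z a b : R[i]) :
  cderiv f z a -> cderiv g z b ->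
  cderiv (fun w => f w * g w) z (a * g z + f z * b).
Proof.
move=> fa gb.
apply: (@cderiv_scaled _ _ _ _
  (cabs (g z) + (cabs b + 1) + cabs a * (cabs b + 1) + cabs (f z))) => e e0 e1.
have [d1 d10 H1] := fa _ e0.
have [d2 d20 H2] := gb _ e0.
have [d3 d30 H3] := cderiv_lip gb.
exists (Num.min (Num.min d1 d2) (Num.min d3 e)); first by rewrite !lt_min d10 d20 d30 e0.
move=> h; rewrite !lt_min => /andP[/andP[h1 h2] /andP[h3 h4]].
have {}H1 := H1 _ h1; have {}H2 := H2 _ h2; have {}H3 := H3 _ h3.
have -> : f (z + h) * g (z + h) - f z * g z - (a * g z + f z * b) * h =
  (f (z + h) - f z - a * h) * g z + (f (z + h) - f z - a * h) * (g (z + h) - g z)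
  + a * h * (g (z + h) - g z) + f z * (g (z + h) - g z - b * h) by ring.
apply: le_trans (cabsD _ _) _.
apply: le_trans (lerD (cabsD _ _) (lexx _)) _.
apply: le_trans (lerD (lerD (cabsD _ _) (lexx _)) (lexx _)) _.
rewrite !cabsM 3!mulrDl 3!mulrDl.
move: (cabs (g (z + h) - g z)) H3 (cabs_ge0 (g (z + h) - g z)) => G3 H3 G30.
move: (cabs (f (z + h) - f z - a * h)) H1 (cabs_ge0 (f (z + h) - f z - a * h)) => F H1 F0.
move: (cabs (g (z + h) - g z - b * h)) H2 (cabs_ge0 (g (z + h) - g z - b * h)) => G H2 G0.
move: (cabs_ge0 a) (cabs_ge0 b) (cabs_ge0 (f z)) (cabs_ge0 (g z)) (cabs_ge0 h) h4.
move: (cabs a) (cabs b) (cabs (f z)) (cabs (g z)) (cabs h) H1 H2 H3 => A B Fz Gz k H1 H2 H3 A0 B0 Fz0 Gz0 k0 ke.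
have G3e : G3 <= (B + 1) * e.
  by apply: le_trans H3 _; apply: ler_wpM2l; [exact: addr_ge0|exact: ltW].
apply: lerD; [apply: lerD; [apply: lerD|]|].
- by rewrite mulrC -mulrA ler_wpM2l.
- rewrite -mulrA [leRHS]mulrC; apply: ler_pM => //.
  apply: le_trans G3e _; rewrite -[leRHS]mulr1 ler_wpM2l ?addr_ge0//.
- have -> : A * (B + 1) * e * k = (A * k) * ((B + 1) * e) by ring.
  by apply: ler_wpM2l => //; exact: mulr_ge0.
- by rewrite -mulrA ler_wpM2l.
Qed.

Lemma cderivD (R : realType) (f g : R[i] -> R[i]) (z a b : R[i]) :
  cderiv f z a -> cderiv g z b -> cderiv (fun w => f w + g w) z (a + b).
Proof.
move=> fa gb; apply: (@cderiv_scaled _ _ _ _ 2) => e e0 e1.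
have [d1 d10 H1] := fa _ e0.
have [d2 d20 H2] := gb _ e0.
exists (Num.min d1 d2); first by rewrite lt_min d10.
move=> h; rewrite lt_min => /andP[/H1 h1 /H2 h2].
have -> : f (z + h) + g (z + h) - (f z + g z) - (a + b) * h =
  (f (z + h) - f z - a * h) + (g (z + h) - g z - b * h) by ring.
apply: le_trans (cabsD _ _) _; apply: le_trans (lerD h1 h2) _.
by lra.
Qed.

Lemma cderiv_cst (R : realType) (c z : R[i]) : cderiv (fun _ => c) z 0.
Proof.
move=> e e0; exists 1 => // h _.
by rewrite mul0r subr0 subrr cabs0 mulr_ge0 ?cabs_ge0 ?ltW.
Qed.

Lemma cderiv_id (R : realType) (z : R[i]) : cderiv (fun w => w) z 1.
Proof.
move=> e e0; exists 1 => // h _.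
have -> : z + h - z - 1 * h = 0 by ring.
by rewrite cabs0 mulr_ge0 ?cabs_ge0 ?ltW.
Qed.

Lemma cderiv_comp (R : realType) (f g : R[i] -> R[i]) (z a b : R[i]) :
  cderiv f (g z) a -> cderiv g z b -> cderiv (fun w => f (g w)) z (a * b).
Proof.
move=> fa gb.
apply: (@cderiv_scaled _ _ _ _ ((cabs b + 1) + cabs a)) => e e0 e1.
have [d1 d10 H1] := fa _ e0.
have [d2 d20 H2] := gb _ e0.
have [d3 d30 H3] := cderiv_lip gb.
have b0 : 0 < cabs b + 1 by rewrite ltr_wpDl ?cabs_ge0.
exists (Num.min (d1 / (cabs b + 1)) (Num.min d2 d3)).
  by rewrite !lt_min d20 d30 divr_gt0.
move=> h; rewrite !lt_min => /and3P[h1 /H2 {}H2 /H3 {}H3].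
have -> : f (g (z + h)) - f (g z) - a * b * h =
  (f (g z + (g (z + h) - g z)) - f (g z) - a * (g (z + h) - g z))
  + a * (g (z + h) - g z - b * h).
  by rewrite (addrC (g z)) subrK; ring.
have kd1 : cabs (g (z + h) - g z) < d1.
  by apply: le_lt_trans H3 _; rewrite mulrC -ltr_pdivlMr.
apply: le_trans (cabsD _ _) _.
apply: le_trans (lerD (H1 _ kd1) (lexx _)) _.
rewrite cabsM 2!mulrDl lerD//.
  by rewrite [_ * e]mulrC -mulrA ler_wpM2l// ltW.
by rewrite -mulrA ler_wpM2l// cabs_ge0.
Qed.

Lemma is_derive_eps (R : realType) (f : R -> R) (x d : R) :
  is_derive x 1 f d -> forall e : R, 0 < e -> exists2 del : R, 0 < del &
    forall h, `|h| < del -> `|f (x + h) - f x - d * h| <= e * `|h|.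
Proof.
move=> [/cvg_ex [d' fd'] fd] e e0; have dE : d' = d.
  by rewrite -fd; exact/esym/cvg_lim.
move/cvgrPdist_le : fd' => /(_ _ e0).
rewrite /dnbhs near_withinE => /nbhs_ballP [r /= r0 rP].
exists r => // h hr.
have [->|h0] := eqVneq h 0; first by rewrite addr0 subrr mulr0 subrr normr0 mulr0.
have hb : ball (0 : R) r h by rewrite -ball_normE /= sub0r normrN.
have := rP h hb h0.
rewrite /= /GRing.scale /= mulr1 => hle; rewrite dE in hle.
have -> : f (x + h) - f x - d * h = - ((d - h^-1 * (f (h + x) - f x)) * h).
  by rewrite (addrC h x) mulrBl mulrAC mulVf// mul1r opprB.
by rewrite normrN normrM ler_wpM2r.
Qed.

Lemma cexpD (R : realType) (z w : R[i]) : cexp (z + w) = cexp z * cexp w.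
Proof.
case: z w => [a b] [c d]; rewrite /cexp; simpc.
by rewrite expRD cosD sinD; congr (_ +i* _); ring.
Qed.

Lemma cexp0 (R : realType) : cexp (0 : R[i]) = 1.
Proof. by rewrite /cexp /= expR0 cos0 sin0 mulr1 mulr0. Qed.

Lemma cabs_cexp (R : realType) (z : R[i]) : cabs (cexp z) = expR (complex.Re z).
Proof.
apply/eqP; rewrite -(@eqrXn2 _ 2) ?cabs_ge0 ?expR_ge0// cabs_sqr /=; apply/eqP.
by rewrite !exprMn -mulrDr cos2Dsin2 mulr1.
Qed.

Lemma cderiv_cexp (R : realType) (z : R[i]) : cderiv (@cexp R) z (cexp z).
Proof.
have He : is_derive (0:R) 1 expR 1 by have := is_derive_expR (0:R); rewrite expR0.
have Hc : is_derive (0:R) 1 cos 0 by have := is_derive_cos (0:R); rewrite sin0 oppr0.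
have Hs : is_derive (0:R) 1 sin 1 by have := is_derive_sin (0:R); rewrite cos0.
apply: (@cderiv_scaled _ _ _ _ (cabs (cexp z) * 9)) => e e0 e1.
have [d1 d10 H1] := is_derive_eps He e0.
have [d2 d20 H2] := is_derive_eps Hc e0.
have [d3 d30 H3] := is_derive_eps Hs e0.
exists (Num.min (Num.min d1 d2) (Num.min d3 e)); first by rewrite !lt_min d10 d20 d30 e0.
move=> h; rewrite !lt_min => /andP[/andP[h1 h2] /andP[h3 h4]].
rewrite cexpD -{2}(mulr1 (cexp z)) -mulrBr -mulrBr cabsM -!mulrA.
rewrite ler_wpM2l ?cabs_ge0//.
apply: le_trans (cabs_le_ReIm _) _.
have := H1 _ (le_lt_trans (Re_le_cabs h) h1).
have := H2 _ (le_lt_trans (Im_le_cabs h) h2).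
have := H3 _ (le_lt_trans (Im_le_cabs h) h3).
rewrite !add0r expR0 cos0 sin0 subr0 mul0r subr0 !mul1r.
move: (Re_le_cabs h) (Im_le_cabs h) h4.
move: (cabs_ge0 h); move: (cabs h) => k k0.
case: h {h1 h2 h3} => a b /= ak bk ke Sb Cb Ea.
have kk : k * k <= e * k by rewrite ler_wpM2r// ltW.
have ek : e * k <= k by rewrite -[leRHS]mul1r ler_wpM2r.
have Sb' : `|sin b - b| <= e * k by apply: (le_trans Sb); rewrite ler_wpM2l// ltW.
have Cb' : `|cos b - 1| <= e * k by apply: (le_trans Cb); rewrite ler_wpM2l// ltW.
have Ea' : `|expR a - 1 - a| <= e * k by apply: (le_trans Ea); rewrite ler_wpM2l// ltW.
have k1 : k <= 1 by rewrite (le_trans (ltW ke)).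
have E1 : `|expR a - 1| <= 2 * k.
  rewrite -(subrK a (expR a - 1)); apply: le_trans (ler_normD _ _) _; lra.
have E2 : `|expR a| <= 3.
  by rewrite -(subrK 1 (expR a)); apply: le_trans (ler_normD _ _) _; rewrite normr1; lra.
have -> : expR a * cos b - 1 - a = (expR a - 1 - a) + expR a * (cos b - 1) by ring.
have -> : expR a * sin b - 0 - b = expR a * (sin b - b) + (expR a - 1) * b by ring.
apply: le_trans (lerD (ler_normD _ _) (ler_normD _ _)) _; rewrite !normrM.
have T1 : `|expR a| * `|cos b - 1| <= 3 * (e * k) by apply: ler_pM.
have T2 : `|expR a| * `|sin b - b| <= 3 * (e * k) by apply: ler_pM.
have T3 : `|expR a - 1| * `|b| <= (2 * k) * k by apply: ler_pM.
lra.
Qed.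

(** * Goursat's theorem on rectangles *)

Definition seg_int (R : realType) (f : R -> R) (a b : R) : R :=
  (\int[@lebesgue_measure R]_(x in `[a, b]) f x)%R.

Lemma seg_integrable (R : realType) (f : R -> R) (a b : R) : continuous f ->
  (@lebesgue_measure R).-integrable `[a, b] (EFin \o f).
Proof.
move=> fc; apply: continuous_compact_integrable; first exact: segment_compact.
exact: continuous_subspaceT.
Qed.

Lemma seg_int_cat (R : realType) (f : R -> R) (a b c : R) : continuous f ->
  a <= b -> b <= c -> seg_int f a c = seg_int f a b + seg_int f b c.
Proof.
move=> fc ab bc; rewrite addrC; apply/eqP; rewrite -subr_eq; apply/eqP.
rewrite /seg_int Rintegral_itvB ?bnd_simp//; last exact: seg_integrable.
rewrite Rintegral_itv_obnd_cbnd//.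
apply: integrableS (seg_integrable b c fc) => //.
by apply: subset_itvr; rewrite bnd_simp.
Qed.

Lemma seg_intB (R : realType) (f g : R -> R) (a b : R) :
  continuous f -> continuous g ->
  seg_int (fun x => f x - g x) a b = seg_int f a b - seg_int g a b.
Proof. by move=> fc gc; rewrite /seg_int RintegralB//; exact: seg_integrable. Qed.

Lemma seg_int_cst (R : realType) (c a b : R) : a <= b ->
  seg_int (fun=> c) a b = c * (b - a).
Proof.
move=> ab; rewrite /seg_int Rintegral_cst//= lebesgue_measure_itv/= lte_fin.
by move: ab; rewrite le_eqVlt => /predU1P[->|->]//; rewrite ltxx subrr.
Qed.

Lemma seg_int_near (R : realType) (f : R -> R) (a b c e : R) : continuous f ->
  a <= b -> (forall x, a <= x <= b -> `|f x - c| <= e) ->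
  `|seg_int f a b - c * (b - a)| <= e * (b - a).
Proof.
move=> fc ab fe; rewrite -seg_int_cst// -seg_intB//; last exact: cst_continuous.
have gc : continuous (fun x => f x - c).
  by move=> x; apply: cvgB; [exact: fc|exact: cst_continuous].
apply: le_trans (le_normr_Rintegral _ (seg_integrable _ _ gc)) _ => //.
rewrite -seg_int_cst//; apply: le_Rintegral => //.
- apply: (@seg_integrable _ (fun x => `|f x - c|)) => x.
  exact: (cvg_norm (gc x)).
- by apply: (@seg_integrable _ (fun=> e)); exact: cst_continuous.
Qed.

(** Total differentiability at [(x, y)], with partial derivatives [a] and [b]. *)
Definition diff2 (R : realType) (F : R -> R -> R) (x y a b : R) : Prop :=
  forall e : R, 0 < e -> exists2 del : R, 0 < del & forall h k : R,
    `|h| <= del -> `|k| <= del ->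
    `|F (x + h) (y + k) - F x y - a * h - b * k| <= e * (`|h| + `|k|).

Lemma diff2_continuous1 (R : realType) (F : R -> R -> R) :
  (forall x y, exists a b, diff2 F x y a b) -> forall y, continuous (F ^~ y).
Proof.
move=> dF y x; have [a [b H]] := dF x y.
apply/cvgrPdist_le => e e0.
have [del del0 Hd] := H 1 ltr01.
pose M := `|a| + 1; have M0 : 0 < M by rewrite /M ltr_wpDl.
near=> t.
have td : `|t - x| <= del.
  rewrite distrC; near: t; apply: cvgr_dist_le => //; exact: cvg_id.
have := Hd (t - x) 0 td; rewrite normr0 => /(_ (ltW del0)).
rewrite (addrC x) subrK addr0 mulr0 subr0 addr0 mul1r => h.
rewrite distrC -(subrK (a * (t - x)) (F t y - F x y)).
apply: le_trans (ler_normD _ _) _; rewrite normrM.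
apply: (@le_trans _ _ (M * `|t - x|)); first by rewrite mulrDl mul1r addrC lerD2l.
rewrite mulrC -ler_pdivlMr// distrC; near: t; apply: cvgr_dist_le; first exact: cvg_id.
by rewrite divr_gt0.
Unshelve. all: by end_near. Qed.

Lemma diff2_swap (R : realType) (F : R -> R -> R) (x y a b : R) :
  diff2 F x y a b -> diff2 (fun y x => F x y) y x b a.
Proof.
move=> H e e0; have [d d0 Hd] := H e e0; exists d => // h k hd kd.
by rewrite [X in e * X]addrC (le_trans _ (Hd k h kd hd))// addrAC.
Qed.

Lemma diff2_continuous2 (R : realType) (F : R -> R -> R) :
  (forall x y, exists a b, diff2 F x y a b) -> forall x, continuous (F x).
Proof.
move=> dF x; apply: (@diff2_continuous1 _ (fun y x => F x y)) => {x} y x.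
by have [a [b /diff2_swap H]] := dF x y; exists b, a.
Qed.

(** The counterclockwise integral of the form [P dx + Q dy] along the boundary
    of the rectangle with lower left corner [(x, y)] and sides [a], [b]. *)
Definition rect_int (R : realType) (P Q : R -> R -> R) (x y a b : R) : R :=
  seg_int (P ^~ y) x (x + a) - seg_int (P ^~ (y + b)) x (x + a)
  + (seg_int (Q (x + a)) y (y + b) - seg_int (Q x) y (y + b)).

(** The integrals along the four quarters add up to the integral along the whole
    boundary, so one of them carries at least a quarter of it. *)
Lemma rect_int_quarter (R : realType) (P Q : R -> R -> R) (x y a b : R) :
  (forall y, continuous (P ^~ y)) -> (forall x, continuous (Q x)) ->
  0 <= a -> 0 <= b ->
  exists p : R * R, [/\ x <= p.1 <= x + a / 2, y <= p.2 <= y + b / 2 &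
    `|rect_int P Q x y a b| <= 4 * `|rect_int P Q p.1 p.2 (a / 2) (b / 2)| ].
Proof.
move=> Pc Qc a0 b0.
have E : rect_int P Q x y a b =
  rect_int P Q x y (a / 2) (b / 2) + rect_int P Q (x + a / 2) y (a / 2) (b / 2) +
  (rect_int P Q x (y + b / 2) (a / 2) (b / 2) +
   rect_int P Q (x + a / 2) (y + b / 2) (a / 2) (b / 2)).
  rewrite /rect_int -!addrA -!splitr.
  have Pcat y0 : seg_int (P ^~ y0) x (x + a) =
      seg_int (P ^~ y0) x (x + a / 2) + seg_int (P ^~ y0) (x + a / 2) (x + a).
    by apply: seg_int_cat => //; lra.
  have Qcat x0 : seg_int (Q x0) y (y + b) =
      seg_int (Q x0) y (y + b / 2) + seg_int (Q x0) (y + b / 2) (y + b).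
    by apply: seg_int_cat => //; lra.
  rewrite !Pcat !Qcat; ring.
apply: contrapT => H.
have K p1 p2 : x <= p1 <= x + a / 2 -> y <= p2 <= y + b / 2 ->
    4 * `|rect_int P Q p1 p2 (a / 2) (b / 2)| < `|rect_int P Q x y a b|.
  move=> h1 h2; rewrite ltNge; apply/negP => h3; apply: H; exists (p1, p2); split => //.
have h1 : x <= x <= x + a / 2 by lra.
have h2 : x <= x + a / 2 <= x + a / 2 by lra.
have h3 : y <= y <= y + b / 2 by lra.
have h4 : y <= y + b / 2 <= y + b / 2 by lra.
have := K _ _ h1 h3; have := K _ _ h2 h3; have := K _ _ h1 h4; have := K _ _ h2 h4.
have : `|rect_int P Q x y a b| <=
  `|rect_int P Q x y (a / 2) (b / 2)| + `|rect_int P Q (x + a / 2) y (a / 2) (b / 2)| +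
  (`|rect_int P Q x (y + b / 2) (a / 2) (b / 2)| +
   `|rect_int P Q (x + a / 2) (y + b / 2) (a / 2) (b / 2)|).
  by rewrite E; apply: le_trans (ler_normD _ _) _; apply: lerD; exact: ler_normD.
lra.
Qed.

(** The affine part of the form is closed, since the mixed coefficients of [P]
    and [Q] agree; only the remainders contribute. *)
Lemma rect_int_small (R : realType) (P Q : R -> R -> R) (p q c a1 b2 e : R) :
  (forall y, continuous (P ^~ y)) -> (forall x, continuous (Q x)) ->
  diff2 P p q a1 c -> diff2 Q p q c b2 -> 0 < e ->
  exists2 del : R, 0 < del & forall x y a b, 0 <= a <= del -> 0 <= b <= del ->
    x <= p <= x + a -> y <= q <= y + b ->
    `|rect_int P Q x y a b| <= 2 * e * (a + b) ^+ 2.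
Proof.
move=> Pc Qc dP dQ e0.
have [d1 d10 H1] := dP e e0; have [d2 d20 H2] := dQ e e0.
exists (Num.min d1 d2); first by rewrite lt_min d10.
move=> x y a b /andP[a0]; rewrite le_min => /andP[ad1 ad2].
move=> /andP[b0]; rewrite le_min => /andP[bd1 bd2] /andP[xp pa] /andP[yq qb].
have H1' s t : x <= s <= x + a -> y <= t <= y + b ->
    `|P s t - P p q - a1 * (s - p) - c * (t - q)| <= e * (a + b).
  move=> /andP[s1 s2] /andP[t1 t2].
  have sp : `|s - p| <= a by rewrite ler_norml; lra.
  have tq : `|t - q| <= b by rewrite ler_norml; lra.
  have := H1 (s - p) (t - q) (le_trans sp ad1) (le_trans tq bd1).
  rewrite (addrC p) (addrC q) !subrK => /le_trans; apply.
  by apply: ler_wpM2l; [exact: ltW|exact: lerD].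
have H2' s t : x <= s <= x + a -> y <= t <= y + b ->
    `|Q s t - Q p q - c * (s - p) - b2 * (t - q)| <= e * (a + b).
  move=> /andP[s1 s2] /andP[t1 t2].
  have sp : `|s - p| <= a by rewrite ler_norml; lra.
  have tq : `|t - q| <= b by rewrite ler_norml; lra.
  have := H2 (s - p) (t - q) (le_trans sp ad2) (le_trans tq bd2).
  rewrite (addrC p) (addrC q) !subrK => /le_trans; apply.
  by apply: ler_wpM2l; [exact: ltW|exact: lerD].
have yb1 : y <= y <= y + b by lra.
have yb2 : y <= y + b <= y + b by lra.
have xa1 : x <= x <= x + a by lra.
have xa2 : x <= x + a <= x + a by lra.
rewrite /rect_int -!seg_intB//.
have N1 : `|seg_int (fun s => P s y - P s (y + b)) x (x + a) - (- (c * b)) * (x + a - x)|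
    <= 2 * (e * (a + b)) * (x + a - x).
  apply: seg_int_near; [|lra|].
    by move=> s; apply: cvgB; exact: Pc.
  move=> s xs; have := H1' s _ xs yb1; have := H1' s _ xs yb2.
  rewrite !ler_norml => /andP[? ?] /andP[? ?]; apply/andP; split; lra.
have N2 : `|seg_int (fun t => Q (x + a) t - Q x t) y (y + b) - (c * a) * (y + b - y)|
    <= 2 * (e * (a + b)) * (y + b - y).
  apply: seg_int_near; [|lra|].
    by move=> t; apply: cvgB; exact: Qc.
  move=> t yt; have := H2' _ t xa1 yt; have := H2' _ t xa2 yt.
  rewrite !ler_norml => /andP[? ?] /andP[? ?]; apply/andP; split; lra.
move: N1 N2; set S1 := seg_int _ _ _; set S2 := seg_int _ _ _.
rewrite !ler_norml => /andP[? ?] /andP[? ?]; apply/andP; split; lra.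
Qed.

Lemma exp2_archi (R : realType) (x : R) : exists n : nat, x < 2 ^+ n.
Proof.
exists (Num.truncn x).+1; apply: (lt_trans (truncnS_gt x)).
by rewrite -natrX ltr_nat ltn_expl.
Qed.

(** Goursat's bisection: differentiability at each point suffices, because the
    nested rectangles all contain one limit point. *)
Lemma goursat_rect (R : realType) (P Q : R -> R -> R) :
  (forall x y, exists a b c, diff2 P x y a b /\ diff2 Q x y b c) ->
  forall x y a b, 0 <= a -> 0 <= b -> rect_int P Q x y a b = 0.
Proof.
move=> dPQ x0 y0 a b a0 b0.
have Pc : forall y, continuous (P ^~ y).
  apply: diff2_continuous1 => x y; have [u [v [w [? ?]]]] := dPQ x y.
  by exists u, v.
have Qc : forall x, continuous (Q x).
  apply: diff2_continuous2 => x y; have [u [v [w [? ?]]]] := dPQ x y.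
  by exists v, w.
have h2 n : a / 2 ^+ n.+1 = a / 2 ^+ n / 2 by rewrite exprSr invfM mulrA.
have k2 n : b / 2 ^+ n.+1 = b / 2 ^+ n / 2 by rewrite exprSr invfM mulrA.
have an0 n : 0 <= a / 2 ^+ n by rewrite divr_ge0// exprn_ge0.
have bn0 n : 0 <= b / 2 ^+ n by rewrite divr_ge0// exprn_ge0.
(* Lower left corners of nested rectangles, each a quarter of the previous one
   that carries at least a quarter of its boundary integral. *)
pose next n (p : R * R) : R * R :=
  xget p [set p' | [/\ p.1 <= p'.1 <= p.1 + a / 2 ^+ n / 2,
    p.2 <= p'.2 <= p.2 + b / 2 ^+ n / 2 &
    `|rect_int P Q p.1 p.2 (a / 2 ^+ n) (b / 2 ^+ n)| <=
     4 * `|rect_int P Q p'.1 p'.2 (a / 2 ^+ n / 2) (b / 2 ^+ n / 2)|]].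
pose z := fix z n := if n is m.+1 then next m (z m) else (x0, y0).
have zS n : [/\ (z n).1 <= (z n.+1).1 <= (z n).1 + a / 2 ^+ n / 2,
    (z n).2 <= (z n.+1).2 <= (z n).2 + b / 2 ^+ n / 2 &
    `|rect_int P Q (z n).1 (z n).2 (a / 2 ^+ n) (b / 2 ^+ n)| <=
     4 * `|rect_int P Q (z n.+1).1 (z n.+1).2 (a / 2 ^+ n.+1) (b / 2 ^+ n.+1)|].
  rewrite h2 k2.
  have [p Hp] := rect_int_quarter (z n).1 (z n).2 Pc Qc (an0 n) (bn0 n).
  exact: (@xgetPex _ (z n) [set p' | [/\ _, _ & _]]) (ex_intro _ p Hp).
have inter (c : R) (s : nat -> R) : 0 <= c ->
    (forall n, s n <= s n.+1 <= s n + c / 2 ^+ n / 2) ->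
    exists p, forall n, s n <= p <= s n + c / 2 ^+ n.
  move=> c0 Hs.
  have mono m k : s m <= s (m + k)%N.
    elim: k => [|k IH]; first by rewrite addn0.
    by rewrite addnS (le_trans IH)//; have /andP[] := Hs (m + k)%N.
  have anti m k : s (m + k)%N + c / 2 ^+ (m + k) <= s m + c / 2 ^+ m.
    elim: k => [|k IH]; first by rewrite addn0.
    apply: le_trans IH; rewrite addnS.
    have /andP[_] := Hs (m + k)%N; rewrite exprSr invfM mulrA; lra.
  have cross n m : s n <= s m + c / 2 ^+ m.
    have cn k : 0 <= c / 2 ^+ k by rewrite divr_ge0// exprn_ge0.
    have [nm|/ltnW mn] := leqP n m.
      have := mono n (m - n)%N; rewrite subnKC// => h.
      by apply: le_trans h _; rewrite lerDl.
    have := anti m (n - m)%N; rewrite subnKC//; apply: le_trans.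
    by rewrite lerDl.
  exists (sup (range s)) => n; apply/andP; split.
    apply: sup_upper_bound; last by exists n.
    split; first by exists (s 0%N), 0%N.
    by exists (s 0%N + c / 2 ^+ 0) => _ [m _ <-]; exact: cross.
  apply: ge_sup; first by exists (s 0%N), 0%N.
  by move=> _ [m _ <-]; exact: cross.
have [p Hp] := inter a (fun n => (z n).1) a0 (fun n => let: And3 h _ _ := zS n in h).
have [q Hq] := inter b (fun n => (z n).2) b0 (fun n => let: And3 _ h _ := zS n in h).
have E4 n : `|rect_int P Q x0 y0 a b| <=
    4 ^+ n * `|rect_int P Q (z n).1 (z n).2 (a / 2 ^+ n) (b / 2 ^+ n)|.
  elim: n => [|n IH]; first by rewrite !expr0 mul1r !divr1.
  apply: le_trans IH _; have [_ _ h] := zS n.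
  by rewrite exprSr -mulrA ler_wpM2l// exprn_ge0.
have [u [c [w [dP dQ]]]] := dPQ p q.
apply/eqP; rewrite -normr_le0; apply/ler_addgt0Pr => e e0; rewrite add0r.
pose e1 := e / (2 * ((a + b) ^+ 2 + 1)).
have D0 : 0 < 2 * ((a + b) ^+ 2 + 1) by rewrite mulr_gt0// ltr_wpDl// sqr_ge0.
have e10 : 0 < e1 by rewrite divr_gt0.
have [del del0 Hd] := rect_int_small Pc Qc dP dQ e10.
have [n Hn] := exp2_archi ((a + b) / del).
have p2 : 0 < (2 : R) ^+ n by rewrite exprn_gt0.
have lab : (a + b) / 2 ^+ n <= del.
  by rewrite ler_pdivrMr// mulrC -ler_pdivrMr// ltW.
have la : a / 2 ^+ n <= del.
  by apply: le_trans lab; apply: ler_wpM2r; [rewrite invr_ge0 ltW|lra].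
have lb : b / 2 ^+ n <= del.
  by apply: le_trans lab; apply: ler_wpM2r; [rewrite invr_ge0 ltW|lra].
have := Hd (z n).1 (z n).2 (a / 2 ^+ n) (b / 2 ^+ n).
rewrite an0 bn0 la lb => /(_ isT isT (Hp n) (Hq n)) h.
apply: le_trans (E4 n) _.
have p4 : 0 <= (4 : R) ^+ n by rewrite exprn_ge0.
apply: le_trans (ler_wpM2l p4 h) _.
(* The loss [4 ^ n] is the inverse of the ratio of the areas. *)
have -> : 4 ^+ n * (2 * e1 * (a / 2 ^+ n + b / 2 ^+ n) ^+ 2) = 2 * e1 * (a + b) ^+ 2.
  rewrite -mulrDl expr_div_n -exprM mulnC exprM.
  have -> : (2 : R) ^+ 2 = 4 by ring.
  have : (4 : R) ^+ n != 0 by rewrite expf_neq0//; lra.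
  by move=> ?; field.
rewrite /e1; move: (sqr_ge0 (a + b)); move: ((a + b) ^+ 2) => s s0.
have -> : 2 * (e / (2 * (s + 1))) * s = e * (s / (s + 1)) by field; lra.
apply: ler_piMr; first exact: ltW.
by rewrite ler_pdivrMr; lra.
Qed.

(** * The mean value property on circles *)

Definition holo (R : realType) (f : R[i] -> R[i]) : Prop :=
  forall z, exists d, cderiv f z d.

Lemma holoM (R : realType) (f g : R[i] -> R[i]) :
  holo f -> holo g -> holo (fun w => f w * g w).
Proof.
move=> hf hg z; have [a fa] := hf z; have [b gb] := hg z.
by exists (a * g z + f z * b); exact: cderivM.
Qed.

Lemma holoD (R : realType) (f g : R[i] -> R[i]) :
  holo f -> holo g -> holo (fun w => f w + g w).
Proof.
move=> hf hg z; have [a fa] := hf z; have [b gb] := hg z.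
by exists (a + b); exact: cderivD.
Qed.

Lemma holo_comp (R : realType) (f g : R[i] -> R[i]) :
  holo f -> holo g -> holo (fun w => f (g w)).
Proof.
move=> hf hg z; have [b gb] := hg z; have [a fa] := hf (g z).
by exists (a * b); exact: cderiv_comp.
Qed.

Lemma holo_cst (R : realType) (c : R[i]) : holo (fun=> c).
Proof. by move=> z; exists 0; exact: cderiv_cst. Qed.

Lemma holo_id (R : realType) : holo (fun w : R[i] => w).
Proof. by move=> z; exists 1; exact: cderiv_id. Qed.

Lemma holo_cexp (R : realType) : holo (@cexp R).
Proof. by move=> z; exists (cexp z); exact: cderiv_cexp. Qed.

Lemma holoX (R : realType) n : holo (fun w : R[i] => w ^+ n).
Proof.
elim: n => [|n IH].
  by under eq_fun do rewrite expr0; exact: holo_cst.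
by under eq_fun do rewrite exprS; apply: holoM => //; exact: holo_id.
Qed.

Lemma cReB (R : realType) (z w : R[i]) :
  complex.Re (z - w) = complex.Re z - complex.Re w.
Proof. by case: z w => [a b] [c d]. Qed.

Lemma cImB (R : realType) (z w : R[i]) :
  complex.Im (z - w) = complex.Im z - complex.Im w.
Proof. by case: z w => [a b] [c d]. Qed.

Lemma cReD (R : realType) (z w : R[i]) :
  complex.Re (z + w) = complex.Re z + complex.Re w.
Proof. by case: z w => [a b] [c d]. Qed.

Lemma cImD (R : realType) (z w : R[i]) :
  complex.Im (z + w) = complex.Im z + complex.Im w.
Proof. by case: z w => [a b] [c d]. Qed.

Lemma cReM (R : realType) (z w : R[i]) :
  complex.Re (z * w) = complex.Re z * complex.Re w - complex.Im z * complex.Im w.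
Proof. by case: z w => [a b] [c d]. Qed.

Lemma cImM (R : realType) (z w : R[i]) :
  complex.Im (z * w) = complex.Re z * complex.Im w + complex.Im z * complex.Re w.
Proof. by case: z w => [a b] [c d]. Qed.

(** The Cauchy-Riemann equations: the partial derivatives of both parts are read
    off the single complex number [d]. *)
Lemma cderiv_diff2 (R : realType) (F : R[i] -> R[i]) (x y : R) (d : R[i]) :
  cderiv F (x +i* y) d ->
  diff2 (fun s t => complex.Re (F (s +i* t))) x y (complex.Re d) (- complex.Im d) /\
  diff2 (fun s t => complex.Im (F (s +i* t))) x y (complex.Im d) (complex.Re d).
Proof.
move=> Fd; split => e e0; have [del del0 H] := Fd e e0.
- exists (del / 3) => [|h k hd kd]; first by rewrite divr_gt0.
  have hk : cabs (h +i* k) < del.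
    by apply: le_lt_trans (cabs_le_ReIm _) _ => /=; lra.
  apply: (@le_trans _ _ (e * cabs (h +i* k))); last first.
    by apply: ler_wpM2l; [exact: ltW|exact: cabs_le_ReIm].
  apply: le_trans (H _ hk); apply: le_trans (Re_le_cabs _).
  rewrite !cReB cReM /= [X in F X](_ : _ = (x + h) +i* (y + k)); last by simpc.
  by rewrite le_eqVlt; apply/orP; left; apply/eqP; congr `| _ |; ring.
- exists (del / 3) => [|h k hd kd]; first by rewrite divr_gt0.
  have hk : cabs (h +i* k) < del.
    by apply: le_lt_trans (cabs_le_ReIm _) _ => /=; lra.
  apply: (@le_trans _ _ (e * cabs (h +i* k))); last first.
    by apply: ler_wpM2l; [exact: ltW|exact: cabs_le_ReIm].
  apply: le_trans (H _ hk); apply: le_trans (Im_le_cabs _).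
  rewrite !cImB cImM /= [X in F X](_ : _ = (x + h) +i* (y + k)); last by simpc.
  by rewrite le_eqVlt; apply/orP; left; apply/eqP; congr `| _ |; ring.
Qed.

Definition crot (R : realType) (t : R) : R[i] := cos t +i* sin t.

Lemma cexp_rot (R : realType) (s t : R) : cexp (s +i* t) = (expR s)%:C * crot t.
Proof. by rewrite /cexp /crot /=; simpc. Qed.

Lemma circle_continuous (R : realType) (g : R[i] -> R[i]) : holo g ->
  continuous (fun t => complex.Re (g (crot t))).
Proof.
move=> hg; have hF := holo_comp hg (@holo_cexp R).
have := @diff2_continuous2 _ (fun s t => complex.Re (g (cexp (s +i* t)))).
move=> /(_ _ 0); rewrite (_ : (fun t => _) = (fun t => complex.Re (g (crot t)))).
  apply=> x y; have [d /cderiv_diff2[H _]] := hF (x +i* y).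
  by exists (complex.Re d), (- complex.Im d).
by apply/funext => t; rewrite cexp_rot expR0 mul1r.
Qed.

(** In the coordinate [s + it |-> exp (s + it)] circles become vertical
    segments; the horizontal sides of the rectangle cancel by periodicity, so
    the mean does not depend on the radius. *)
Lemma circle_mean (R : realType) (g : R[i] -> R[i]) : holo g ->
  seg_int (fun t => complex.Re (g (crot t))) 0 (2 * pi) = complex.Re (g 0) * (2 * pi).
Proof.
move=> hg; have hF := holo_comp hg (@holo_cexp R).
pose F z := g (cexp z).
pose U s t := complex.Re (F (s +i* t)); pose V s t := complex.Im (F (s +i* t)).
have dVU x y : exists a b c, diff2 V x y a b /\ diff2 U x y b c.
  have [d /cderiv_diff2[H1 H2]] := hF (x +i* y).
  by exists (complex.Im d), (complex.Re d), (- complex.Im d).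
have pi2 : 0 <= 2 * pi :> R by rewrite mulr_ge0// pi_ge0.
have Vper s : V s 0 = V s (2 * pi).
  by rewrite /V /F !cexp_rot /crot mulr_natl cos2pi sin2pi cos0 sin0.
have ind a : 0 <= a -> seg_int (U (- a)) 0 (2 * pi) = seg_int (U 0) 0 (2 * pi).
  move=> a0; have := goursat_rect dVU (- a) 0 a0 pi2.
  rewrite /rect_int !add0r addNr.
  rewrite (_ : V ^~ (2 * pi) = V ^~ 0); last by apply/funext => s; rewrite Vper.
  by rewrite subrr add0r => /eqP; rewrite subr_eq0 => /eqP.
have -> : (fun t => complex.Re (g (crot t))) = U 0.
  by apply/funext => t; rewrite /U /F cexp_rot expR0 mul1r.
(* The circle of abscissa [ln r] has radius [r]; let it shrink to the centre. *)
apply/eqP; rewrite -subr_eq0 -normr_le0; apply/ler_addgt0Pr => e e0; rewrite add0r.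
have [d gd] := hg 0.
have [del del0 Hd] := cderiv_lip gd.
pose M := cabs d + 1; have M0 : 0 < M by rewrite /M ltr_wpDl// cabs_ge0.
pose e1 := e / (2 * pi) / M.
have e10 : 0 < e1 by rewrite !divr_gt0// mulr_gt0// pi_gt0.
pose r := Num.min (del / 2) (Num.min 1 e1).
have r0 : 0 < r by rewrite !lt_min divr_gt0// ltr01.
have rd : r < del by rewrite gt_min; apply/orP; left; lra.
have re : r <= e1 by rewrite !ge_min lexx !orbT.
have r1 : r <= 1 by rewrite !ge_min lexx !orbT.
have a0 : 0 <= - ln r by rewrite oppr_ge0 -(ln1 R) ler_ln// posrE.
rewrite -(ind _ a0) opprK.
have Uc : continuous (U (ln r)).
  apply: diff2_continuous2 => x y; have [u [v [w [? ?]]]] := dVU x y.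
  by exists v, w.
have := @seg_int_near _ (U (ln r)) 0 (2 * pi) (complex.Re (g 0)) (M * r) Uc pi2.
rewrite !subr0 => H; apply: le_trans (H _) _ => [t _|].
  rewrite /U /F cexp_rot lnK ?posrE// -cReB.
  apply: le_trans (Re_le_cabs _) _; rewrite -[X in g X - _]add0r.
  have cr : cabs (r%:C * crot t) = r.
    rewrite cabsM cabs_real gtr0_norm// /cabs /= cos2Dsin2 sqrtr1 mulr1//.
  by apply: le_trans (Hd _ _) _; rewrite cr.
apply: (@le_trans _ _ (M * e1 * (2 * pi))).
  by apply: ler_wpM2r => //; apply: ler_wpM2l => //; exact: ltW.
rewrite /e1 le_eqVlt; apply/orP; left; apply/eqP.
have Mn : M != 0 by rewrite gt_eqF.
have key p : p != 0 -> M * (e / (2 * p) / M) * (2 * p) = e.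
  by move=> pn; field; rewrite Mn pn.
by rewrite key// gt_eqF// pi_gt0.
Qed.

(** * Translations and rotations of the plane *)

Lemma lebesgue_measure_shift (R : realType) (c : R) (A : set (measurableTypeR R)) :
  measurable A ->
  pushforward (@lebesgue_measure R) (fun x => x + c : measurableTypeR R) A
  = lebesgue_measure A.
Proof.
move=> mA; apply/esym.
have mf : measurable_fun setT (fun x : measurableTypeR R => x + c : measurableTypeR R).
  exact: measurable_funD.
pose f : {mfun measurableTypeR R >-> measurableTypeR R} :=
   HB.pack (fun x => x + c : measurableTypeR R) (isMeasurableFun.Build _ _ _ _ _ mf).
apply: (@lebesgue_measure_unique R (pushforward (@lebesgue_measure R) f)) => //= _ [[a b]] _ <-.
rewrite /pushforward.
have -> : f @^-1` `]a, b]%classic = `]a - c, b - c]%classic.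
  by apply/seteqP; split=> x /=; rewrite !in_itv/= ltrBlDr lerBrDr.
rewrite !lebesgue_measure_itv/= !lte_fin ltrD2r -!EFinB.
by rewrite (_ : b - c - (a - c) = b - a) //; ring.
Qed.

Lemma ge0_integral_shift (R : realType) (c : R) (f : R -> \bar R) :
  measurable_fun setT f -> (forall x, 0 <= f x)%E ->
  (\int[@lebesgue_measure R]_x f (x + c)%R = \int[@lebesgue_measure R]_x f x)%E.
Proof.
move=> mf f0.
have mp : measurable_fun setT (fun x : measurableTypeR R => x + c : measurableTypeR R).
  exact: measurable_funD.
rewrite -[LHS](ge0_integral_pushforward mp (@lebesgue_measure R) measurableT mf)//.
by apply: eq_measure_integral => A mA _; exact: lebesgue_measure_shift.
Qed.

(** By Fubini a shear is a translation of each fibre. *)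
Lemma ge0_integral_shear (R : realType) (c : R -> R)
    (f : measurableTypeR R * measurableTypeR R -> \bar R) :
  measurable_fun setT c ->
  measurable_fun setT f -> (forall p, 0 <= f p)%E ->
  (\int[(@lebesgue_measure R \x @lebesgue_measure R)%E]_p f (p.1, (p.2 + c p.1)%R) =
   \int[(@lebesgue_measure R \x @lebesgue_measure R)%E]_p f p)%E.
Proof.
move=> mc mf f0.
rewrite fubini_tonelli1//=; last first.
  apply: measurableT_comp => //=; apply/measurable_fun_pair => //=.
  apply: measurable_funD => //=; exact: measurableT_comp.
rewrite fubini_tonelli1//.
apply: eq_integral => x _.
rewrite /fubini_F/=.
by rewrite (ge0_integral_shift (c x) (f := fun y => f (x, y)))//; exact: measurableT_comp.
Qed.

(** Stated through integrals of nonnegative functions, so that integrability and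
    signed integrals can be transported afterwards. *)
Definition preserves_dL (R : realType)
    (Phi : measurableTypeR R * measurableTypeR R -> measurableTypeR R * measurableTypeR R) :=
  measurable_fun setT Phi /\
  forall f, measurable_fun setT f -> (forall p, 0 <= f p)%E ->
  (\int[(@lebesgue_measure R \x @lebesgue_measure R)%E]_p f (Phi p) =
   \int[(@lebesgue_measure R \x @lebesgue_measure R)%E]_p f p)%E.

Lemma preserves_comp (R : realType)
    (Phi Psi : measurableTypeR R * measurableTypeR R -> measurableTypeR R * measurableTypeR R) :
  preserves_dL Phi -> preserves_dL Psi -> preserves_dL (Phi \o Psi).
Proof.
move=> [mP HP] [mQ HQ]; split; first exact: measurableT_comp.
move=> f mf f0; rewrite -[RHS]HP// -[RHS]HQ//; exact: measurableT_comp.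
Qed.

Lemma preserves_shear2 (R : realType) (c : R -> R) : measurable_fun setT c ->
  preserves_dL (fun p : R * R => (p.1, (p.2 + c p.1)%R)).
Proof.
move=> mc; split; last by move=> f mf f0; exact: ge0_integral_shear.
apply/measurable_fun_pair => //=.
by apply: measurable_funD => //=; exact: measurableT_comp.
Qed.

Lemma preserves_shear1 (R : realType) (c : R -> R) : measurable_fun setT c ->
  preserves_dL (fun p : R * R => ((p.1 + c p.2)%R, p.2)).
Proof.
move=> mc; have mP : measurable_fun setT
    (fun p : R * R => ((p.1 + c p.2)%R, p.2)).
  apply/measurable_fun_pair => //=.
  by apply: measurable_funD => //=; exact: measurableT_comp.
split=> // f mf f0.
have mfP : measurable_fun setT (fun p : R * R =>
    f ((p.1 + c p.2)%R, p.2)) by exact: measurableT_comp mf mP.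
rewrite fubini_tonelli2// [RHS]fubini_tonelli2//.
apply: eq_integral => y _; rewrite /fubini_G /=.
by rewrite (ge0_integral_shift (c y) (f := fun x => f (x, y)))//; exact: measurableT_comp.
Qed.

Lemma preserves_translation (R : realType) (a b : R) :
  preserves_dL (fun p : R * R => ((p.1 + a)%R, (p.2 + b)%R)).
Proof.
have := preserves_comp (preserves_shear1 (measurable_cst (a : measurableTypeR R)))
  (preserves_shear2 (measurable_cst (b : measurableTypeR R))).
by apply.
Qed.

(** A rotation is a product of three shears, unless it is the half turn, which
    is the square of a quarter turn. *)
Lemma preserves_rotation (R : realType) (c s : R) : c ^+ 2 + s ^+ 2 = 1 ->
  preserves_dL (fun p : R * R => ((c * p.1 - s * p.2)%R, (s * p.1 + c * p.2)%R)).
Proof.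
have gen (c' s' : R) : c' ^+ 2 + s' ^+ 2 = 1 -> c' != -1 ->
  preserves_dL (fun p : R * R => ((c' * p.1 - s' * p.2)%R, (s' * p.1 + c' * p.2)%R)).
  move=> cs cN1; have c1 : 1 + c' != 0 by rewrite addrC addr_eq0.
  (* Minus the tangent of half the angle. *)
  pose a := - s' / (1 + c').
  have ma : measurable_fun setT (fun x : R => a * x) by exact: mulrl_measurable.
  have ms : measurable_fun setT (fun x : R => s' * x) by exact: mulrl_measurable.
  have E1 : 1 + a * s' = c'.
    have H : s' ^+ 2 = (1 - c') * (1 + c') by lra.
    have -> : 1 + a * s' = 1 - s' ^+ 2 / (1 + c') by rewrite /a; ring.
    by rewrite H mulfK//; ring.
  have E2 : 2 * a + a ^+ 2 * s' = - s'.
    have -> : 2 * a + a ^+ 2 * s' = a * (1 + (1 + a * s')) by ring.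
    by rewrite E1 /a -mulrA mulVf ?mulr1.
  have E x y : x + a * y + a * (y + s' * (x + a * y)) = c' * x - s' * y.
    transitivity ((1 + a * s') * x + (2 * a + a ^+ 2 * s') * y); first by ring.
    by rewrite E1 E2 mulNr.
  have E' x y : y + s' * (x + a * y) = s' * x + c' * y.
    transitivity (s' * x + (1 + a * s') * y); first by ring.
    by rewrite E1.
  have := preserves_comp (preserves_shear1 ma)
    (preserves_comp (preserves_shear2 ms) (preserves_shear1 ma)).
  by congr preserves_dL; apply/funext => -[x y] /=; rewrite E E'.
have [->|cN1] := eqVneq c (-1); last by move=> cs; exact: gen.
move=> cs; have -> : s = 0.
  by apply/eqP; rewrite -sqrf_eq0; apply/eqP; move: cs; rewrite sqrrN expr1n; lra.
have H01 : (0 : R) ^+ 2 + 1 ^+ 2 = 1 by rewrite expr0n expr1n /= add0r.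
have N01 : (0 : R) != -1 by rewrite eq_sym oppr_eq0 oner_eq0.
have := preserves_comp (gen _ _ H01 N01) (gen _ _ H01 N01).
by congr preserves_dL; apply/funext => -[x y] /=; congr (_, _); ring.
Qed.

Lemma preserves_integrable (R : realType) Phi (f : R * R -> R) :
  @preserves_dL R Phi -> (@dL R).-integrable setT (EFin \o f) ->
  (@dL R).-integrable setT (EFin \o (f \o Phi)).
Proof.
move=> [mP HP] /integrableP[mf fi]; apply/integrableP; split.
  by have := measurableT_comp mf mP.
have mf' : measurable_fun setT (fun p => `|(EFin \o f) p|)%E.
  exact: measurableT_comp.
have H := HP _ mf' (fun p => abse_ge0 _).
by apply: le_lt_trans fi; rewrite -H.
Qed.

Lemma preserves_Rintegral (R : realType) Phi (f : R * R -> R) :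
  @preserves_dL R Phi -> (@dL R).-integrable setT (EFin \o f) ->
  (\int[@dL R]_p f (Phi p) = \int[@dL R]_p f p)%R.
Proof.
move=> [mP HP] /integrableP[mf fi]; rewrite /Rintegral; congr fine.
rewrite [LHS]integralE [RHS]integralE; congr (_ - _)%E.
  have mf' := measurable_funepos mf.
  by rewrite -[RHS](HP _ mf' (funepos_ge0 _)); apply: eq_integral => p _; rewrite funepos.unlock.
have mf' := measurable_funeneg mf.
by rewrite -[RHS](HP _ mf' (funeneg_ge0 _)); apply: eq_integral => p _; rewrite funeneg.unlock.
Qed.

(** * Integrals of complex functions on the plane *)

(** Measurability and integrability of functions on the plane are read in the
    coordinates of [ofpair]. *)
Definition rmeas (R : realType) (g : R[i] -> R) : Prop :=
  measurable_fun [set: measurableTypeR R * measurableTypeR R]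
    (fun p => g (ofpair p) : measurableTypeR R).

Definition rintble (R : realType) (g : R[i] -> R) : Prop :=
  (@dL R).-integrable setT (fun p => (g (ofpair p))%:E).

Definition rint (R : realType) (g : R[i] -> R) : R :=
  (\int[@dL R]_p g (ofpair p))%R.

Definition cmeas (R : realType) (F : R[i] -> R[i]) : Prop :=
  rmeas (fun z => complex.Re (F z)) /\ rmeas (fun z => complex.Im (F z)).

Definition cintble (R : realType) (F : R[i] -> R[i]) : Prop :=
  rintble (fun z => complex.Re (F z)) /\ rintble (fun z => complex.Im (F z)).

Lemma cintegralE (R : realType) (F : R[i] -> R[i]) :
  cintegral F = rint (fun z => complex.Re (F z)) +i* rint (fun z => complex.Im (F z)).
Proof. by []. Qed.

Lemma rmeasD (R : realType) (f g : R[i] -> R) :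
  rmeas f -> rmeas g -> rmeas (fun z => f z + g z).
Proof. by move=> mf mg; exact: measurable_funD. Qed.

Lemma rmeasN (R : realType) (f : R[i] -> R) : rmeas f -> rmeas (fun z => - f z).
Proof. by move=> mf; exact: measurable_funN. Qed.

Lemma rmeasM (R : realType) (f g : R[i] -> R) :
  rmeas f -> rmeas g -> rmeas (fun z => f z * g z).
Proof. by move=> mf mg; exact: measurable_funM. Qed.

Lemma rmeas_cst (R : realType) (c : R) : rmeas (fun _ : R[i] => c).
Proof. exact: measurable_cst. Qed.

Lemma rmeas_comp (R : realType) (h : R -> R) (g : R[i] -> R) :
  continuous h -> rmeas g -> rmeas (fun z => h (g z)).
Proof. by move=> hc mg; apply: measurableT_comp mg; exact: continuous_measurable_fun. Qed.

Lemma rmeasX (R : realType) (f : R[i] -> R) n : rmeas f -> rmeas (fun z => f z ^+ n).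
Proof. by move=> mf; exact: measurable_funX. Qed.

Lemma cmeas_id (R : realType) : cmeas (fun z : R[i] => z).
Proof. split.
- exact (@measurable_fst _ _ (measurableTypeR R) (measurableTypeR R)).
- exact (@measurable_snd _ _ (measurableTypeR R) (measurableTypeR R)). Qed.

Lemma cmeas_cst (R : realType) (c : R[i]) : cmeas (fun _ : R[i] => c).
Proof. by split; [exact (rmeas_cst (complex.Re c))|exact (rmeas_cst (complex.Im c))]. Qed.

Lemma cmeasD (R : realType) (F G : R[i] -> R[i]) :
  cmeas F -> cmeas G -> cmeas (fun z => F z + G z).
Proof.
move=> [m1 m2] [m3 m4]; split.
  by under eq_fun do rewrite cReD; exact (rmeasD m1 m3).
by under eq_fun do rewrite cImD; exact (rmeasD m2 m4).
Qed.

Lemma cmeasM (R : realType) (F G : R[i] -> R[i]) :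
  cmeas F -> cmeas G -> cmeas (fun z => F z * G z).
Proof.
move=> [m1 m2] [m3 m4]; split.
  under eq_fun do rewrite cReM.
  exact (rmeasD (rmeasM m1 m3) (rmeasN (rmeasM m2 m4))).
under eq_fun do rewrite cImM.
exact (rmeasD (rmeasM m1 m4) (rmeasM m2 m3)).
Qed.

Lemma cmeas_conj (R : realType) (F : R[i] -> R[i]) :
  cmeas F -> cmeas (fun z => conjc (F z)).
Proof.
move=> [m1 m2]; split.
  by rewrite (_ : (fun z => _) = fun z => complex.Re (F z))//; apply/funext => z; case: (F z).
rewrite (_ : (fun z => _) = fun z => - complex.Im (F z)); first exact (rmeasN m2).
by apply/funext => z; case: (F z).
Qed.

Lemma cmeas_real (R : realType) (g : R[i] -> R) : rmeas g -> cmeas (fun z => (g z)%:C).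
Proof. by move=> mg; split => //; exact (rmeas_cst 0). Qed.

Lemma cmeasX (R : realType) (F : R[i] -> R[i]) n :
  cmeas F -> cmeas (fun z => F z ^+ n).
Proof.
move=> mF; elim: n => [|n IH]; first by under eq_fun do rewrite expr0; exact: cmeas_cst.
by under eq_fun do rewrite exprS; exact: cmeasM.
Qed.

Lemma cmeas_sum (R : realType) (F : nat -> R[i] -> R[i]) n :
  (forall k, cmeas (F k)) -> cmeas (fun z => \sum_(k < n) F k z).
Proof.
move=> mF; elim: n => [|n IH]; first by under eq_fun do rewrite big_ord0; exact: cmeas_cst.
by under eq_fun do rewrite big_ord_recr /=; exact: cmeasD.
Qed.

Lemma cmeas_cexp (R : realType) (F : R[i] -> R[i]) :
  cmeas F -> cmeas (fun z => cexp (F z)).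
Proof.
move=> [m1 m2].
have me := rmeas_comp (@continuous_expR R) m1.
split; first exact (rmeasM me (rmeas_comp (@continuous_cos R) m2)).
exact (rmeasM me (rmeas_comp (@continuous_sin R) m2)).
Qed.

Lemma rmeas_cabs (R : realType) (F : R[i] -> R[i]) :
  cmeas F -> rmeas (fun z => cabs (F z)).
Proof.
move=> [m1 m2].
rewrite (_ : (fun z => _) =
  fun z => Num.sqrt (complex.Re (F z) ^+ 2 + complex.Im (F z) ^+ 2)).
  exact (rmeas_comp (@sqrt_continuous R) (rmeasD (rmeasX 2 m1) (rmeasX 2 m2))).
by apply/funext => z; case: (F z).
Qed.

Lemma rintble_meas (R : realType) (g : R[i] -> R) : rintble g -> rmeas g.
Proof. by move=> /integrableP[/measurable_EFinP]. Qed.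

Lemma rintble_le (R : realType) (f g : R[i] -> R) :
  rmeas f -> rintble g -> (forall z, `|f z| <= g z) -> rintble f.
Proof.
move=> mf ig fg; apply: le_integrable ig => //; first exact/measurable_EFinP.
by move=> p _ /=; rewrite lee_fin (le_trans (fg _))// ler_norm.
Qed.

Lemma rintbleD (R : realType) (f g : R[i] -> R) :
  rintble f -> rintble g -> rintble (fun z => f z + g z).
Proof. by move=> hf hg; have := integrableD measurableT hf hg. Qed.

Lemma rintbleZ (R : realType) (c : R) (f : R[i] -> R) :
  rintble f -> rintble (fun z => c * f z).
Proof. by move=> hf; have := integrableZl measurableT c hf. Qed.

Lemma rintD (R : realType) (f g : R[i] -> R) : rintble f -> rintble g ->
  rint (fun z => f z + g z) = rint f + rint g.
Proof. by move=> hf hg; rewrite /rint RintegralD. Qed.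

Lemma rintZ (R : realType) (c : R) (f : R[i] -> R) : rintble f ->
  rint (fun z => c * f z) = c * rint f.
Proof. by move=> hf; rewrite /rint RintegralZl. Qed.

Lemma rint_le (R : realType) (f g : R[i] -> R) : rintble f -> rintble g ->
  (forall z, f z <= g z) -> rint f <= rint g.
Proof. by move=> hf hg fg; apply: le_Rintegral. Qed.

Lemma rint_ge0 (R : realType) (f : R[i] -> R) : (forall z, 0 <= f z) -> 0 <= rint f.
Proof. by move=> f0; apply: Rintegral_ge0. Qed.

Lemma rint_norm (R : realType) (f g : R[i] -> R) : rintble f -> rintble g ->
  (forall z, `|f z| <= g z) -> `|rint f| <= rint g.
Proof.
move=> hf hg fg; rewrite ler_norml; apply/andP; split.
  rewrite lerNl -[X in X <= _]mulN1r -rintZ//; apply: rint_le => //; first exact: rintbleZ.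
  by move=> z; rewrite mulN1r (le_trans _ (fg z))// -normrN ler_norm.
by apply: rint_le => // z; rewrite (le_trans _ (fg z))// ler_norm.
Qed.

Lemma cintble_le (R : realType) (F : R[i] -> R[i]) (g : R[i] -> R) :
  cmeas F -> rintble g -> (forall z, cabs (F z) <= g z) -> cintble F.
Proof.
move=> [m1 m2] ig Fg; split; apply: rintble_le ig _ => // z; apply: le_trans (Fg z).
  exact: Re_le_cabs.
exact: Im_le_cabs.
Qed.

Lemma cintble_meas (R : realType) (F : R[i] -> R[i]) : cintble F -> cmeas F.
Proof. by move=> [? ?]; split; exact: rintble_meas. Qed.

Lemma rintble_norm (R : realType) (f : R[i] -> R) :
  rintble f -> rintble (fun z => `|f z|).
Proof. by move=> hf; exact: integrable_norm. Qed.

Lemma rintble_cabs (R : realType) (F : R[i] -> R[i]) :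
  cintble F -> rintble (fun z => cabs (F z)).
Proof.
move=> iF; have [i1 i2] := iF.
apply: (rintble_le (rmeas_cabs (cintble_meas iF))
  (rintbleD (rintble_norm i1) (rintble_norm i2))) => z.
by rewrite ger0_norm ?cabs_ge0// cabs_le_ReIm.
Qed.

Lemma cintbleD (R : realType) (F G : R[i] -> R[i]) :
  cintble F -> cintble G -> cintble (fun z => F z + G z).
Proof.
move=> iF iG.
apply: (cintble_le _ (rintbleD (rintble_cabs iF) (rintble_cabs iG))).
  by apply: cmeasD; exact: cintble_meas.
by move=> z; exact: cabsD.
Qed.

Lemma cintbleZ (R : realType) (c : R[i]) (F : R[i] -> R[i]) :
  cintble F -> cintble (fun z => c * F z).
Proof.
move=> iF; apply: (cintble_le _ (rintbleZ (cabs c) (rintble_cabs iF))).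
  by apply: cmeasM; [exact: cmeas_cst|exact: cintble_meas].
by move=> z; rewrite cabsM.
Qed.

Lemma cintegralD (R : realType) (F G : R[i] -> R[i]) : cintble F -> cintble G ->
  cintegral (fun z => F z + G z) = cintegral F + cintegral G.
Proof.
move=> [i1 i2] [i3 i4]; rewrite !cintegralE; simpc; rewrite -!rintD//.
by congr (_ +i* _); congr rint; apply/funext => z; rewrite ?cReD ?cImD.
Qed.

Lemma cintegralZ (R : realType) (c : R[i]) (F : R[i] -> R[i]) : cintble F ->
  cintegral (fun z => c * F z) = c * cintegral F.
Proof.
move=> [i1 i2]; rewrite !cintegralE; case: c => a b; simpc.
rewrite -mulNr -!rintZ// -!rintD; try exact: rintbleZ.
by congr (_ +i* _); congr rint; apply/funext => z; rewrite ?cReM ?cImM /= ?mulNr.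
Qed.

Lemma cintble0 (R : realType) : cintble (fun _ : R[i] => 0).
Proof. by split; exact: integrable0. Qed.

Lemma cintegral0 (R : realType) : cintegral (fun _ : R[i] => 0) = 0.
Proof. by rewrite -(mul0r 0) cintegralZ ?mul0r//; exact: cintble0. Qed.

Lemma cintble_sum (R : realType) (F : nat -> R[i] -> R[i]) n :
  (forall k, cintble (F k)) -> cintble (fun z => \sum_(k < n) F k z).
Proof.
move=> iF; elim: n => [|n IH]; first by under eq_fun do rewrite big_ord0; exact: cintble0.
by under eq_fun do rewrite big_ord_recr /=; exact: cintbleD.
Qed.

Lemma cintegral_sum (R : realType) (F : nat -> R[i] -> R[i]) n :
  (forall k, cintble (F k)) ->
  cintegral (fun z => \sum_(k < n) F k z) = \sum_(k < n) cintegral (F k).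
Proof.
move=> iF; elim: n => [|n IH].
  by rewrite big_ord0; under eq_fun do rewrite big_ord0; exact: cintegral0.
rewrite big_ord_recr /= -IH -cintegralD//; last exact: cintble_sum.
by congr cintegral; apply/funext => z; rewrite big_ord_recr.
Qed.

(** The factor 2 pays for estimating the real and imaginary parts separately. *)
Lemma cintegral_norm (R : realType) (F : R[i] -> R[i]) (g : R[i] -> R) :
  cintble F -> rintble g -> (forall z, cabs (F z) <= g z) ->
  cabs (cintegral F) <= 2 * rint g.
Proof.
move=> [i1 i2] ig Fg; apply: le_trans (cabs_le_ReIm _) _; rewrite /=.
have H1 := rint_norm i1 ig (fun z => le_trans (Re_le_cabs (F z)) (Fg z)).
have H2 := rint_norm i2 ig (fun z => le_trans (Im_le_cabs (F z)) (Fg z)).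
by rewrite mulrDl mul1r; apply: lerD.
Qed.

(** Convergence in modulus, which turns complex limits into limits of real
    sequences. *)
Definition ccvg (R : realType) (u : nat -> R[i]) (l : R[i]) : Prop :=
  (fun n => cabs (u n - l)) @ \oo --> (0 : R).

Lemma ccvgP (R : realType) (u : nat -> R[i]) (l : R[i]) : ccvg u l <->
  forall e : R, 0 < e -> exists N, forall n, (N <= n)%N -> cabs (u n - l) <= e.
Proof.
split=> [/cvgrPdist_le H e /H [N _ HN]|H].
  exists N => n Nn; have := HN n Nn; rewrite /= sub0r normrN ger0_norm//.
  exact: cabs_ge0.
apply/cvgrPdist_le => e /H [N HN]; exists N => // n Nn.
by rewrite /= sub0r normrN ger0_norm ?HN ?cabs_ge0.
Qed.

Lemma ccvg_uniq (R : realType) (u : nat -> R[i]) (l m : R[i]) :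
  ccvg u l -> ccvg u m -> l = m.
Proof.
move=> /ccvgP ul /ccvgP um; apply/eqP; rewrite -subr_eq0 -cabs_eq0.
rewrite eq_le cabs_ge0 andbT; apply/ler_addgt0Pr => e e0; rewrite add0r.
have e2 : 0 < e / 2 by rewrite divr_gt0.
have [N1 H1] := ul _ e2; have [N2 H2] := um _ e2; pose n := maxn N1 N2.
have := H1 n (leq_maxl _ _); have := H2 n (leq_maxr _ _) => h2 h1.
have -> : l - m = (u n - m) - (u n - l) by ring.
by apply: le_trans (cabsB _ _) _; lra.
Qed.

Lemma ccvgD (R : realType) (u v : nat -> R[i]) (l m : R[i]) :
  ccvg u l -> ccvg v m -> ccvg (fun n => u n + v n) (l + m).
Proof.
move=> /ccvgP ul /ccvgP vm; apply/ccvgP => e e0.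
have e2 : 0 < e / 2 by rewrite divr_gt0.
have [N1 H1] := ul _ e2; have [N2 H2] := vm _ e2; exists (maxn N1 N2) => n.
rewrite geq_max => /andP[/H1 h1 /H2 h2].
have -> : u n + v n - (l + m) = (u n - l) + (v n - m) by ring.
by apply: le_trans (cabsD _ _) _; lra.
Qed.

Lemma ccvgZ (R : realType) (c : R[i]) (u : nat -> R[i]) (l : R[i]) :
  ccvg u l -> ccvg (fun n => c * u n) (c * l).
Proof.
move=> /ccvgP ul; apply/ccvgP => e e0.
have c0 : 0 < cabs c + 1 by rewrite ltr_wpDl// cabs_ge0.
have [N H] := ul (e / (cabs c + 1)) (divr_gt0 e0 c0); exists N => n /H h.
rewrite -mulrBr cabsM; apply: le_trans (_ : (cabs c + 1) * (e / (cabs c + 1)) <= _).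
  by apply: ler_pM => //; rewrite ?cabs_ge0// lerDl.
by rewrite mulrC divfK// gt_eqF.
Qed.

Lemma ccvg_cst (R : realType) (c : R[i]) : ccvg (fun=> c) c.
Proof. by apply/ccvgP => e e0; exists 0%N => n _; rewrite subrr cabs0 ltW. Qed.

Lemma ccvg_squeeze (R : realType) (u : nat -> R[i]) (l : R[i]) (v : nat -> R) :
  (forall n, cabs (u n - l) <= v n) -> v @ \oo --> (0 : R) -> ccvg u l.
Proof.
move=> uv v0; apply/ccvgP => e e0; move/cvgrPdist_le : v0 => /(_ _ e0) [N _ HN].
exists N => n Nn; apply: le_trans (uv n) _; have := HN n Nn.
by rewrite /= sub0r normrN; apply: le_trans; rewrite ler_norm.
Qed.

Lemma ccvg_bounded (R : realType) (u : nat -> R[i]) (l : R[i]) (M : R) :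
  ccvg u l -> (forall n, cabs (u n) <= M) -> cabs l <= M.
Proof.
move=> /ccvgP ul uM; apply/ler_addgt0Pr => e /ul [N /(_ N (leqnn N)) h].
rewrite -(subrK (u N) l); apply: le_trans (cabsD _ _) _.
by rewrite addrC; apply: lerD => //; rewrite cabsC.
Qed.

(** Dominated convergence, applied to the moduli of the differences. *)
Lemma cintegral_dominated (R : realType) (F : nat -> R[i] -> R[i]) (G : R[i] -> R[i])
    (g : R[i] -> R) :
  (forall n, cmeas (F n)) -> cmeas G -> rintble g ->
  (forall n z, cabs (F n z) <= g z) -> (forall z, ccvg (F ^~ z) (G z)) ->
  ccvg (fun n => cintegral (F n)) (cintegral G).
Proof.
move=> mF mG ig Fg FG.
have Gg z : cabs (G z) <= g z by apply: ccvg_bounded (FG z) _ => n; exact: Fg.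
have iF n : cintble (F n) by exact: cintble_le (Fg n).
have iG : cintble G by exact: cintble_le Gg.
pose h n z := cabs (F n z - G z).
have mh n : cmeas (fun z => F n z - G z).
  have -> : (fun z => F n z - G z) = (fun z => F n z + (-1) * G z).
    by apply/funext => z; rewrite mulN1r.
  by apply: cmeasD => //; apply: cmeasM => //; exact: cmeas_cst.
have ig2 : rintble (fun z => 2 * g z) by exact: rintbleZ.
have hg n z : `|h n z| <= 2 * g z.
  rewrite ger0_norm ?cabs_ge0//; apply: le_trans (cabsB _ _) _.
  by rewrite mulrDl mul1r; apply: lerD.
have ih n : rintble (h n) by exact: (rintble_le (rmeas_cabs (mh n)) ig2 (hg n)).
apply: (@ccvg_squeeze _ _ _ (fun n => 2 * rint (h n))).
  move=> n; have -> : cintegral (F n) - cintegral G = cintegral (fun z => F n z + (-1) * G z).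
    by rewrite cintegralD//; [rewrite cintegralZ// mulN1r|exact: cintbleZ].
  apply: cintegral_norm => //; first by apply: cintbleD => //; exact: cintbleZ.
  by move=> z; rewrite mulN1r.
suff H : (fun n => rint (h n)) @ \oo --> (0 : R).
  by rewrite -[X in _ --> X](mulr0 2); apply: cvgMr.
have [|||_ _] := @dominated_convergence _ _ R (@dL R) setT measurableT
  (fun n p => (h n (ofpair p))%:E) (fun=> 0%E) (fun p => (2 * g (ofpair p))%:E)
  (fun n => proj2 (measurable_EFinP _ _) (rmeas_cabs (mh n))) _ _ ig2.
- exact: measurable_cst.
- apply: aeW => p _; apply: cvg_EFin; first exact: nearW.
  exact: FG.
- by apply: aeW => p n _; rewrite /= lee_fin.
rewrite integral0 => /fine_cvg; exact.
Qed.

(** * Gaussian weights and the reproducing formula *)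

Lemma integral_EFin_Rintegral d (T : measurableType d) (R : realType)
    (mu : {measure set T -> \bar R}) (D : set T) (f : T -> R) :
  measurable D -> mu.-integrable D (EFin \o f) ->
  (\int[mu]_(x in D) (f x)%:E = (\int[mu]_(x in D) f x)%R%:E)%E.
Proof. by move=> mD hf; rewrite /Rintegral fineK//; exact: integrable_fin_num. Qed.

(** A multiple of the density of a normal distribution. *)
Lemma integrable_gauss1 (R : realType) (c : R) : 0 < c ->
  (@lebesgue_measure R).-integrable setT (fun x => (expR (- (c * x ^+ 2)))%:E).
Proof.
move=> c0; pose s := Num.sqrt (2 * c)^-1.
have c20 : 0 < (2 * c)^-1 by rewrite invr_gt0 mulr_gt0.
have s0 : s != 0 by rewrite gt_eqF// sqrtr_gt0.
have p0 := normal_peak_gt0 s0.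
have := integrableZl measurableT (normal_peak s)^-1 (integrable_normal_pdf 0 s).
congr (_.-integrable _ _); apply/funext => x /=.
rewrite -EFinM normal_pdfE// mulKf ?gt_eqF// /normal_fun subr0; congr (expR _)%:E.
have cn : c != 0 by rewrite gt_eqF.
by rewrite /s sqr_sqrtr ?ltW// -mulr_natr; field.
Qed.

Lemma rintble_gauss0 (R : realType) (c : R) : 0 < c ->
  rintble (fun z : R[i] => expR (- (c * cabs z ^+ 2))).
Proof.
move=> c0; have m : rmeas (fun z : R[i] => expR (- (c * cabs z ^+ 2))).
  apply: (rmeas_comp (@continuous_expR R)); apply: rmeasN; apply: rmeasM; first exact (rmeas_cst c).
  by apply: rmeasX; apply: rmeas_cabs; exact: cmeas_id.
apply/integrable12ltyP; first exact/measurable_EFinP.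
have e0 y : (0 <= (EFin \o (fun y => expR (- (c * y ^+ 2)))) y)%E.
  by rewrite lee_fin expR_ge0.
have ig := integrable_gauss1 c0.
have [/measurable_EFinP mg /= fg] := integrableP _ _ _ ig.
pose I := (\int[@lebesgue_measure R]_x (expR (- (c * x ^+ 2)))%:E)%E.
have IE : (\int[@lebesgue_measure R]_x `|(expR (- (c * x ^+ 2)))%:E|)%E = I.
  by apply: eq_integral => x _; rewrite gee0_abs// lee_fin expR_ge0.
have I0 : (0 <= I)%E by apply: integral_ge0 => x _; rewrite lee_fin expR_ge0.
have Ioo : (I < +oo)%E by rewrite -IE.
rewrite (_ : (\int[_]_x _)%E = I * I)%E; first by rewrite lte_mul_pinfty// ge0_fin_numE.
transitivity (\int[@lebesgue_measure R]_x ((expR (- (c * x ^+ 2)))%:E * I))%E.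
  apply: eq_integral => x _.
  rewrite -(ge0_integralZl _ measurableT (proj2 (measurable_EFinP _ _) mg) (fun y _ => e0 y) (e0 x)).
  apply: eq_integral => y _; rewrite ger0_norm ?expR_ge0//= -EFinM -expRD.
  by rewrite sqr_sqrtr ?addr_ge0 ?sqr_ge0//; congr (expR _)%:E; ring.
by rewrite (ge0_integralZr _ measurableT (proj2 (measurable_EFinP _ _) mg) (fun y _ => e0 y) I0).
Qed.

(** Half of the quadratic exponent absorbs the linear one. *)
Lemma rintble_gauss (R : realType) (c B : R) : 0 < c ->
  rintble (fun z : R[i] => expR (B * cabs z - c * cabs z ^+ 2)).
Proof.
move=> c0; have c20 : 0 < c / 2 by rewrite divr_gt0.
have ic := rintbleZ (expR (B ^+ 2 / (2 * c))) (rintble_gauss0 c20).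
apply: rintble_le ic _.
  apply: (rmeas_comp (@continuous_expR R)); have mc := rmeas_cabs (cmeas_id R).
  apply: rmeasD; first by apply: rmeasM => //; exact (rmeas_cst B).
  by apply: rmeasN; apply: rmeasM; [exact (rmeas_cst c)|exact: rmeasX].
move=> z; rewrite ger0_norm ?expR_ge0// -expRD ler_expR.
have -> : B ^+ 2 / (2 * c) - c / 2 * cabs z ^+ 2 =
  B * cabs z - c * cabs z ^+ 2 + (B - c * cabs z) ^+ 2 / (2 * c).
  have cn : c != 0 by rewrite gt_eqF.
  by field.
by rewrite lerDl divr_ge0 ?sqr_ge0// mulr_ge0// ltW.
Qed.

Lemma cmul_pair (R : realType) (e : R[i]) (x y : R) :
  e * (x +i* y) = (complex.Re e * x - complex.Im e * y) +i*
                  (complex.Im e * x + complex.Re e * y).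
Proof. by case: e => a b /=; simpc; rewrite [b * x + _]addrC. Qed.

Lemma rint_rot (R : realType) (g : R[i] -> R) (e : R[i]) : cabs e = 1 -> rintble g ->
  rintble (fun w => g (e * w)) /\ rint (fun w => g (e * w)) = rint g.
Proof.
move=> e1 ig; have cs : complex.Re e ^+ 2 + complex.Im e ^+ 2 = 1.
  by rewrite -cabs_sqr e1 expr1n.
have HP := preserves_rotation cs.
have E : (fun w => g (e * w)) \o @ofpair R =
    (g \o @ofpair R) \o (fun p : R * R => ((complex.Re e * p.1 - complex.Im e * p.2)%R,
      (complex.Im e * p.1 + complex.Re e * p.2)%R)).
  by apply/funext => -[x y] /=; congr g; rewrite /ofpair /= cmul_pair.
split; first by have := preserves_integrable HP ig; rewrite -E.
rewrite /rint -[RHS](preserves_Rintegral HP ig).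
by apply: eq_Rintegral => p _; have := congr1 (fun h => h p) E.
Qed.

Lemma rint_shift (R : realType) (g : R[i] -> R) (c : R[i]) : rintble g ->
  rintble (fun w => g (w + c)) /\ rint (fun w => g (w + c)) = rint g.
Proof.
move=> ig; have HP := preserves_translation (complex.Re c) (complex.Im c).
have E : (fun w => g (w + c)) \o @ofpair R =
    (g \o @ofpair R) \o (fun p : R * R => ((p.1 + complex.Re c)%R, (p.2 + complex.Im c)%R)).
  by apply/funext => -[x y] /=; congr g; rewrite /ofpair /=; case: (c) => a b; simpc.
split; first by have := preserves_integrable HP ig; rewrite -E.
rewrite /rint -[RHS](preserves_Rintegral HP ig).
by apply: eq_Rintegral => p _; have := congr1 (fun h => h p) E.
Qed.

Lemma cintegral_shift (R : realType) (F : R[i] -> R[i]) (c : R[i]) :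
  cintble F -> cintegral (fun w => F (w + c)) = cintegral F.
Proof.
move=> [i1 i2]; have [_ E1] := rint_shift c i1; have [_ E2] := rint_shift c i2.
by rewrite !cintegralE E1 E2.
Qed.

Lemma cabs_rot (R : realType) (t : R) : cabs (crot t) = 1.
Proof. by rewrite /cabs /= cos2Dsin2 sqrtr1. Qed.

(** Makes sigma-finiteness of the product available to the Fubini theorem, which
    is applied with this product as one of its factors. *)
Definition sigma_finite_prod d1 d2 (T1 : measurableType d1) (T2 : measurableType d2)
    (R : realType) (m1 : {sigma_finite_measure set T1 -> \bar R})
    (m2 : {sigma_finite_measure set T2 -> \bar R}) :
  {sigma_finite_measure set (T1 * T2)%type -> \bar R} :=
  HB.pack (m1 \x m2)%E
    (lebesgue_integral_fubini.measure_function_Measure_isSigmaFinite__to__measure_function_isSigmaFinite m1 m2)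
    (lebesgue_integral_fubini.measure_function_Measure_isSigmaFinite__to__measure_function_isSFinite m1 m2).

(** Averaging over all rotations of the plane replaces [g] by its circle means,
    hence by its value at the centre. *)
Lemma radial_mean_Re (R : realType) (g : R[i] -> R[i]) (rho : R -> R) :
  holo g -> cmeas g -> rintble (fun w => rho (cabs w)) ->
  rintble (fun w => complex.Re (g w) * rho (cabs w)) ->
  rint (fun w => complex.Re (g w) * rho (cabs w)) =
  complex.Re (g 0) * rint (fun w : R[i] => rho (cabs w)).
Proof.
move=> hg [mg _] irho iH.
set H := (fun w => complex.Re (g w) * rho (cabs w)) in iH *.
pose D : set R := `[0, 2 * pi]%classic.
have pi20 : 0 <= 2 * pi :> R by rewrite mulr_ge0// pi_ge0.
have mD : measurable (D : set (measurableTypeR R)) by exact: measurable_itv.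
have muD : lebesgue_measure (D : set (measurableTypeR R)) = (2 * pi)%:E.
  rewrite /D lebesgue_measure_itv/= lte_fin oppr0 adde0.
  by move: pi20; rewrite le_eqVlt => /predU1P[<-|->]//; rewrite ltxx.
(* [H] turned by the angle [q.1]: integrating first over the plane gives back
   the integral of [H], first over the angle the circle means of [g]. *)
pose K (q : R * (R * R)) := H (crot q.1 * ofpair q.2) * \1_D q.1.
have mK : measurable_fun [set: measurableTypeR R * (measurableTypeR R * measurableTypeR R)] K.
  have mt : measurable_fun [set: measurableTypeR R * (measurableTypeR R * measurableTypeR R)]
    (fun q => q.1 : measurableTypeR R) by exact: measurable_fst.
  have mx : measurable_fun [set: measurableTypeR R * (measurableTypeR R * measurableTypeR R)]
    (fun q => q.2.1 : measurableTypeR R).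
    exact (measurableT_comp measurable_fst measurable_snd).
  have my : measurable_fun [set: measurableTypeR R * (measurableTypeR R * measurableTypeR R)]
    (fun q => q.2.2 : measurableTypeR R).
    exact (measurableT_comp measurable_snd measurable_snd).
  have mc := measurableT_comp (continuous_measurable_fun (@continuous_cos R)) mt.
  have ms := measurableT_comp (continuous_measurable_fun (@continuous_sin R)) mt.
  apply: measurable_funM; last by apply: measurableT_comp => //; exact: measurable_indic.
  have mP : measurable_fun [set: measurableTypeR R * (measurableTypeR R * measurableTypeR R)]
    (fun q : R * (R * R) => ((cos q.1 * q.2.1 - sin q.1 * q.2.2)%R,
       (sin q.1 * q.2.1 + cos q.1 * q.2.2)%R) : measurableTypeR R * measurableTypeR R).
    apply/measurable_fun_pair.
      by apply: measurable_funB; exact: measurable_funM.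
    by apply: measurable_funD; exact: measurable_funM.
  have := measurableT_comp (rintble_meas iH) mP.
  congr measurable_fun; apply/funext => -[t [x y]] /=; congr H.
  by rewrite /ofpair /= cmul_pair.
have inner1 t : (\int[@dL R]_p (K (t, p))%:E = (rint H * \1_D t)%:E)%E.
  have [ir Er] := rint_rot (cabs_rot t) iH.
  have -> : (\int[@dL R]_p (K (t, p))%:E = (\int[@dL R]_p (K (t, p)))%R%:E)%E.
    apply: integral_EFin_Rintegral => //.
    exact (integrableZr measurableT (\1_D t) ir).
  by rewrite /K /= RintegralZr// -Er.
have inner1' t : (\int[@dL R]_p `|(K (t, p))%:E| = (rint (fun w => `|H w|) * \1_D t)%:E)%E.
  have [ir Er] := rint_rot (cabs_rot t) (rintble_norm iH).
  under eq_integral => p _.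
    rewrite abse_EFin /K /= normrM (ger0_norm (_ : 0 <= \1_D t))//; over.
  have -> : (\int[@dL R]_p (`|H (crot t * ofpair p)| * \1_D t)%:E =
    (\int[@dL R]_p (`|H (crot t * ofpair p)| * \1_D t))%R%:E)%E.
    apply: integral_EFin_Rintegral => //.
    exact (integrableZr measurableT (\1_D t) ir).
  by rewrite RintegralZr// -Er.
have outer (c : R) : (\int[@lebesgue_measure R]_t (c * \1_D t)%:E = (c * (2 * pi))%:E)%E.
  under eq_integral do rewrite EFinM.
  rewrite integralZl//; last first.
    exact: integrable_indic_itv.
  rewrite integral_indic// setIT [RHS]EFinM; congr (_ * _)%E.
  exact: muD.
pose L := sigma_finite_prod (@lebesgue_measure R) (@lebesgue_measure R).
have inner1x t : (\int[L]_p (K (t, p))%:E = (rint H * \1_D t)%:E)%E := inner1 t.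
have inner1x' t : (\int[L]_p `|(K (t, p))%:E| =
  (rint (fun w => `|H w|) * \1_D t)%:E)%E := inner1' t.
have iK : ((@lebesgue_measure R) \x L)%E.-integrable setT (fun q => (K q)%:E).
  apply/integrable12ltyP; first exact/measurable_EFinP.
  under eq_integral do rewrite inner1x'.
  by rewrite outer ltry.
have := Fubini iK.
under eq_integral do rewrite inner1x.
rewrite outer.
have inner2 p : (\int[@lebesgue_measure R]_t (K (t, p))%:E =
    (complex.Re (g 0) * (2 * pi) * rho (cabs (ofpair p)))%:E)%E.
  pose h w := g (w * ofpair p).
  have hh : holo h.
    by apply: (holo_comp hg); apply: holoM; [exact: holo_id|exact: holo_cst].
  have cm := circle_mean hh; rewrite {2}/h mul0r in cm.
  rewrite -cm mulrC.
  have ih := seg_integrable 0 (2 * pi) (circle_continuous hh).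
  rewrite EFinM /seg_int -integral_EFin_Rintegral// -integralZl//.
  rewrite [RHS]integral_mkcond epatch_indic.
  apply: eq_integral => t _.
  have -> : K (t, p) = complex.Re (g (crot t * ofpair p)) * rho (cabs (ofpair p)) * \1_D t.
    by rewrite /K /H cabsM cabs_rot mul1r.
  by rewrite -!EFinM /h; congr (_%:E); rewrite /= [rho _ * _]mulrC.
under [X in _ = X -> _]eq_integral do rewrite inner2.
have -> : (\int[L]_p (complex.Re (g 0) * (2 * pi) * rho (cabs (ofpair p)))%:E =
  (\int[@dL R]_p (complex.Re (g 0) * (2 * pi) * rho (cabs (ofpair p))))%R%:E)%E.
  apply: integral_EFin_Rintegral => //.
  exact (integrableZl measurableT (complex.Re (g 0) * (2 * pi)) irho).
rewrite RintegralZl// => -[E].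
have pn : 2 * pi != 0 :> R by rewrite gt_eqF// mulr_gt0// pi_gt0.
by apply: (mulIf pn); rewrite E mulrAC.
Qed.

Lemma radial_mean (R : realType) (g : R[i] -> R[i]) (rho : R -> R) :
  holo g -> cmeas g -> rintble (fun w => rho (cabs w)) ->
  cintble (fun w => g w * (rho (cabs w))%:C) ->
  cintegral (fun w => g w * (rho (cabs w))%:C) =
  g 0 * (rint (fun w : R[i] => rho (cabs w)))%:C.
Proof.
move=> hg mg irho [i1 i2]; rewrite cintegralE.
have e1 : (fun w => complex.Re (g w * (rho (cabs w))%:C)) =
    (fun w => complex.Re (g w) * rho (cabs w)).
  by apply/funext => w; rewrite cReM /= mulr0 subr0.
have e2 : (fun w => complex.Im (g w * (rho (cabs w))%:C)) =
    (fun w => complex.Re (- 'i * g w) * rho (cabs w)).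
  by apply/funext => w; rewrite cImM /=; case: (g w) => a b; simpc.
rewrite e1 in i1 *; rewrite e2 in i2 *.
rewrite radial_mean_Re// (@radial_mean_Re _ (fun w => - 'i * g w))//.
- by case: (g 0) => a b; simpc.
- by apply: holoM => //; exact: holo_cst.
- by apply: cmeasM => //; exact: cmeas_cst.
Qed.

(** The reproducing formula of the Bargmann-Fock space, for the weight
    [exp (- c |w|^2)]: the mean value property of
    [w |-> f (z + w) exp (- c conj(z) w)], translated back by [z]. *)
Lemma reproducing (R : realType) (f : R[i] -> R[i]) (c : R) (z : R[i]) : 0 < c ->
  holo f -> cmeas f ->
  (forall B, rintble (fun w => cabs (f w) * expR (B * cabs w - c * cabs w ^+ 2))) ->
  cintegral (fun w => f w * cexp (c%:C * z * conjc w) * (expR (- (c * cabs w ^+ 2)))%:C) =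
  f z * (rint (fun w : R[i] => expR (- (c * cabs w ^+ 2))))%:C.
Proof.
move=> c0 hf mf ifB.
pose F w := f w * cexp (c%:C * z * conjc w) * (expR (- (c * cabs w ^+ 2)))%:C.
have mF : cmeas F.
  apply: cmeasM; first apply: cmeasM => //.
    apply: cmeas_cexp; apply: cmeasM; first exact: cmeas_cst.
    by apply: cmeas_conj; exact: cmeas_id.
  apply: cmeas_real; apply: (rmeas_comp (@continuous_expR R)); apply: rmeasN.
  by apply: rmeasM; [exact (rmeas_cst c)|apply: rmeasX; apply: rmeas_cabs; exact: cmeas_id].
have iF : cintble F.
  apply: (cintble_le mF (ifB (c * cabs z))) => w.
  rewrite /F !cabsM cabs_cexp cabs_real (ger0_norm (expR_ge0 _)) -mulrA -expRD.
  rewrite ler_wpM2l ?cabs_ge0// ler_expR lerD2r.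
  apply: le_trans (ler_norm _) _; apply: le_trans (Re_le_cabs _) _.
  by rewrite !cabsM cabs_conj cabs_real gtr0_norm.
rewrite -[LHS](cintegral_shift z iF).
pose g w := f (w + z) * cexp (- (c%:C * conjc z * w)).
(* Complete the square in the exponent. *)
have E w : F (w + z) = g w * (expR (- (c * cabs w ^+ 2)))%:C.
  rewrite /F /g -!mulrA; congr (_ * _).
  have cR (x : R) : (expR x)%:C = cexp x%:C.
    by rewrite /cexp /= cos0 sin0 mulr1 mulr0.
  rewrite !cR -!cexpD; congr cexp.
  have cN (x : R) : (- (c * x))%:C = - (c%:C * x%:C) by simpc.
  have cD : conjc (w + z) = conjc w + conjc z by case: (w) (z) => [? ?] [? ?]; simpc; rewrite -opprD.
  by rewrite !cN -!mulc_conj cD; ring.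
have hg : holo g.
  apply: holoM; first by apply: (holo_comp hf); apply: holoD; [exact: holo_id|exact: holo_cst].
  apply: (holo_comp (@holo_cexp R)).
  have -> : (fun w => - (c%:C * conjc z * w)) = (fun w => (- (c%:C * conjc z)) * w).
    by apply/funext => w; rewrite mulNr.
  by apply: holoM; [exact: holo_cst|exact: holo_id].
have -> : (fun w => F (w + z)) = (fun w => g w * (expR (- (c * cabs w ^+ 2)))%:C).
  by apply/funext => w; exact: E.
have mg : cmeas g.
  apply: cmeasM; last first.
    apply: cmeas_cexp.
    have -> : (fun w => - (c%:C * conjc z * w)) = (fun w => (- (c%:C * conjc z)) * w).
      by apply/funext => w; rewrite mulNr.
    by apply: cmeasM; [exact: cmeas_cst|exact: cmeas_id].
  have [mP _] := preserves_translation (complex.Re z) (complex.Im z).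
  case: mf => m1 m2; split.
    have := measurableT_comp m1 mP; congr measurable_fun.
    by apply/funext => -[x y] /=; rewrite /ofpair /=; congr (complex.Re (f _)); case: (z) => a b; simpc.
  have := measurableT_comp m2 mP; congr measurable_fun.
  by apply/funext => -[x y] /=; rewrite /ofpair /=; congr (complex.Im (f _)); case: (z) => a b; simpc.
rewrite (@radial_mean _ g (fun r => expR (- (c * r ^+ 2))))//.
- by rewrite /g add0r mulr0 oppr0 cexp0 mulr1.
- exact: rintble_gauss0.
- have [i1 i2] := iF; have [j1 _] := rint_shift z i1; have [j2 _] := rint_shift z i2.
  split.
    by move: j1; congr rintble; apply/funext => w; rewrite E.
  by move: j2; congr rintble; apply/funext => w; rewrite E.
Qed.

(** * The exponential series *)

Lemma eps_is_derive (R : realType) (f : R -> R) (x d : R) :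
  (forall e : R, 0 < e -> exists2 del : R, 0 < del &
    forall h, `|h| < del -> `|f (x + h) - f x - d * h| <= e * `|h|) ->
  is_derive x 1 f d.
Proof.
move=> H.
have C : h^-1 *: ((f \o shift x) (h *: (1 : R^o)) - f x) @[h --> 0^'] --> (d : R^o).
  apply/cvgrPdist_le => e e0; have [del del0 Hd] := H e e0.
  rewrite /dnbhs near_withinE; apply/nbhs_ballP; exists del => //= h hd h0.
  have {}hd : `|h| < del by move: hd; rewrite -ball_normE /= sub0r normrN.
  rewrite /GRing.scale /= mulr1 -(ler_pM2r (_ : 0 < `|h|)) ?normr_gt0//.
  apply: le_trans (Hd _ hd); rewrite -normrM -[X in _ <= X]normrN.
  rewrite le_eqVlt; apply/orP; left; apply/eqP; congr `| _ |.
  by rewrite mulrBl mulrAC mulVf// mul1r (addrC h x); ring.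
by apply: DeriveDef; [apply/cvg_ex; exists d|exact/cvg_lim].
Qed.

Lemma cderiv_line (R : realType) (f : R[i] -> R[i]) (w v d : R[i]) (t : R) :
  cderiv f (w + t%:C * v) d ->
  is_derive t 1 (fun s : R => complex.Re (f (w + s%:C * v))) (complex.Re (d * v)) /\
  is_derive t 1 (fun s : R => complex.Im (f (w + s%:C * v))) (complex.Im (d * v)).
Proof.
move=> fd.
have K : cderiv (fun s => f (w + s * v)) t%:C (d * v).
  have gd : cderiv (fun s => w + s * v) t%:C (0 + (1 * v + t%:C * 0)).
    apply: cderivD; first exact: cderiv_cst.
    by apply: cderivM; [exact: cderiv_id|exact: cderiv_cst].
  by have := @cderiv_comp _ f (fun s => w + s * v) _ _ _ fd gd; rewrite mul1r mulr0 addr0 add0r.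
split; apply: eps_is_derive => e e0; have [del del0 H] := K e e0;
    (exists del => // h hd; have {}hd : cabs h%:C < del by rewrite cabs_real).
  - apply: le_trans (_ : e * cabs h%:C <= _); last by rewrite cabs_real.
    apply: le_trans (H _ hd); apply: le_trans (Re_le_cabs _); rewrite !cReB.
    rewrite (_ : (t + h)%:C = t%:C + h%:C); last by simpc.
    by rewrite [complex.Re (d * v * _)]cReM [complex.Im h%:C]/= mulr0 subr0.
  - apply: le_trans (_ : e * cabs h%:C <= _); last by rewrite cabs_real.
    apply: le_trans (H _ hd); apply: le_trans (Im_le_cabs _); rewrite !cImB.
    rewrite (_ : (t + h)%:C = t%:C + h%:C); last by simpc.
    by rewrite [complex.Im (d * v * _)]cImM [complex.Im h%:C]/= mulr0 add0r.
Qed.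

(** The real mean value theorem for both parts along the segment, which explains
    the factor 2. *)
Lemma cderiv_mvt (R : realType) (f d : R[i] -> R[i]) (w v : R[i]) (M : R) :
  (forall t : R, 0 <= t <= 1 -> cderiv f (w + t%:C * v) (d (w + t%:C * v)) /\
     cabs (d (w + t%:C * v)) <= M) ->
  cabs (f (w + v) - f w) <= 2 * (M * cabs v).
Proof.
move=> H; apply: le_trans (cabs_le_ReIm _) _; rewrite cReB cImB mulrDl mul1r.
have bound (g g' : R -> R) :
    (forall t : R, 0 <= t <= 1 -> is_derive t 1 g (g' t) /\ `|g' t| <= M * cabs v) ->
    `|g 1 - g 0| <= M * cabs v.
  move=> gP; have [||c] := @MVT_segment R g g' 0 1 ler01.
  - by move=> t; rewrite in_itv/= => /andP[t0 t1]; apply: (gP t _).1; rewrite !ltW.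
  - apply: derivable_within_continuous => t; rewrite in_itv/= => t01.
    by have [gd _] := gP t t01; exact: ex_derive.
  by rewrite in_itv/= subr0 mulr1 => c01 ->; exact: (gP c c01).2.
apply: lerD.
- have := bound (fun s => complex.Re (f (w + s%:C * v)))
    (fun s => complex.Re (d (w + s%:C * v) * v)).
  rewrite mul1r mul0r addr0; apply=> t /H [fd dM].
  split; first exact: (cderiv_line fd).1.
  by apply: le_trans (Re_le_cabs _) _; rewrite cabsM ler_wpM2r ?cabs_ge0.
- have := bound (fun s => complex.Im (f (w + s%:C * v)))
    (fun s => complex.Im (d (w + s%:C * v) * v)).
  rewrite mul1r mul0r addr0; apply=> t /H [fd dM].
  split; first exact: (cderiv_line fd).2.
  by apply: le_trans (Im_le_cabs _) _; rewrite cabsM ler_wpM2r ?cabs_ge0.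
Qed.

Lemma cderivX (R : realType) n (z : R[i]) :
  cderiv (fun w => w ^+ n) z (n%:R * z ^+ n.-1).
Proof.
elim: n => [|n IH].
  by rewrite mul0r; under eq_fun do rewrite expr0; exact: cderiv_cst.
under eq_fun do rewrite exprS.
have -> : n.+1%:R * z ^+ n.+1.-1 = 1 * z ^+ n + z * (n%:R * z ^+ n.-1) :> R[i].
  case: n {IH} => [|n] /=; first by rewrite expr0 mul0r mulr0 addr0.
  by rewrite [in RHS]mulrCA -exprS -mulrDl nat1r.
exact (cderivM (cderiv_id z) IH).
Qed.

Definition exp_poly (R : realType) (N : nat) (z : R[i]) : R[i] :=
  \sum_(k < N) (k`!%:R)^-1 * z ^+ k.

Lemma fact_neq0 (R : realType) n : n`!%:R != 0 :> R[i].
Proof. by rewrite pnatr_eq0 -lt0n fact_gt0. Qed.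

Lemma cderiv_exp_poly (R : realType) N (z : R[i]) :
  cderiv (exp_poly N.+1) z (exp_poly N z).
Proof.
elim: N => [|N IH].
  rewrite /exp_poly big_ord0; under eq_fun do rewrite big_ord1 expr0.
  exact: cderiv_cst.
rewrite [exp_poly N.+1 z]/exp_poly big_ord_recr /= -/(exp_poly N z).
rewrite (_ : exp_poly N.+2 =
  fun w => exp_poly N.+1 w + (N.+1`!%:R)^-1 * w ^+ N.+1); last first.
  by apply/funext => w; rewrite /exp_poly [LHS]big_ord_recr.
apply: cderivD => //.
have -> : (N`!%:R)^-1 * z ^+ N =
    0 * z ^+ N.+1 + (N.+1`!%:R)^-1 * (N.+1%:R * z ^+ N.+1.-1) :> R[i].
  rewrite mul0r add0r factS natrM invfM mulrA; congr (_ * _).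
  by rewrite mulrAC mulVf ?mul1r// pnatr_eq0.
exact (cderivM (cderiv_cst _ z) (cderivX N.+1 z)).
Qed.

Lemma sum_exp_le (R : realType) N (x : R) : 0 <= x ->
  \sum_(k < N) x ^+ k / k`!%:R <= expR x.
Proof.
move=> x0; have := @nondecreasing_cvgn_le R (series (exp_coeff x)).
move=> /(_ _ (is_cvg_series_exp_coeff x) N).
rewrite /series /= big_mkord; apply.
move=> m n mn; rewrite -subr_ge0 /series /=.
by rewrite sub_series_geq// sumr_ge0// => k _; exact: exp_coeff_ge0.
Qed.

Lemma cabs_nat (R : realType) n : cabs (n%:R : R[i]) = n%:R.
Proof.
by rewrite -[n%:R]/(n%:R) (_ : n%:R = (n%:R)%:C) ?cabs_real ?normr_nat// rmorph_nat.
Qed.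

Lemma exp_poly_bound (R : realType) N (z : R[i]) :
  cabs (exp_poly N z) <= expR (cabs z).
Proof.
apply: le_trans (cabs_sum _ _ _) _; apply: le_trans (sum_exp_le N (cabs_ge0 z)).
by apply: ler_sum => k _; rewrite cabsM cabsV cabs_nat cabsX mulrC.
Qed.

(** The function [exp_poly N.+1 w * exp (- w)] has derivative
    [- w ^ N / N! * exp (- w)], built on a single term of the series, so the mean
    value inequality bounds its distance to [1]. *)
Lemma exp_poly_cvg (R : realType) (z : R[i]) : ccvg (fun N => exp_poly N z) (cexp z).
Proof.
suff H : ccvg (fun N => exp_poly N.+1 z) (cexp z).
  by move: H; rewrite /ccvg (cvg_shiftS (fun N => cabs (exp_poly N z - cexp z))).
pose C := expR (cabs z) * (2 * (expR (cabs z) * cabs z)).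
apply: (@ccvg_squeeze _ _ _ (fun N => C * exp_coeff (cabs z) N)); last first.
  by rewrite -[X in _ --> X](mulr0 C); apply: cvgMr; exact: cvg_exp_coeff.
move=> N; pose f (w : R[i]) := exp_poly N.+1 w * cexp (- w).
pose d (w : R[i]) : R[i] := - ((N`!%:R)^-1 * w ^+ N * cexp (- w)).
have fd w : cderiv f w (d w).
  have -> : d w = exp_poly N w * cexp (- w) + exp_poly N.+1 w * (cexp (- w) * -1).
    rewrite /d [exp_poly N.+1 w]/exp_poly big_ord_recr /= -/(exp_poly N w); ring.
  apply: (@cderivM _ _ (fun w => cexp (- w)) _ _ _ (cderiv_exp_poly N w)).
  apply: (@cderiv_comp _ (@cexp R) (fun w => - w)); first exact: cderiv_cexp.
  have := cderivM (@cderiv_cst R (-1) w) (@cderiv_id R w).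
  rewrite mul0r add0r mulr1; congr cderiv.
  by apply/funext => s; rewrite mulN1r.
pose M := expR (cabs z) * exp_coeff (cabs z) N.
have := @cderiv_mvt _ f d 0 z M.
rewrite add0r => H.
have {}H : cabs (f z - f 0) <= 2 * (M * cabs z).
  apply: H => t /andP[t0 t1]; split; first exact: fd.
  rewrite add0r /d cabsN !cabsM cabsV cabs_nat cabsX cabs_cexp cabsM cabs_real ger0_norm//.
  rewrite mulrC; apply: ler_pM; rewrite ?expR_ge0//.
  - by rewrite mulr_ge0 ?invr_ge0// exprn_ge0// mulr_ge0// cabs_ge0.
  - rewrite ler_expR; apply: le_trans (ler_norm _) _; apply: le_trans (Re_le_cabs _) _.
    by rewrite cabsN cabsM cabs_real ger0_norm// ler_piMl// cabs_ge0.
  - rewrite /exp_coeff /= mulrC ler_wpM2r ?invr_ge0//.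
    by rewrite lerXn2r// ?nnegrE ?mulr_ge0 ?cabs_ge0// ler_piMl// cabs_ge0.
have f0 : f 0 = 1.
  rewrite /f oppr0 cexp0 mulr1 /exp_poly big_ord_recl /= expr0 fact0 invr1 mulr1.
  by rewrite big1 ?addr0// => k _; rewrite expr0n mulr0.
have -> : exp_poly N.+1 z - cexp z = cexp z * (f z - f 0).
  rewrite f0 /f mulrBr mulr1 mulrCA -cexpD subrr cexp0 mulr1 //.
rewrite cabsM cabs_cexp /C -!mulrA; apply: ler_pM; rewrite ?expR_ge0 ?cabs_ge0//.
  by rewrite ler_expR (le_trans (ler_norm _))// Re_le_cabs.
by apply: le_trans H _; rewrite /M; apply: ler_wpM2l => //; rewrite -mulrA [_ * cabs z]mulrC.
Qed.

(** * Power series from the reproducing formula *)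

(** The partial sums of the absolute series are bounded at every radius, so the
    power series converges on the whole plane. *)
Definition entire_coef (R : realType) (a : nat -> R[i]) : Prop :=
  forall r : R, 0 <= r -> exists M, forall N, \sum_(k < N) cabs (a k) * r ^+ k <= M.

Definition sums_to (R : realType) (a : nat -> R[i]) (f : R[i] -> R[i]) : Prop :=
  forall z, ccvg (fun N => \sum_(k < N) a k * z ^+ k) (f z).

(** Dividing by [z] shifts the coefficients; that the shifted series vanishes at
    [0] too follows by letting [z] tend to [0], its tail being bounded by a
    multiple of [z]. *)
Lemma pseries_uniq (R : realType) (d : nat -> R[i]) :
  entire_coef d -> sums_to d (fun=> 0) -> forall n, d n = 0.
Proof.
have first (c : nat -> R[i]) : sums_to c (fun=> 0) -> c 0%N = 0.
  move=> c0; apply: (@ccvg_uniq _ (fun N => \sum_(k < N) c k * 0 ^+ k)); last exact: c0.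
  apply/ccvgP => e e0; exists 1%N => -[//|N] _.
  rewrite big_ord_recl expr0 mulr1 big1 ?addr0 ?subrr ?cabs0 ?ltW// => k _.
  by rewrite expr0n mulr0.
move=> dM d0 n; elim: n d dM d0 => [|n IH] d dM d0; first exact: first.
have z0 := first d d0.
have dM' (r : R) : 0 <= r -> exists M, forall N, \sum_(k < N) cabs (d k.+1) * r ^+ k <= M.
  move=> r0; have [M HM] := dM (r + 1) (addr_ge0 r0 ler01); exists M => N.
  apply: le_trans (HM N.+1); rewrite big_ord_recl z0 cabs0 mul0r add0r.
  apply: ler_sum => k _; rewrite ler_wpM2l ?cabs_ge0// lift0 exprS.
  apply: le_trans (_ : (r + 1) ^+ k <= _).
    by rewrite lerXn2r ?nnegrE ?addr_ge0// lerDl.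
  by rewrite ler_peMl ?exprn_ge0 ?addr_ge0// lerDr.
have nz z : z != 0 -> ccvg (fun N => \sum_(k < N) d k.+1 * z ^+ k) 0.
  move=> zn0; rewrite -[X in ccvg _ X](mulr0 z^-1).
  have -> : (fun N => \sum_(k < N) d k.+1 * z ^+ k) =
      (fun N => z^-1 * (\sum_(k < N.+1) d k * z ^+ k)).
    apply/funext => N; rewrite big_ord_recl z0 mul0r add0r mulr_sumr.
    by apply: eq_bigr => k _; rewrite lift0 exprS [z^-1 * _]mulrC mulrA -(mulrA _ z) mulrCA; field.
  apply: ccvgZ; have := d0 z.
  by rewrite /ccvg -(cvg_shiftS (fun N => cabs (\sum_(k < N) d k * z ^+ k - 0))).
apply: (IH (fun k => d k.+1)) => // z.
have [->|] := eqVneq z 0; last exact: nz.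
have d10 : d 1%N = 0.
  apply/eqP; rewrite -cabs_eq0 eq_le cabs_ge0 andbT.
  have [M HM] := dM' 1 ler01.
  have M0 : 0 <= M by have := HM 0%N; rewrite big_ord0.
  apply/ler_addgt0Pr => e e0; rewrite add0r.
  pose t := Num.min 1 (e / 2 / (M + 1)).
  have t0 : 0 < t by rewrite lt_min ltr01 !divr_gt0// ltr_wpDl.
  have t1 : t <= 1 by rewrite ge_min lexx.
  have tM : t * M <= e / 2.
    apply: le_trans (_ : t * (M + 1) <= _); first by rewrite ler_wpM2l ?ltW// ltrDl.
    by rewrite -ler_pdivlMr ?ltr_wpDl// ge_min lexx orbT.
  have tn0 : t%:C != 0 by rewrite -cabs_eq0 cabs_real gt_eqF// normr_gt0 gt_eqF.
  have /ccvgP/(_ (e / 2) (divr_gt0 e0 (ltr0Sn _ 1)))[N HN] := nz _ tn0.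
  have := HN N.+1 (leqnSn N); rewrite subr0 big_ord_recl /= expr0 mulr1.
  set s := \sum_(i < N) _ => hs.
  have ss : cabs s <= t * M.
    apply: le_trans (cabs_sum _ _ _) _.
    apply: (@le_trans _ _ (t * \sum_(k < N.+1) cabs (d k.+1) * 1 ^+ k)); last first.
      by rewrite ler_wpM2l// ltW.
    rewrite big_ord_recl mulrDr mulr_sumr.
    apply: le_trans (_ : \sum_(i < N) t * (cabs (d (bump 0 i).+1) * 1 ^+ bump 0 i) <= _).
      apply: ler_sum => k _; rewrite cabsM cabsX cabs_real (gtr0_norm t0) expr1n mulr1.
      rewrite mulrC ler_wpM2r ?cabs_ge0// /bump /= add1n exprS.
      by apply: ler_piMr; [exact: ltW|apply: exprn_ile1 => //; exact: ltW].
    by rewrite lerDr; apply: mulr_ge0; [exact: ltW|rewrite expr1n mulr1 cabs_ge0].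
  rewrite -(addrK s (d 1%N)); apply: le_trans (cabsB _ _) _; lra.
apply/ccvgP => e e0; exists 0%N => -[|N] _; first by rewrite big_ord0 subrr cabs0 ltW.
rewrite big_ord_recl d10 mul0r add0r big1 ?subrr ?cabs0 ?ltW// => k _.
by rewrite expr0n mulr0.
Qed.

Lemma rintble_kernel (R : realType) (v : R[i] -> R[i]) n :
  cmeas v -> (forall B, rintble (fun w => cabs (v w) * expR (B * cabs w))) ->
  cintble (fun w => v w * conjc w ^+ n).
Proof.
move=> mv iv; apply: (cintble_le _ (rintbleZ (n`!%:R) (iv 1))).
  apply: cmeasM => //; apply: cmeasX; apply: cmeas_conj; exact: cmeas_id.
move=> w; rewrite cabsM mulrCA ler_wpM2l ?cabs_ge0// cabsX cabs_conj mul1r.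
have := sum_exp_le n.+1 (cabs_ge0 w); rewrite big_ord_recr /= => h.
rewrite mulrC -ler_pdivrMr ?ltr0n ?fact_gt0//; apply: le_trans h; rewrite lerDr.
by apply: sumr_ge0 => k _; rewrite divr_ge0// exprn_ge0// cabs_ge0.
Qed.

(** Expanding the exponential turns an integral against [exp (z conj w)] into a
    power series in [z]. *)
Lemma exp_kernel_expand (R : realType) (v : R[i] -> R[i]) (z : R[i]) :
  cmeas v -> (forall B, rintble (fun w => cabs (v w) * expR (B * cabs w))) ->
  ccvg (fun N => \sum_(n < N) ((n`!%:R)^-1 * cintegral (fun w => v w * conjc w ^+ n)) * z ^+ n)
    (cintegral (fun w => v w * cexp (z * conjc w))).
Proof.
move=> mv iv; have iK n := rintble_kernel n mv iv.
have mc : cmeas (fun w : R[i] => z * conjc w).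
  by apply: cmeasM; [exact: cmeas_cst|apply: cmeas_conj; exact: cmeas_id].
have mE N : cmeas (fun w => exp_poly N (z * conjc w)).
  apply: (cmeas_sum (F := fun k w => (k`!%:R)^-1 * (z * conjc w) ^+ k)) => k.
  by apply: cmeasM; [exact: cmeas_cst|exact: cmeasX].
have -> : (fun N => \sum_(n < N) ((n`!%:R)^-1 *
      cintegral (fun w => v w * conjc w ^+ n)) * z ^+ n) =
    (fun N => cintegral (fun w => v w * exp_poly N (z * conjc w))).
  apply/funext => N.
  pose F k w := (k`!%:R)^-1 * z ^+ k * (v w * conjc w ^+ k).
  have -> : (fun w => v w * exp_poly N (z * conjc w)) = (fun w => \sum_(k < N) F k w).
    apply/funext => w; rewrite mulr_sumr; apply: eq_bigr => k _.
    by rewrite /F exprMn; ring.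
  rewrite cintegral_sum; last by move=> k; exact: cintbleZ.
  by apply: eq_bigr => k _; rewrite cintegralZ// mulrAC.
apply: (cintegral_dominated (g := fun w => cabs (v w) * expR (cabs z * cabs w))) => //.
- by move=> N; exact: cmeasM.
- by apply: cmeasM => //; exact: cmeas_cexp.
- move=> N w; rewrite cabsM ler_wpM2l ?cabs_ge0//; apply: le_trans (exp_poly_bound _ _) _.
  by rewrite cabsM cabs_conj.
- by move=> w; apply: ccvgZ; exact: exp_poly_cvg.
Qed.

(** The series of [exp_kernel_expand] converges absolutely everywhere. *)
Lemma exp_kernel_bound (R : realType) (v : R[i] -> R[i]) (r : R) N : 0 <= r ->
  cmeas v -> (forall B, rintble (fun w => cabs (v w) * expR (B * cabs w))) ->
  \sum_(n < N) cabs ((n`!%:R)^-1 * cintegral (fun w => v w * conjc w ^+ n)) * r ^+ n <=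
    2 * rint (fun w => cabs (v w) * expR (r * cabs w)).
Proof.
move=> r0 mv iv; have iK n := rintble_kernel n mv iv.
pose g n w := r ^+ n / n`!%:R * cabs (v w * conjc w ^+ n).
have ig n : rintble (g n) by apply: rintbleZ; exact: rintble_cabs.
apply: (@le_trans _ _ (\sum_(n < N) 2 * rint (g n))).
  apply: ler_sum => n _; rewrite cabsM cabsV cabs_nat.
  rewrite /g rintZ; last exact: rintble_cabs.
  rewrite mulrAC [_^-1 * _]mulrC [leRHS]mulrCA ler_wpM2l ?divr_ge0 ?exprn_ge0//.
  by apply: cintegral_norm => //; exact: rintble_cabs.
rewrite -mulr_sumr ler_wpM2l//.
have [H1 H2] : rintble (fun w => \sum_(n < N) g n w) /\
    rint (fun w => \sum_(n < N) g n w) = \sum_(n < N) rint (g n).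
  elim: N => [|N [IH1 IH2]].
    under eq_fun do rewrite big_ord0; rewrite big_ord0.
    by split; [exact: integrable0|rewrite /rint Rintegral_cst// mul0r].
  under eq_fun do rewrite big_ord_recr /=; rewrite big_ord_recr /= -IH2.
  by split; [exact: rintbleD|rewrite -rintD].
rewrite -H2; apply: rint_le => // w.
rewrite /g; under eq_bigr do rewrite cabsM cabsX cabs_conj mulrCA.
rewrite -mulr_sumr ler_wpM2l ?cabs_ge0//.
apply: le_trans (sum_exp_le N (mulr_ge0 r0 (cabs_ge0 w))).
by apply: ler_sum => n _; rewrite exprMn mulrAC.
Qed.

Definition gauss (R : realType) (c : R) (w : R[i]) : R := expR (- (c * cabs w ^+ 2)).

Lemma gauss_gt0 (R : realType) (c : R) w : 0 < gauss c w.
Proof. exact: expR_gt0. Qed.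

Lemma rmeas_gauss (R : realType) (c : R) : rmeas (gauss c).
Proof.
apply: (rmeas_comp (@continuous_expR R)); apply: rmeasN.
by apply: rmeasM; [exact (rmeas_cst c)|apply: rmeasX; apply: rmeas_cabs; exact: cmeas_id].
Qed.

(** The Gaussian is bounded below on the unit square. *)
Lemma rint_gauss_gt0 (R : realType) (c : R) : 0 < c -> 0 < rint (gauss c).
Proof.
move=> c0; pose I : set (measurableTypeR R) := `[0, 1]%classic.
pose A : set (measurableTypeR R * measurableTypeR R) := I `*` I.
have mI : measurable I by exact: measurable_itv.
have mA : measurable A by exact: measurableX.
have muI : lebesgue_measure I = 1%E.
  by rewrite /I lebesgue_measure_itv/= lte_fin ltr01 oppr0 adde0.
have muA : dL A = 1%E.
  rewrite /dL product_measure1E//; transitivity (lebesgue_measure I * lebesgue_measure I)%E => //.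
  by rewrite muI mule1.
pose h (z : R[i]) : R := \1_A (complex.Re z, complex.Im z).
have hle z : `|h z| <= expR (c * 2) * gauss c z.
  rewrite /gauss -expRD ger0_norm// /h indicE.
  have [|_] := boolP (_ \in A); last by rewrite expR_ge0.
  rewrite inE => -[/= /andP[x0 x1] /andP[y0 y1]].
  rewrite -[1%:R]expR0 ler_expR -mulrBr cabs_sqr.
  apply: mulr_ge0; first exact: ltW.
  rewrite subr_ge0.
  have : complex.Re z ^+ 2 <= 1 by rewrite expr_le1.
  have : complex.Im z ^+ 2 <= 1 by rewrite expr_le1.
  lra.
have mh : rmeas h.
  by rewrite /rmeas (_ : (fun p => _) = \1_A)//; apply/funext => -[].
have ig := rintble_gauss0 c0.
have ih : rintble h by exact: rintble_le (rintbleZ _ ig) hle.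
have h1 : rint h = 1.
  rewrite /rint /Rintegral (_ : (fun p => _) = (fun p => (\1_A p)%:E)); last first.
    by apply/funext => -[].
  rewrite integral_indic// setIT; transitivity (fine (dL A)) => //.
  by rewrite muA.
have : 1 <= expR (c * 2) * rint (gauss c).
  rewrite -[leLHS]h1 -rintZ//; apply: rint_le => //; first exact: rintbleZ.
  by move=> z; apply: le_trans (hle z); exact: ler_norm.
have e0 := expR_gt0 (c * 2).
move=> h2; rewrite -(pmulr_rgt0 _ e0); exact: lt_le_trans h2.
Qed.

(** A power is dominated by an exponential. *)
Lemma rintble_monomial (R : realType) (c B : R) m : 0 < c ->
  rintble (fun w : R[i] => cabs w ^+ m * expR (B * cabs w - c * cabs w ^+ 2)).
Proof.
move=> c0; apply: (rintble_le _ (rintbleZ m`!%:R (rintble_gauss (B + 1) c0))).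
  have mc := rmeas_cabs (cmeas_id R).
  apply: rmeasM; first exact: rmeasX.
  apply: (rmeas_comp (@continuous_expR R)).
  apply: rmeasD; first by apply: rmeasM => //; exact (rmeas_cst B).
  by apply: rmeasN; apply: rmeasM; [exact (rmeas_cst c)|exact: rmeasX].
move=> w; rewrite ger0_norm; last by rewrite mulr_ge0 ?exprn_ge0 ?cabs_ge0 ?expR_ge0.
have -> : (B + 1) * cabs w - c * cabs w ^+ 2 =
  cabs w + (B * cabs w - c * cabs w ^+ 2) by ring.
rewrite expRD mulrA ler_wpM2r ?expR_ge0//.
have := sum_exp_le m.+1 (cabs_ge0 w); rewrite big_ord_recr /= => h.
rewrite mulrC -ler_pdivrMr ?ltr0n ?fact_gt0//; apply: le_trans h; rewrite lerDr.
by apply: sumr_ge0 => k _; rewrite divr_ge0// exprn_ge0// cabs_ge0.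
Qed.

(** The Taylor coefficient of an entire [f], as its inner product with a
    monomial for the weight [gauss c], normalised by [gauss_moment]. *)
Definition gauss_coef (R : realType) (c : R) (f : R[i] -> R[i]) (n : nat) : R[i] :=
  (rint (gauss c))%:C^-1 * (c ^+ n)%:C * ((n`!%:R)^-1 *
    cintegral (fun w => f w * (gauss c w)%:C * conjc w ^+ n)).

(** The reproducing formula as a power series; the coefficients are the inner
    products with the monomials. *)
Lemma reproducing_series (R : realType) (f : R[i] -> R[i]) (c : R) : 0 < c ->
  holo f -> cmeas f ->
  (forall B, rintble (fun w => cabs (f w) * expR (B * cabs w - c * cabs w ^+ 2))) ->
  entire_coef (gauss_coef c f) /\ sums_to (gauss_coef c f) f.
Proof.
move=> c0 hf mf ifB; pose v w := f w * (gauss c w)%:C.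
have mv : cmeas v by apply: cmeasM => //; apply: cmeas_real; exact: rmeas_gauss.
have iv B : rintble (fun w => cabs (v w) * expR (B * cabs w)).
  move: (ifB B); congr rintble; apply/funext => w.
  rewrite /v cabsM cabs_real (gtr0_norm (gauss_gt0 _ _)) -mulrA; congr (_ * _).
  by rewrite /gauss -expRD addrC.
have J0 := rint_gauss_gt0 c0.
have Jn0 : (rint (gauss c))%:C != 0 by rewrite -cabs_eq0 cabs_real gt_eqF// normr_gt0 gt_eqF.
split=> [r r0|z].
  have cr0 : 0 <= c * r by rewrite mulr_ge0// ltW.
  have cn0 k : 0 <= c ^+ k by rewrite exprn_ge0// ltW.
  exists ((rint (gauss c))^-1 * (2 * rint (fun w => cabs (v w) * expR (c * r * cabs w)))) => N.
  apply: le_trans (ler_wpM2l _ (exp_kernel_bound N cr0 mv iv)); last by rewrite invr_ge0 ltW.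
  rewrite mulr_sumr; apply: ler_sum => k _.
  rewrite /gauss_coef -/(v) !cabsM cabsV !cabs_real (gtr0_norm J0) (ger0_norm (cn0 _)).
  by rewrite exprMn le_eqVlt; apply/orP; left; apply/eqP; rewrite /v; ring.
have H := reproducing z c0 hf mf ifB.
have -> : f z = (rint (gauss c))%:C^-1 * cintegral (fun w => v w * cexp (c%:C * z * conjc w)).
  rewrite [cintegral _](_ : _ = f z * (rint (gauss c))%:C).
    by rewrite mulrC mulfK.
  by rewrite -H; congr cintegral; apply/funext => w; rewrite /v mulrAC.
have -> : (fun N => \sum_(k < N) gauss_coef c f k * z ^+ k) = (fun N => (rint (gauss c))%:C^-1 *
    (\sum_(n < N) ((n`!%:R)^-1 * cintegral (fun w => v w * conjc w ^+ n)) * (c%:C * z) ^+ n)).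
  apply/funext => N; rewrite mulr_sumr; apply: eq_bigr => k _.
  by rewrite /gauss_coef -/(v) exprMn rmorphXn /=; ring.
by apply: ccvgZ; exact: exp_kernel_expand.
Qed.

Lemma sum_delta (A : nzRingType) (F : nat -> A) m N :
  \sum_(k < N) ((k : nat) == m)%:R * F k = (m < N)%N%:R * F m.
Proof.
elim: N => [|N IH]; first by rewrite big_ord0 mul0r.
rewrite big_ord_recr /= IH.
have [mN|Nm|->] := ltngtP m N; last by rewrite ltnSn mul0r add0r.
  by rewrite ltnS (ltnW mN) mul0r addr0.
by rewrite ltnS leqNgt Nm !mul0r addr0.
Qed.

(** By uniqueness the expansion of a monomial given by [reproducing_series] is
    the trivial one; its coefficients are the moments. *)
Lemma gauss_moment (R : realType) (c : R) m n : 0 < c ->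
  cintegral (fun w : R[i] => w ^+ m * (gauss c w)%:C * conjc w ^+ n) =
  if m == n then (rint (gauss c) * n`!%:R / c ^+ n)%:C else 0.
Proof.
move=> c0; have J0 := rint_gauss_gt0 c0.
have [|||dM dz] := @reproducing_series R (fun w => w ^+ m) c c0.
- exact: holoX.
- by apply: cmeasX; exact: cmeas_id.
- by move=> B; under eq_fun do rewrite cabsX; exact: rintble_monomial.
set d := gauss_coef _ _ in dM dz.
pose d' k := d k - (k == m)%:R.
have sumE N z : \sum_(k < N) d' k * z ^+ k =
    \sum_(k < N) d k * z ^+ k - (m < N)%:R * z ^+ m.
  rewrite /d'; under eq_bigr do rewrite mulrBl.
  by rewrite sumrB sum_delta.
have : d' n = 0.
  apply: pseries_uniq => [r r0|z].
    have [M HM] := dM r r0; exists (M + r ^+ m) => N.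
    apply: (@le_trans _ _ (\sum_(k < N) (cabs (d k) * r ^+ k + ((k : nat) == m)%:R * r ^+ k))).
      apply: ler_sum => k _; rewrite -mulrDl ler_wpM2r ?exprn_ge0//.
      by apply: le_trans (cabsB _ _) _; rewrite cabs_nat.
    rewrite big_split /=; apply: lerD; first exact: HM.
    rewrite [leLHS](_ : _ = (m < N)%N%:R * r ^+ m); last first.
      exact: (sum_delta (fun k => r ^+ k)).
    by case: ltnP => _; rewrite ?mul1r// mul0r exprn_ge0.
  have /ccvgP H := dz z; apply/ccvgP => e /H [N HN]; exists (maxn N m.+1) => k.
  rewrite geq_max => /andP[/HN h mk]; rewrite sumE mk mul1r subr0.
  exact: h.
move=> /eqP; rewrite subr_eq0 => /eqP; rewrite /d /gauss_coef => E.
have Jn0 : (rint (gauss c))%:C != 0 by rewrite -cabs_eq0 cabs_real gt_eqF// normr_gt0 gt_eqF.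
have cn0 : (c ^+ n)%:C != 0.
  by rewrite -cabs_eq0 cabs_real gt_eqF// normr_gt0 gt_eqF// exprn_gt0.
have -> : cintegral (fun w : R[i] => w ^+ m * (gauss c w)%:C * conjc w ^+ n) =
   (n == m)%:R * ((rint (gauss c))%:C * n`!%:R / (c ^+ n)%:C).
  rewrite -E; have fn0 := fact_neq0 R n.
  set x := cintegral _; set y := (rint (gauss c))%:C in Jn0 *.
  set t := (c ^+ n)%:C in cn0 *; set u := (n`!%:R : R[i]) in fn0 *.
  clearbody x y t u; field; first by rewrite Jn0 cn0 fn0.
rewrite eq_sym; case: eqP => _; last by rewrite mul0r.
rewrite mul1r rmorphM fmorphV rmorphM /=; congr (_ * _ * _).
by rewrite rmorph_nat.
Qed.

(** * Coefficients of entire functions *)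

Lemma entire_coefD (R : realType) (a b : nat -> R[i]) :
  entire_coef a -> entire_coef b -> entire_coef (fun n => a n + b n).
Proof.
move=> ha hb r r0; have [M HM] := ha r r0; have [M' HM'] := hb r r0.
exists (M + M') => N; apply: le_trans (lerD (HM N) (HM' N)); rewrite -big_split /=.
by apply: ler_sum => k _; rewrite -mulrDl ler_wpM2r ?exprn_ge0// cabsD.
Qed.

Lemma entire_coefZ (R : realType) (c : R[i]) (a : nat -> R[i]) :
  entire_coef a -> entire_coef (fun n => c * a n).
Proof.
move=> ha r r0; have [M HM] := ha r r0.
exists (cabs c * M) => N; apply: le_trans (ler_wpM2l (cabs_ge0 c) (HM N)).
by rewrite mulr_sumr; apply: ler_sum => k _; rewrite cabsM mulrA.
Qed.

Lemma entire_coef_nat (R : realType) (a : nat -> R[i]) :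
  entire_coef a -> entire_coef (fun n => n%:R * a n).
Proof.
move=> ha r r0; have [M HM] := ha (2 * r) (mulr_ge0 (ler0n R _) r0).
exists M => N; apply: le_trans (HM N); apply: ler_sum => k _.
rewrite cabsM cabs_nat exprMn -mulrA mulrCA ler_wpM2l ?cabs_ge0//.
by rewrite ler_wpM2r ?exprn_ge0// -natrX ler_nat ltnW// ltn_expl.
Qed.

Lemma sums_toD (R : realType) (a b : nat -> R[i]) f g :
  sums_to a f -> sums_to b g -> sums_to (fun n => a n + b n) (fun z => f z + g z).
Proof.
move=> ha hb z; have := ccvgD (ha z) (hb z).
congr ccvg; apply/funext => N; rewrite -big_split /=.
by apply: eq_bigr => k _; rewrite mulrDl.
Qed.

Lemma sums_toZ (R : realType) (c : R[i]) (a : nat -> R[i]) f :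
  sums_to a f -> sums_to (fun n => c * a n) (fun z => c * f z).
Proof.
move=> ha z; have := ccvgZ c (ha z).
congr ccvg; apply/funext => N; rewrite mulr_sumr.
by apply: eq_bigr => k _; rewrite mulrA.
Qed.

Lemma sums_to_inj (R : realType) (a b : nat -> R[i]) f :
  entire_coef a -> entire_coef b -> sums_to a f -> sums_to b f -> a = b.
Proof.
move=> ha hb af bf; apply/funext => n; apply/eqP; rewrite -subr_eq0 -mulN1r.
apply/eqP; apply: (pseries_uniq (d := fun n => a n + (-1) * b n)).
  exact (entire_coefD ha (entire_coefZ (-1) hb)).
move=> z; have := sums_toD af (sums_toZ (-1) bf) z.
by rewrite mulN1r subrr.
Qed.

(** The quadratic remainder, with a constant growing geometrically in [n] so
    that it sums against the coefficients of an entire function. *)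
Lemma taylor_monomial (R : realType) (z h : R[i]) (rho : R) n :
  cabs z <= rho -> cabs (z + h) <= rho -> 1 <= rho ->
  cabs ((z + h) ^+ n - z ^+ n - n%:R * z ^+ n.-1 * h) <= cabs h ^+ 2 * (n%:R ^+ 2 * rho ^+ n).
Proof.
move=> zr zhr r1; have r0 : 0 <= rho by apply: le_trans r1.
elim: n => [|n IH].
  by rewrite !expr0 subrr mul0r mul0r subrr cabs0 expr0n mul0r mulr0.
have -> : (z + h) ^+ n.+1 - z ^+ n.+1 - n.+1%:R * z ^+ n.+1.-1 * h =
    (z + h) * ((z + h) ^+ n - z ^+ n - n%:R * z ^+ n.-1 * h) + n%:R * z ^+ n.-1 * h ^+ 2.
  rewrite -nat1r /= !exprS; case: n {IH} => [|n] /=; first by rewrite !expr0; ring.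
  by rewrite !exprS; ring.
apply: le_trans (cabsD _ _) _; rewrite !cabsM !cabsX cabs_nat.
apply: (@le_trans _ _ (rho * (cabs h ^+ 2 * (n%:R ^+ 2 * rho ^+ n)) +
    n%:R * rho ^+ n * cabs h ^+ 2)).
  apply: lerD; first by apply: ler_pM; rewrite ?cabs_ge0.
  apply: ler_wpM2r; first exact: sqr_ge0.
  apply: ler_wpM2l => //; apply: (@le_trans _ _ (rho ^+ n.-1)).
    by rewrite lerXn2r// nnegrE cabs_ge0.
  by rewrite ler_weXn2l// leq_pred.
have -> : rho * (cabs h ^+ 2 * (n%:R ^+ 2 * rho ^+ n)) + n%:R * rho ^+ n * cabs h ^+ 2 =
  cabs h ^+ 2 * (rho ^+ n * (n%:R ^+ 2 * rho + n%:R)) by ring.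
rewrite ler_wpM2l ?sqr_ge0//.
have -> : n.+1%:R ^+ 2 * rho ^+ n.+1 = rho ^+ n * (n.+1%:R ^+ 2 * rho).
  by rewrite (exprS rho); ring.
rewrite ler_wpM2l ?exprn_ge0// -natr1; have n0 : 0 <= n%:R :> R by [].
have : n%:R <= n%:R * rho by rewrite ler_peMr.
have -> : (n%:R + 1) ^+ 2 * rho = n%:R ^+ 2 * rho + n%:R * rho + (n%:R * rho + rho) by ring.
have : 0 <= n%:R * rho + rho by rewrite addr_ge0// mulr_ge0.
lra.
Qed.

(** Termwise differentiation: the quadratic Taylor remainders of the partial
    sums are bounded uniformly. *)
Lemma sums_to_deriv (R : realType) (a : nat -> R[i]) (f d : R[i] -> R[i]) :
  entire_coef a -> sums_to a f -> (forall z, cderiv f z (d z)) ->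
  sums_to (fun n => n%:R * a n) (fun z => z * d z).
Proof.
move=> ha af fd z.
suff H : ccvg (fun N => \sum_(k < N) a k * (k%:R * z ^+ k.-1)) (d z).
  have := ccvgZ z H; congr ccvg; apply/funext => N; rewrite mulr_sumr.
  apply: eq_bigr => -[[|k] _] _ /=; first by rewrite !mul0r !mulr0.
  by rewrite exprS; ring.
pose rho := cabs z + 1; have z0 := cabs_ge0 z.
have rho1 : 1 <= rho by rewrite /rho lerDr.
have rho0 : 0 <= rho by apply: le_trans rho1.
(* The factor [4 ^ k] absorbs the factor [k ^ 2] of the Taylor remainders. *)
have [M HM] := ha (4 * rho) (mulr_ge0 (ler0n R _) rho0).
have M0 : 0 <= M by have := HM 0%N; rewrite big_ord0.
pose F N w := \sum_(k < N) a k * w ^+ k.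
have rem N h : cabs h <= 1 ->
    cabs (F N (z + h) - F N z - (\sum_(k < N) a k * (k%:R * z ^+ k.-1)) * h) <= M * cabs h ^+ 2.
  move=> h1.
  have -> : F N (z + h) - F N z - (\sum_(k < N) a k * (k%:R * z ^+ k.-1)) * h =
      \sum_(k < N) a k * ((z + h) ^+ k - z ^+ k - k%:R * z ^+ k.-1 * h).
    by rewrite /F mulr_suml -!sumrB; apply: eq_bigr => k _; ring.
  apply: le_trans (cabs_sum _ _ _) _; apply: le_trans (ler_wpM2r (sqr_ge0 _) (HM N)).
  rewrite mulr_suml; apply: ler_sum => k _; rewrite cabsM -[leRHS]mulrA ler_wpM2l ?cabs_ge0//.
  apply: le_trans (taylor_monomial _ _ _ rho1) _.
  - by rewrite /rho lerDl.
  - by apply: le_trans (cabsD _ _) _; rewrite /rho lerD2l.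
  rewrite mulrC ler_wpM2r ?sqr_ge0// exprMn ler_wpM2r ?exprn_ge0//.
  rewrite -natrX -natrX ler_nat (_ : 4 ^ k = (2 ^ k) ^ 2)%N; last first.
    by rewrite -expnM mulnC expnM.
  by rewrite leq_exp2r// ltnW// ltn_expl.
apply/ccvgP => e e0.
have e4 : 0 < e / 4 by rewrite divr_gt0.
have [del del0 Hd] := fd z _ e4.
pose t := Num.min (del / 2) (Num.min 1 (e / 4 / (M + 1))).
have M1 : 0 < M + 1 by rewrite ltr_wpDl.
have t0 : 0 < t by rewrite !lt_min !divr_gt0// ltr01.
have t1 : t <= 1 by rewrite !ge_min lexx !orbT.
have td : t < del by rewrite gt_min; apply/orP; left; lra.
have tM : M * t <= e / 4.
  apply: (@le_trans _ _ (t * (M + 1))).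
    by rewrite mulrC ler_wpM2l ?(ltW t0)// lerDl.
  by rewrite -ler_pdivlMr// !ge_min lexx !orbT.
have ct : cabs t%:C = t by rewrite cabs_real gtr0_norm.
have e4t : 0 < e / 4 * t by rewrite mulr_gt0.
have /ccvgP/(_ _ e4t)[N1 H1] := af (z + t%:C).
have /ccvgP/(_ _ e4t)[N2 H2] := af z.
exists (maxn N1 N2) => N; rewrite geq_max => /andP[/H1 h1 /H2 h2].
have h3 := Hd t%:C; rewrite ct in h3; have {}h3 := h3 td.
have h4 := rem N t%:C; rewrite ct in h4; have {}h4 := h4 t1.
rewrite -(ler_pM2r t0) -{1}ct -cabsM.
set D := \sum_(k < N) _ in h4 *.
have -> : (D - d z) * t%:C = - (F N (z + t%:C) - F N z - D * t%:C)
  + (F N (z + t%:C) - f (z + t%:C)) - (F N z - f z) + (f (z + t%:C) - f z - d z * t%:C).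
  by ring.
apply: le_trans (cabsD _ _) _.
apply: le_trans (lerD (cabsB _ _) (lexx _)) _.
apply: le_trans (lerD (lerD (cabsD _ _) (lexx _)) (lexx _)) _.
rewrite cabsN.
have h5 : M * t ^+ 2 <= e / 4 * t by rewrite expr2 mulrA ler_wpM2r// ltW.
rewrite -/(F N (z + t%:C)) in h1; rewrite -/(F N z) in h2.
have -> : e * t = e / 4 * t + e / 4 * t + e / 4 * t + e / 4 * t by field.
apply: lerD => //; apply: lerD => //; apply: lerD => //.
exact: le_trans h4 h5.
Qed.

(** Cauchy-Schwarz against the exponential series, in the form of the inequality
    of arithmetic and geometric means for each term. *)
Lemma coef_growth (R : realType) (a : nat -> R[i]) (A q r : R) N :
  0 < q -> 0 <= r -> (forall N, \sum_(k < N) k`!%:R * cabs (a k) ^+ 2 / q ^+ k <= A) ->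
  \sum_(k < N) cabs (a k) * r ^+ k <= (A + 1) / 2 * expR (q * r ^+ 2 / 2).
Proof.
move=> q0 r0 HA; pose K := expR (q * r ^+ 2 / 2).
have K0 : 0 < K by exact: expR_gt0.
have KK : K * K = expR (q * r ^+ 2) by rewrite -expRD -splitr.
apply: (@le_trans _ _ (\sum_(k < N) ((K * (k`!%:R * cabs (a k) ^+ 2 / q ^+ k) +
    K^-1 * ((q * r ^+ 2) ^+ k / k`!%:R)) / 2))).
  apply: ler_sum => k _; rewrite ler_pdivlMr//.
  have f0 : 0 < k`!%:R :> R by rewrite ltr0n fact_gt0.
  have q0k : 0 < q ^+ k by rewrite exprn_gt0.
  (* The weight that makes both squares balance. *)
  pose s := K * k`!%:R / q ^+ k; have s0 : 0 < s by rewrite divr_gt0// mulr_gt0.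
  have -> : K * (k`!%:R * cabs (a k) ^+ 2 / q ^+ k) + K^-1 * ((q * r ^+ 2) ^+ k / k`!%:R) =
    cabs (a k) * r ^+ k * 2 + (s * cabs (a k) - r ^+ k) ^+ 2 / s.
    rewrite exprMn exprAC /s; field.
    by rewrite !gt_eqF.
  by rewrite lerDl divr_ge0 ?sqr_ge0// ltW.
rewrite -mulr_suml big_split /= -!mulr_sumr -/K.
have -> : (A + 1) / 2 * K = (K * A + K) / 2 by field.
rewrite ler_wpM2r ?invr_ge0//; apply: lerD; first by rewrite ler_wpM2l ?(ltW K0)//; exact: HA.
have := sum_exp_le N (mulr_ge0 (ltW q0) (sqr_ge0 r)); rewrite -KK => h.
by rewrite mulrC ler_pdivrMr.
Qed.

(** * Functions of the Bargmann-Fock space *)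

Lemma entire_holo (R : realType) (f : R[i] -> R[i]) : entire f -> holo f.
Proof. by move=> fe z; exact: entire_cderiv. Qed.

Lemma cexp_real (R : realType) (x : R) : cexp x%:C = (expR x)%:C.
Proof. by rewrite /cexp /= cos0 sin0 mulr1 mulr0. Qed.

Lemma real_cM (R : realType) (x y : R) : (x * y)%:C = x%:C * y%:C.
Proof. by simpc. Qed.

Lemma real_c_nat (R : realType) n : (n%:R : R)%:C = n%:R.
Proof. exact: rmorph_nat. Qed.

Lemma real_c_sum (R : realType) (F : nat -> R) N :
  (\sum_(n < N) F n)%:C = \sum_(n < N) (F n)%:C.
Proof. exact: rmorph_sum. Qed.

Lemma bargmann_fock_holo (R : realType) (u : R[i] -> R[i]) : bargmann_fock u ->
  exists f, [/\ holo f, cmeas f, (forall z, u z = (expR (- (cabs z ^+ 2 / 2)))%:C * f z) &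
    rintble (fun w => cabs (f w) ^+ 2 * gauss 1 w)].
Proof.
move=> [[f fe uE] [m1 m2 iu]]; exists f.
have mu : cmeas u by split.
have fE : f = fun z => (expR (cabs z ^+ 2 / 2))%:C * u z.
  apply/funext => z; rewrite uE mulrA -rmorphM /= -expRD subrr expR0.
  by rewrite (_ : 1%:C = 1) ?mul1r.
have mf : cmeas f.
  rewrite fE; apply: cmeasM => //; apply: cmeas_real.
  apply: (rmeas_comp (@continuous_expR R)).
  apply: rmeasM; last exact (rmeas_cst 2^-1).
  by apply: rmeasX; apply: rmeas_cabs; exact: cmeas_id.
split => //; first exact: entire_holo.
have E w : cabs (f w) ^+ 2 * gauss 1 w = cabs (u w) ^+ 2.
  rewrite uE cabsM cabs_real ger0_norm ?expR_ge0// exprMn mulrC; congr (_ * _).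
  by rewrite /gauss -expRM_natl; congr expR; field.
apply/integrableP; split.
  apply/measurable_EFinP; apply: (@rmeasM _ (fun w => cabs (f w) ^+ 2)).
    by apply: rmeasX; exact: rmeas_cabs.
  exact: rmeas_gauss.
rewrite (_ : (\int[_]_x _)%E = (\int[@dL R]_(p in setT) ((cabs (u (ofpair p)) ^+ 2)%:E))%E)//.
by apply: eq_integral => p _; rewrite /= E ger0_norm// sqr_ge0.
Qed.

(** The product of two square integrable functions, by the inequality of
    arithmetic and geometric means. *)
Lemma rintble_L2_exp (R : realType) (f : R[i] -> R[i]) B : cmeas f ->
  rintble (fun w => cabs (f w) ^+ 2 * gauss 1 w) ->
  rintble (fun w => cabs (f w) * expR (B * cabs w - 1 * cabs w ^+ 2)).
Proof.
move=> mf i2.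
apply: (rintble_le _ (rintbleD i2 (rintble_gauss (2 * B) (ltr01)))).
  apply: rmeasM; first exact: rmeas_cabs.
  have mc := rmeas_cabs (cmeas_id R).
  apply: (rmeas_comp (@continuous_expR R)).
  apply: rmeasD; first by apply: rmeasM => //; exact (rmeas_cst B).
  by apply: rmeasN; apply: rmeasM; [exact (rmeas_cst 1)|exact: rmeasX].
move=> w; rewrite ger0_norm ?mulr_ge0 ?cabs_ge0 ?expR_ge0//.
have -> : expR (B * cabs w - 1 * cabs w ^+ 2) = expR (B * cabs w) * gauss 1 w.
  by rewrite -expRD.
have -> : expR (2 * B * cabs w - 1 * cabs w ^+ 2) = expR (B * cabs w) ^+ 2 * gauss 1 w.
  by rewrite -expRM_natl -expRD mulrA.
rewrite mulrA -mulrDl ler_wpM2r ?(ltW (gauss_gt0 _ _))//.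
have := sqr_ge0 (cabs (f w) - expR (B * cabs w)).
have := mulr_ge0 (cabs_ge0 (f w)) (expR_ge0 (B * cabs w)).
by rewrite sqrrB; lra.
Qed.

(** Bessel's inequality: with [p] a partial sum of the expansion of [f],
    integrate the pointwise inequality [Re (conj p * (2 f - p)) <= |f| ^ 2]. *)
Lemma bessel (R : realType) (f : R[i] -> R[i]) N : cmeas f ->
  rintble (fun w => cabs (f w) ^+ 2 * gauss 1 w) ->
  rint (gauss 1 : R[i] -> R) * \sum_(n < N) n`!%:R * cabs (gauss_coef 1 f n) ^+ 2 <=
  rint (fun w => cabs (f w) ^+ 2 * gauss 1 w).
Proof.
move=> mf i2; set J := rint (gauss 1); pose a := gauss_coef 1 f.
have J0 : 0 < J by exact: rint_gauss_gt0.
have Jn0 : J%:C != 0 by rewrite -cabs_eq0 cabs_real gt_eqF// normr_gt0 gt_eqF.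
have aE n : cintegral (fun w => f w * (gauss 1 w)%:C * conjc w ^+ n) =
    J%:C * n`!%:R * a n.
  rewrite /a /gauss_coef expr1n -/J (_ : 1%:C = 1)//.
  have fn0 := fact_neq0 R n.
  by rewrite mulr1 mulrACA mulfV// mul1r mulVKf.
have mg : cmeas (fun w : R[i] => (gauss 1 w)%:C).
  by apply: cmeas_real; exact: rmeas_gauss.
have iv (g : R[i] -> R[i]) n : cmeas g ->
    (forall B, rintble (fun w => cabs (g w) * expR (B * cabs w - 1 * cabs w ^+ 2))) ->
    cintble (fun w => g w * (gauss 1 w)%:C * conjc w ^+ n).
  move=> mg' ig; apply: rintble_kernel; first exact: cmeasM.
  move=> B; move: (ig B); congr rintble; apply/funext => w.
  by rewrite cabsM cabs_real (gtr0_norm (gauss_gt0 _ _)) -mulrA -expRD addrC.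
have if_ n : cintble (fun w => f w * (gauss 1 w)%:C * conjc w ^+ n).
  by apply: iv => // B; exact: rintble_L2_exp.
have im m n : cintble (fun w : R[i] => w ^+ m * (gauss 1 w)%:C * conjc w ^+ n).
  apply: (iv (fun w : R[i] => w ^+ m) n) => [|B]; first by apply: cmeasX; exact: cmeas_id.
  by under eq_fun do rewrite cabsX; exact: rintble_monomial.
pose p w := \sum_(m < N) a m * w ^+ m.
have pE n w : p w * (gauss 1 w)%:C * conjc w ^+ n =
    \sum_(m < N) a m * (w ^+ m * (gauss 1 w)%:C * conjc w ^+ n).
  by rewrite /p !mulr_suml; apply: eq_bigr => m _; ring.
have ip n : cintble (fun w => p w * (gauss 1 w)%:C * conjc w ^+ n).
  under eq_fun do rewrite pE.
  apply: (cintble_sum (F := fun m w => a m * (w ^+ m * (gauss 1 w)%:C * conjc w ^+ n))) => m.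
  exact: cintbleZ.
have cp n : (n < N)%N -> cintegral (fun w => p w * (gauss 1 w)%:C * conjc w ^+ n) =
    J%:C * n`!%:R * a n.
  move=> nN; under eq_fun do rewrite pE.
  rewrite (cintegral_sum (F := fun m w => a m * (w ^+ m * (gauss 1 w)%:C * conjc w ^+ n)));
    last by move=> m; exact: cintbleZ.
  under eq_bigr => m _ do rewrite cintegralZ// gauss_moment//.
  rewrite (bigD1 (Ordinal nN)) //= eqxx big1 ?addr0; last first.
    move=> m mn; rewrite ifN ?mulr0//.
  rewrite expr1n divr1 rmorphM /= rmorph_nat -/J; ring.
pose H w := \sum_(n < N) conjc (a n) * (2 * (f w * (gauss 1 w)%:C * conjc w ^+ n) +
    (-1) * (p w * (gauss 1 w)%:C * conjc w ^+ n)).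
have iH1 n : cintble (fun w => 2 * (f w * (gauss 1 w)%:C * conjc w ^+ n) +
    (-1) * (p w * (gauss 1 w)%:C * conjc w ^+ n)).
  by apply: cintbleD; exact: cintbleZ.
have iH : cintble H.
  apply: (cintble_sum (F := fun n w => conjc (a n) * (2 * (f w * (gauss 1 w)%:C * conjc w ^+ n) +
    (-1) * (p w * (gauss 1 w)%:C * conjc w ^+ n)))) => n.
  exact: cintbleZ.
have HE w : H w = conjc (p w) * (2 * f w - p w) * (gauss 1 w)%:C.
  have -> : conjc (p w) = \sum_(n < N) conjc (a n) * conjc w ^+ n.
    rewrite /p (rmorph_sum (@conjc R)); apply: eq_bigr => n _.
    by rewrite rmorphM rmorphXn.
  by rewrite /H; move: (p w) => y; rewrite 2!mulr_suml; apply: eq_bigr => n _; ring.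
have cH : cintegral H = (J * \sum_(n < N) n`!%:R * cabs (a n) ^+ 2)%:C.
  rewrite (cintegral_sum (F := fun n w => conjc (a n) * (2 * (f w * (gauss 1 w)%:C * conjc w ^+ n) +
    (-1) * (p w * (gauss 1 w)%:C * conjc w ^+ n)))); last by move=> n; exact: cintbleZ.
  rewrite real_cM (real_c_sum (fun n => n`!%:R * cabs (a n) ^+ 2)) mulr_sumr.
  apply: eq_bigr => n _.
  rewrite cintegralZ// cintegralD; [|exact: cintbleZ|exact: cintbleZ].
  rewrite cintegralZ// cintegralZ// aE cp// real_cM -mulc_conj real_c_nat; ring.
have -> : J * \sum_(n < N) n`!%:R * cabs (a n) ^+ 2 = complex.Re (cintegral H).
  by rewrite cH.
have [iH' _] := iH; rewrite cintegralE /=; apply: rint_le => // w.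
rewrite HE; set x := f w; set y := p w.
rewrite cReM /= mulr0 subr0 ler_wpM2r ?(ltW (gauss_gt0 _ _))//.
rewrite cabs_sqr; case: x y => [x1 x2] [y1 y2]; rewrite /=.
have := sqr_ge0 (x1 - y1); have := sqr_ge0 (x2 - y2).
lra.
Qed.

(** * The stationary equation in Taylor coefficients *)

Lemma gauss_half_derive (R : realType) (x y : R) :
  is_derive x 1 (fun s => expR (- ((s ^+ 2 + y ^+ 2) / 2)))
    (- x * expR (- ((x ^+ 2 + y ^+ 2) / 2))).
Proof.
have H : is_derive x 1 (fun s : R => - ((s ^+ 2 + y ^+ 2) / 2)) (- x).
  apply: eps_is_derive => e e0; exists (2 * e); first by rewrite mulr_gt0.
  move=> h hd.
  have -> : - (((x + h) ^+ 2 + y ^+ 2) / 2) - - ((x ^+ 2 + y ^+ 2) / 2) - - x * h =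
    - (h / 2) * h by field.
  rewrite normrM normrN ler_wpM2r// normrM [`|2^-1|]ger0_norm ?invr_ge0//.
  by rewrite ler_pdivrMr// mulrC ltW.
have := @is_derive1_comp R expR (fun s : R => - ((s ^+ 2 + y ^+ 2) / 2)) x _ _ (is_derive_expR _) H.
by rewrite mulrC.
Qed.

Lemma partial_bf (R : realType) (u f : R[i] -> R[i]) (z d : R[i]) :
  (forall z, u z = (expR (- (cabs z ^+ 2 / 2)))%:C * f z) -> cderiv f z d ->
  let E := (expR (- (cabs z ^+ 2 / 2)))%:C in
  partial_x u z = E * (d - (complex.Re z)%:C * f z) /\
  partial_y u z = E * ('i * d - (complex.Im z)%:C * f z).
Proof.
move=> uE fd E.
have uRe w : complex.Re (u w) = expR (- (cabs w ^+ 2 / 2)) * complex.Re (f w).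
  by rewrite uE cReM /= mul0r subr0.
have uIm w : complex.Im (u w) = expR (- (cabs w ^+ 2 / 2)) * complex.Im (f w).
  by rewrite uE cImM /= mul0r addr0.
have key (x0 : R) (w v : R[i]) (g : R -> R) (c : R) : z = w + x0%:C * v ->
    is_derive x0 1 g c ->
    (forall s : R, expR (- (cabs (w + s%:C * v) ^+ 2 / 2)) = g s) ->
  derive1 (fun s : R => complex.Re (u (w + s%:C * v)) : R^o) x0 =
    c * complex.Re (f z) + g x0 * complex.Re (d * v) /\
  derive1 (fun s : R => complex.Im (u (w + s%:C * v)) : R^o) x0 =
    c * complex.Im (f z) + g x0 * complex.Im (d * v).
  move=> zE gd gE; rewrite zE in fd *.
  have [H1 H2] := cderiv_line fd.
  split.
    rewrite (_ : (fun s => _) = (g * (fun s => complex.Re (f (w + s%:C * v)))))%R; last first.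
      by apply/funext => s; rewrite uRe gE.
    rewrite derive1E; have [_ ->] := is_deriveM gd H1.
    by rewrite [LHS]addrC; congr (_ + _); exact: mulrC.
  rewrite (_ : (fun s => _) = (g * (fun s => complex.Im (f (w + s%:C * v)))))%R; last first.
    by apply/funext => s; rewrite uIm gE.
  rewrite derive1E; have [_ ->] := is_deriveM gd H2.
  by rewrite [LHS]addrC; congr (_ + _); exact: mulrC.
have gx := gauss_half_derive (complex.Re z) (complex.Im z).
have gy := gauss_half_derive (complex.Im z) (complex.Re z).
have [] := key _ (0 +i* complex.Im z) 1 _ _ _ gx.
- by case: (z) => x y; simpc.
- by move=> s; rewrite cabs_sqr /= !mulr1 !mulr0 !addr0 !add0r subr0 ?addr0.
move=> xR xI.
have [] := key _ (complex.Re z)%:C 'i _ _ _ gy.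
- by case: (z) => x y; simpc.
- move=> s; rewrite cabs_sqr /= ?mulr1 ?mulr0 ?mul0r ?subr0 ?addr0 ?add0r.
  by rewrite [X in - (X / 2)]addrC.
move=> yR yI.
have eE : expR (- ((complex.Re z ^+ 2 + complex.Im z ^+ 2) / 2)) =
    expR (- (cabs z ^+ 2 / 2)) by rewrite cabs_sqr.
rewrite [X in expR (- (X / 2))]addrC eE in yR yI; rewrite eE in xR xI.
have Lx s : (0 +i* complex.Im z) + s%:C * 1 = s +i* complex.Im z :> R[i] by simpc.
have Ly s : (complex.Re z)%:C + s%:C * 'i = complex.Re z +i* s :> R[i] by simpc.
split.
  rewrite /partial_x.
  have -> : (fun x : R => complex.Re (u (x +i* complex.Im z)) : R^o) =
      (fun s : R => complex.Re (u ((complex.Im z)*i + s%:C * 1)) : R^o).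
    by apply/funext => s; rewrite Lx.
  have -> : (fun x : R => complex.Im (u (x +i* complex.Im z)) : R^o) =
      (fun s : R => complex.Im (u ((complex.Im z)*i + s%:C * 1)) : R^o).
    by apply/funext => s; rewrite Lx.
  rewrite xR xI !mulr1 /E; case: (d) (f z) => [d1 d2] [f1 f2] /=.
  by simpc; congr (_ +i* _); ring.
rewrite /partial_y.
have -> : (fun y : R => complex.Re (u (complex.Re z +i* y)) : R^o) =
    (fun s : R => complex.Re (u ((complex.Re z)%:C + s%:C * 'i)) : R^o).
  by apply/funext => s; rewrite Ly.
have -> : (fun y : R => complex.Im (u (complex.Re z +i* y)) : R^o) =
    (fun s : R => complex.Im (u ((complex.Re z)%:C + s%:C * 'i)) : R^o).
  by apply/funext => s; rewrite Ly.
rewrite yR yI /E; case: (d) (f z) => [d1 d2] [f1 f2] /=.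
by simpc; congr (_ +i* _); ring.
Qed.

(** On [exp (- |z|^2 / 2) f] the angular momentum operator acts as [z d/dz] on
    the holomorphic factor; the contributions of the Gaussian cancel. *)
Lemma Lambda_bf (R : realType) (u f : R[i] -> R[i]) (z d : R[i]) :
  (forall z, u z = (expR (- (cabs z ^+ 2 / 2)))%:C * f z) -> cderiv f z d ->
  Lambda u z = (expR (- (cabs z ^+ 2 / 2)))%:C * (z * d).
Proof.
move=> uE fd; have [px py] := partial_bf uE fd.
rewrite /Lambda /d_z /d_zbar px py.
set E := (expR _)%:C; set x := (complex.Re z)%:C; set y := (complex.Im z)%:C.
have zE : z = x + 'i * y by rewrite /x /y; case: (z) => a b; simpc.
have cE : conjc z = x - 'i * y by rewrite /x /y; case: (z) => a b; simpc.
rewrite cE [in LHS]zE [in RHS]zE -[0 +i* 1]/('i : R[i]).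
have ii : 'i * 'i = -1 :> R[i] by simpc.
have i2 (w : R[i]) : 'i * ('i * w) = - w by rewrite mulrA ii mulN1r.
set F := f _.
have -> : E * (d - x * F) - 'i * (E * ('i * d - y * F)) = E * (2 * d - (x - 'i * y) * F).
  transitivity (E * (d - x * F + 'i * y * F - 'i * ('i * d))); first by ring.
  by rewrite i2; ring.
have -> : E * (d - x * F) + 'i * (E * ('i * d - y * F)) = E * (- ((x + 'i * y) * F)).
  transitivity (E * (d - x * F - 'i * y * F + 'i * ('i * d))); first by ring.
  by rewrite i2; ring.
by field.
Qed.

(** The Gaussian factors of the kernel and of the three factors [u] combine to
    the weight [gauss 2], twice the weight of the Bargmann-Fock space. *)
Lemma proj_bf_kernel (R : realType) (u f : R[i] -> R[i]) (z : R[i]) :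
  (forall z, u z = (expR (- (cabs z ^+ 2 / 2)))%:C * f z) ->
  proj_bf (fun w => (cabs (u w) ^+ 2)%:C * u w) z =
  (expR (- (cabs z ^+ 2 / 2)))%:C * ((pi^-1)%:C *
    cintegral (fun w => (cabs (f w) ^+ 2 * gauss 2 w)%:C * f w * cexp (z * conjc w))).
Proof.
move=> uE; rewrite /proj_bf -mulrA mulrCA; congr (_ * (_ * _)); congr cintegral.
apply/funext => w; rewrite uE cabsM cabs_real (ger0_norm (expR_ge0 _)).
set e := expR _; rewrite cexpD -rmorphN cexp_real -/e (mulrC (conjc w)).
have -> : gauss 2 w = e ^+ 4.
  by rewrite /e -expRM_natl /gauss; congr expR; field.
have cX n (x : R) : (x ^+ n)%:C = x%:C ^+ n by exact: rmorphXn.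
by rewrite exprMn (real_cM (e ^+ 2)) (real_cM (cabs (f w) ^+ 2)) (cX 2%N e) (cX 4%N e); ring.
Qed.

(** Up to normalisation, the Taylor coefficients of the projected cubic term. *)
Definition cubic_moment (R : realType) (f : R[i] -> R[i]) (n : nat) : R[i] :=
  cintegral (fun w => (cabs (f w) ^+ 2 * gauss 2 w)%:C * f w * conjc w ^+ n).

Lemma rintble_cubic (R : realType) (f : R[i] -> R[i]) (C B : R) : cmeas f ->
  (forall z, cabs (f z) <= C * expR (cabs z ^+ 2 / 2)) ->
  rintble (fun w => cabs ((cabs (f w) ^+ 2 * gauss 2 w)%:C * f w) * expR (B * cabs w)).
Proof.
move=> mf fC.
have h0 : 0 < 2^-1 :> R by rewrite invr_gt0.
apply: (rintble_le _ (rintbleZ (C ^+ 3) (rintble_gauss B h0))).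
  apply: rmeasM.
    apply: rmeas_cabs; apply: cmeasM => //; apply: cmeas_real.
    by apply: rmeasM; [apply: rmeasX; exact: rmeas_cabs|exact: rmeas_gauss].
  apply: (rmeas_comp (@continuous_expR R)); apply: rmeasM; first exact (rmeas_cst B).
  by apply: rmeas_cabs; exact: cmeas_id.
move=> w; rewrite ger0_norm ?mulr_ge0 ?cabs_ge0 ?expR_ge0//.
rewrite cabsM cabs_real ger0_norm; last first.
  by rewrite mulr_ge0 ?sqr_ge0 ?(ltW (gauss_gt0 _ _)).
have -> : expR (B * cabs w - 2^-1 * cabs w ^+ 2) =
    expR (cabs w ^+ 2 / 2) ^+ 3 * gauss 2 w * expR (B * cabs w).
  by rewrite -expRM_natl /gauss -!expRD; congr expR; field.
have h : cabs (f w) ^+ 3 <= (C * expR (cabs w ^+ 2 / 2)) ^+ 3.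
  by rewrite lerXn2r// nnegrE ?cabs_ge0//; exact: le_trans (cabs_ge0 _) (fC w).
have g0 : 0 <= gauss 2 w * expR (B * cabs w) by rewrite mulr_ge0 ?expR_ge0.
apply: le_trans (le_trans (ler_wpM2r g0 h) _); rewrite le_eqVlt; apply/orP; left; apply/eqP.
  by ring.
by rewrite exprMn; ring.
Qed.

(** The stationary equation in Taylor coefficients: the operator on the left is
    diagonal on monomials, and expanding the reproducing kernel shows that the
    right-hand side is a power series as well. *)
Lemma stationary_coef (R : realType) (u f : R[i] -> R[i]) (a : nat -> R[i])
    (lambda mu C : R) :
  holo f -> cmeas f -> (forall z, u z = (expR (- (cabs z ^+ 2 / 2)))%:C * f z) ->
  entire_coef a -> sums_to a f ->
  (forall z, cabs (f z) <= C * expR (cabs z ^+ 2 / 2)) ->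
  (forall z, lambda%:C * u z + mu%:C * Lambda u z =
     proj_bf (fun w => (cabs (u w) ^+ 2)%:C * u w) z) ->
  forall n, (lambda + mu * n%:R)%:C * a n = (pi^-1)%:C * ((n`!%:R)^-1 * cubic_moment f n).
Proof.
move=> hf mf uE ha af fC sol n.
have [d fd] : exists d : R[i] -> R[i], forall z, cderiv f z (d z).
  by exists (fun z => xget 0 (cderiv f z)) => z; have [y yd] := hf z; exact: (xgetPex 0 (ex_intro _ y yd)).
pose v w := (cabs (f w) ^+ 2 * gauss 2 w)%:C * f w.
have mv : cmeas v.
  apply: cmeasM => //; apply: cmeas_real.
  by apply: rmeasM; [apply: rmeasX; exact: rmeas_cabs|exact: rmeas_gauss].
have iv B := rintble_cubic B mf fC.
have eqn z : lambda%:C * f z + mu%:C * (z * d z) =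
    (pi^-1)%:C * cintegral (fun w => v w * cexp (z * conjc w)).
  have := sol z; rewrite (proj_bf_kernel _ uE) uE (Lambda_bf uE (fd z)).
  have En : (expR (- (cabs z ^+ 2 / 2)))%:C != 0.
    by rewrite -cabs_eq0 cabs_real gt_eqF// normr_gt0 gt_eqF// expR_gt0.
  by rewrite mulrCA [mu%:C * _]mulrCA -mulrDr => /(mulfI En).
have S1 := sums_toD (sums_toZ lambda%:C af) (sums_toZ mu%:C (sums_to_deriv ha af fd)).
have S2 : sums_to (fun n => (pi^-1)%:C * ((n`!%:R)^-1 * cubic_moment f n))
    (fun z => lambda%:C * f z + mu%:C * (z * d z)).
  rewrite (_ : (fun z => _) = fun z => (pi^-1)%:C * cintegral (fun w => v w * cexp (z * conjc w)));
    last by apply/funext => z; exact: eqn.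
  by apply: sums_toZ => z; exact: exp_kernel_expand.
have C2 : entire_coef (fun n => (pi^-1)%:C * ((n`!%:R)^-1 * cubic_moment f n)).
  apply: entire_coefZ => r r0; eexists => N; exact: exp_kernel_bound.
have C1 := entire_coefD (entire_coefZ lambda%:C ha) (entire_coefZ mu%:C (entire_coef_nat ha)).
have := congr1 (fun s => s n) (sums_to_inj C1 C2 S1 S2) => /= <-.
have -> : (lambda + mu * n%:R)%:C = lambda%:C + mu%:C * n%:R.
  by rewrite -real_c_nat -real_cM; simpc.
by rewrite mulrDl mulrA.
Qed.

(** * Convolutions and Cauchy-Schwarz estimates *)

Lemma cauchy_schwarz (R : realType) (I : Type) (s : seq I) (P : pred I) (u v : I -> R) :
  (\sum_(i <- s | P i) u i * v i) ^+ 2 <=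
  (\sum_(i <- s | P i) u i ^+ 2) * (\sum_(i <- s | P i) v i ^+ 2).
Proof.
set U := \sum_(i <- s | P i) u i ^+ 2; set V := \sum_(i <- s | P i) v i ^+ 2.
set W := \sum_(i <- s | P i) u i * v i.
have U0 : 0 <= U by apply: sumr_ge0 => i _; exact: sqr_ge0.
have key (t : R) : 0 <= t ^+ 2 * U - 2 * t * W + V.
  have -> : t ^+ 2 * U - 2 * t * W + V = \sum_(i <- s | P i) (t * u i - v i) ^+ 2.
    rewrite /U /W /V !mulr_sumr -sumrB -big_split; apply: eq_bigr => i _ /=; ring.
  by apply: sumr_ge0 => i _; exact: sqr_ge0.
have [U00|Un0] := eqVneq U 0.
  have W0 : W = 0.
    apply/eqP; apply: contraT => Wn0; have := key ((V + 1) / (2 * W)).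
    rewrite U00 mulr0 add0r.
    have -> : - (2 * ((V + 1) / (2 * W)) * W) + V = -1 by field.
    by rewrite oppr_ge0 ler10.
  by rewrite W0 expr0n U00 mul0r.
have {}U0 : 0 < U by rewrite lt_def Un0.
have := key (W / U).
have -> : (W / U) ^+ 2 * U - 2 * (W / U) * W + V = V - W ^+ 2 / U by field.
by rewrite subr_ge0 ler_pdivrMr// mulrC.
Qed.

Definition convol (R : realType) (u v : nat -> R) (m : nat) : R :=
  \sum_(i < m.+1) u i * v (m - i)%N.

Lemma convol_ge0 (R : realType) (u v : nat -> R) m :
  (forall n, 0 <= u n) -> (forall n, 0 <= v n) -> 0 <= convol u v m.
Proof. by move=> u0 v0; apply: sumr_ge0 => i _; rewrite mulr_ge0. Qed.

Lemma triangle_sum (R : realType) (F : nat -> nat -> R) P :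
  \sum_(m < P) \sum_(k < m.+1) F (m - k)%N k = \sum_(k < P) \sum_(n < P - k) F n k.
Proof.
transitivity (\sum_(m < P) \sum_(k < P | (k <= m)%N) F (m - k)%N k).
  apply: eq_bigr => m _.
  by rewrite (big_ord_widen_cond P predT (fun k => F (m - k)%N k)).
rewrite (exchange_big_dep predT) //=; apply: eq_bigr => k _.
have H d : \sum_(i < k + d | (k <= i)%N) F (i - k)%N k = \sum_(n < d) F n k.
  rewrite big_split_ord /= big_pred0 ?add0r; last by move=> m; rewrite leqNgt ltn_ord.
  by apply: eq_big => m; rewrite ?leq_addr// addKn.
by have := H (P - k)%N; rewrite subnKC// ltnW.
Qed.

Lemma sum_le_ord (R : realType) (G : nat -> R) a b : (forall n, 0 <= G n) ->
  (a <= b)%N -> \sum_(n < a) G n <= \sum_(n < b) G n.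
Proof.
move=> G0 ab; rewrite -(subnKC ab) big_split_ord /= lerDl.
by apply: sumr_ge0 => i _; exact: G0.
Qed.

Lemma rect_sum_le (R : realType) (F : nat -> nat -> R) L N :
  (forall n k, 0 <= F n k) ->
  \sum_(n < L) \sum_(k < N) F n k <= \sum_(m < L + N) \sum_(k < m.+1) F (m - k)%N k.
Proof.
move=> F0; rewrite triangle_sum exchange_big /=.
apply: le_trans (sum_le_ord (G := fun k => \sum_(n < L + N - k) F n k) _ (leq_addl L N)).
  apply: ler_sum => k _; apply: (sum_le_ord (G := fun n => F n k)) => //.
  by rewrite -addnBA ?leq_addr// ltnW.
by move=> k; exact: sumr_ge0.
Qed.

(** The triangle [i + j < P] lies in a square. *)
Lemma sum_convol_le (R : realType) (u v : nat -> R) P :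
  (forall n, 0 <= u n) -> (forall n, 0 <= v n) ->
  \sum_(m < P) convol u v m <= (\sum_(i < P) u i) * (\sum_(j < P) v j).
Proof.
move=> u0 v0; rewrite /convol (triangle_sum (fun n k => u k * v n)) mulr_suml.
apply: ler_sum => -[k kP] _ /=; rewrite -mulr_sumr ler_wpM2l//.
by apply: sum_le_ord => //; exact: leq_subr.
Qed.

(** The binomial formula along the diagonals [n + k = m]. *)
Lemma binomial_double_sum (R : realType) (Y : nat -> R) (w z : R) L N :
  (forall m, 0 <= Y m) -> 0 <= w -> 0 <= z ->
  \sum_(n < L) \sum_(k < N) w ^+ k * z ^+ n * 'C(n + k, k)%:R / 2 ^+ (n + k) * Y (n + k)%N <=
  \sum_(m < L + N) Y m * ((w + z) / 2) ^+ m.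
Proof.
move=> Y0 w0 z0.
pose F n k := w ^+ k * z ^+ n * 'C(n + k, k)%:R / 2 ^+ (n + k) * Y (n + k)%N.
apply: le_trans (rect_sum_le L N (F := F) _) _.
  by move=> n k; rewrite mulr_ge0// divr_ge0 ?exprn_ge0// !mulr_ge0 ?exprn_ge0.
rewrite le_eqVlt; apply/orP; left; apply/eqP; apply: eq_bigr => m _.
rewrite expr_div_n addrC exprDn mulrA mulr_sumr mulr_suml; apply: eq_bigr => k _.
have km : (k <= m)%N by rewrite -ltnS.
by rewrite /F subnK// -mulr_natr; ring.
Qed.

Lemma sum_inv_fact (R : realType) m :
  \sum_(i < m.+1) (i`!%:R)^-1 * ((m - i)`!%:R)^-1 = 2 ^+ m / m`!%:R :> R.
Proof.
have -> : 2 ^+ m = \sum_(i < m.+1) 'C(m, i)%:R :> R.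
  rewrite -[2]/(1 + 1) exprDn; apply: eq_bigr => i _.
  by rewrite !expr1n mulr1.
rewrite mulr_suml; apply: eq_bigr => -[i im] _ /=; rewrite ltnS in im.
have H := bin_fact im.
have f0 k : k`!%:R != 0 :> R by rewrite pnatr_eq0 -lt0n fact_gt0.
rewrite -H !natrM; field.
by rewrite !f0 pnatr_eq0 -lt0n bin_gt0 im.
Qed.

Definition energy (R : realType) (x : nat -> R) (n : nat) : R := n`!%:R * x n ^+ 2.

(** The factor [2 ^ m / m!] is the sum of the [1 / (i! (m - i)!)]. *)
Lemma convol_cauchy_schwarz (R : realType) (x : nat -> R) m :
  convol x x m ^+ 2 <=
  convol (energy x) (energy x) m * (2 ^+ m / m`!%:R).
Proof.
have f0 k : k`!%:R != 0 :> R by rewrite pnatr_eq0 -lt0n fact_gt0.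
have fp k : 0 < k`!%:R :> R by rewrite ltr0n fact_gt0.
pose s k : R := Num.sqrt k`!%:R.
have ss k : s k ^+ 2 = k`!%:R by rewrite sqr_sqrtr.
have s0 k : s k != 0 by rewrite gt_eqF// sqrtr_gt0.
have := cauchy_schwarz (index_enum 'I_m.+1) predT
  (fun i => s i * x i * (s (m - i)%N * x (m - i)%N)) (fun i => (s i)^-1 * (s (m - i)%N)^-1).
rewrite (eq_bigr (fun i : 'I_m.+1 => x i * x (m - i)%N)); last first.
  by move=> i _; field; rewrite !s0.
move=> /le_trans; apply; rewrite le_eqVlt; apply/orP; left; apply/eqP; congr (_ * _).
  by apply: eq_bigr => i _; rewrite /energy !exprMn !ss.
by rewrite -sum_inv_fact; apply: eq_bigr => i _; rewrite exprMn !exprVn !ss.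
Qed.

(** The triangle-inequality bound for the [n]-th cubic moment of a polynomial
    with coefficients of modulus [x], up to the constant [rint (gauss 2)]. The
    predicate [P] selects the indices of the conjugated factor. *)
Definition cubic_sum (R : realType) (x : nat -> R) (P : pred nat) (N n : nat) : R :=
  \sum_(k < N | P k) x k * ((n + k)`!%:R / 2 ^+ (n + k) * convol x x (n + k)).

Lemma energy_ge0 (R : realType) (x : nat -> R) n : 0 <= energy x n.
Proof. by rewrite mulr_ge0 ?sqr_ge0. Qed.

(** Splitting the terms with the weights [k! / s ^ k] makes the factorials
    recombine into binomial coefficients; the free parameter [s] is the rate at
    which the conjugated factor is assumed to decay. *)
Lemma cubic_sum_cauchy_schwarz (R : realType) (x : nat -> R) (P : pred nat) (s : R) N n :
  0 < s ->
  cubic_sum x P N n ^+ 2 / n`!%:R <=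
  (\sum_(k < N | P k) energy x k / s ^+ k) *
  (\sum_(k < N | P k) s ^+ k * 'C(n + k, k)%:R / 2 ^+ (n + k) *
      convol (energy x) (energy x) (n + k)).
Proof.
move=> s0; pose r k : R := Num.sqrt (k`!%:R / s ^+ k).
have fp k : 0 < k`!%:R :> R by rewrite ltr0n fact_gt0.
have f0 k : k`!%:R != 0 :> R by rewrite gt_eqF.
have rp k : 0 < k`!%:R / s ^+ k by rewrite divr_gt0// exprn_gt0.
have rr k : r k ^+ 2 = k`!%:R / s ^+ k by rewrite sqr_sqrtr// ltW.
have r0 k : r k != 0 by rewrite gt_eqF// sqrtr_gt0.
rewrite ler_pdivrMr// /cubic_sum.
have := cauchy_schwarz (index_enum 'I_N) (fun k : 'I_N => P k) (fun k => r k * x k)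
  (fun k => (r k)^-1 * ((n + k)`!%:R / 2 ^+ (n + k) * convol x x (n + k))).
rewrite (eq_bigr (fun k : 'I_N => x k * ((n + k)`!%:R / 2 ^+ (n + k) * convol x x (n + k)))); last first.
  by move=> k _; rewrite mulrACA mulfV// mul1r.
move=> /le_trans; apply; rewrite -mulrA; apply: ler_pM.
- by apply: sumr_ge0 => k _; exact: sqr_ge0.
- by apply: sumr_ge0 => k _; exact: sqr_ge0.
- rewrite le_eqVlt; apply/orP; left; apply/eqP; apply: eq_bigr => k _.
  by rewrite exprMn rr /energy; ring.
rewrite mulr_suml; apply: ler_sum => k _.
rewrite !exprMn exprVn rr.
set Y := convol (energy x) (energy x) (n + k).
have := convol_cauchy_schwarz x (n + k); rewrite -/Y => h.
have p2 : 0 < 2 ^+ (n + k) :> R by rewrite exprn_gt0.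
have c0 : 0 <= (k`!%:R / s ^+ k)^-1 * ((n + k)`!%:R ^+ 2 * (2 ^+ (n + k))^-1 ^+ 2).
  by rewrite mulr_ge0 ?invr_ge0 ?(ltW (rp _))// mulr_ge0// sqr_ge0.
apply: le_trans (le_trans (ler_wpM2l c0 h) _); first by rewrite !mulrA.
have Cb : 'C(n + k, k)%:R = (n + k)`!%:R / (k`!%:R * n`!%:R) :> R.
  have := bin_fact (leq_addl n k); rewrite addnK => <-.
  by rewrite natrM natrM mulfK// mulf_neq0.
rewrite Cb le_eqVlt; apply/orP; left; apply/eqP; field.
by rewrite !f0 !gt_eqF// exprn_gt0.
Qed.

(** * The gain of the cubic term *)

(** What the equation says about the moduli [x] of the coefficients, up to a
    constant. The weighted finite sums, bounded uniformly over the truncations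
    [N], are the form that passes from polynomials to their limit. *)
Definition cubic_control (R : realType) (x : nat -> R) (lambda mu K : R) : Prop :=
  forall L (d : nat -> R) (B : R), (forall n, 0 <= d n) ->
  (forall N, \sum_(n < L) d n * (cubic_sum x predT N n ^+ 2 / n`!%:R) <= B) ->
  \sum_(n < L) d n * ((lambda + mu * n%:R) ^+ 2 * energy x n) <= K * B.

(** Convergence of the series with weights [q ^- n]; the smaller [q], the faster
    the decay of [energy x]. *)
Definition energy_le (R : realType) (x : nat -> R) (q A : R) : Prop :=
  forall N, \sum_(n < N) energy x n / q ^+ n <= A.

Lemma energy_convol_ge0 (R : realType) (x : nat -> R) m :
  0 <= convol (energy x) (energy x) m.
Proof. by apply: convol_ge0 => n; exact: energy_ge0. Qed.

(** One application of the equation. The binomial sum turns the rates [q] and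
    [q' ^-1] into [(q + q' ^-1) / 2], which the hypothesis bounds by [q ^-1];
    then the convolution of two convergent series appears, and the third factor
    [A] comes from the conjugated coefficient. For [q < 1] the rate [q'] may be
    chosen smaller than [q]. *)
Lemma energy_step (R : realType) (x : nat -> R) (lambda mu K q q' A : R) :
  cubic_control x lambda mu K -> 0 < q -> 0 < q' -> q ^+ 2 + q / q' <= 2 ->
  energy_le x q A ->
  forall L, \sum_(n < L) (lambda + mu * n%:R) ^+ 2 * energy x n / q' ^+ n <= K * A ^+ 3.
Proof.
move=> HK q0 q'0 qq HA L.
have A0 : 0 <= A by have := HA 0%N; rewrite big_ord0.
rewrite (eq_bigr (fun n : 'I_L => (q' ^+ n)^-1 * ((lambda + mu * n%:R) ^+ 2 * energy x n)));
  last by move=> n _; rewrite mulrC.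
apply: (HK L (fun n => (q' ^+ n)^-1)) => [n|N]; first by rewrite invr_ge0 exprn_ge0// ltW.
have pred_sum : \sum_(k < N | predT (nat_of_ord k)) energy x k / q ^+ k <= A by exact: HA.
apply: (@le_trans _ _ (A * \sum_(n < L) \sum_(k < N)
    q ^+ k * (q'^-1) ^+ n * 'C(n + k, k)%:R / 2 ^+ (n + k) * convol (energy x) (energy x) (n + k))).
  rewrite mulr_sumr; apply: ler_sum => n _.
  have q'n : 0 <= (q' ^+ n)^-1 by rewrite invr_ge0 exprn_ge0// ltW.
  apply: le_trans (ler_wpM2l q'n (cubic_sum_cauchy_schwarz x predT N n q0)) _.
  rewrite mulrCA; apply: ler_pM => //.
  - by apply: sumr_ge0 => k _; rewrite divr_ge0 ?energy_ge0// exprn_ge0// ltW.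
  - rewrite mulr_ge0//; apply: sumr_ge0 => k _.
    by rewrite mulr_ge0 ?energy_convol_ge0// divr_ge0 ?exprn_ge0// mulr_ge0// exprn_ge0// ltW.
  rewrite mulr_sumr; apply: ler_sum => k _.
  by rewrite exprVn le_eqVlt; apply/orP; left; apply/eqP; ring.
rewrite exprS ler_wpM2l//.
apply: le_trans (binomial_double_sum _ _ (@energy_convol_ge0 _ x) (ltW q0) _) _.
  by rewrite invr_ge0 ltW.
pose y n := energy x n / q ^+ n.
have y0 n : 0 <= y n by rewrite divr_ge0 ?energy_ge0// exprn_ge0// ltW.
apply: (@le_trans _ _ (\sum_(m < L + N) convol y y m)).
  apply: ler_sum => m _.
  have -> : convol y y m = convol (energy x) (energy x) m * (q^-1) ^+ m.
    rewrite /convol mulr_suml; apply: eq_bigr => -[i im] _ /=; rewrite ltnS in im.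
    have -> : q^-1 ^+ m = q^-1 ^+ i * q^-1 ^+ (m - i) by rewrite -exprD subnKC.
    by rewrite /y !exprVn; ring.
  rewrite ler_wpM2l ?energy_convol_ge0//.
  have w0 : 0 <= (q + q'^-1) / 2 by rewrite divr_ge0// addr_ge0 ?invr_ge0 ?(ltW q0) ?(ltW q'0).
  rewrite lerXn2r ?nnegrE ?invr_ge0 ?(ltW q0)//.
  by rewrite ler_pdivrMr// -[q^-1]mul1r mulrAC mul1r ler_pdivlMr// mulrDl -expr2 [_^-1 * q]mulrC.
apply: le_trans (sum_convol_le _ y0 y0) _.
by rewrite expr2; apply: ler_pM => //; exact: sumr_ge0.
Qed.

Definition tail_le (R : realType) (x : nat -> R) (M : nat) (t : R) : Prop :=
  forall L, \sum_(n < L | (M <= n)%N) energy x n <= t.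

Lemma tail_le_mono (R : realType) (x : nat -> R) (M M' : nat) (t : R) :
  (M <= M')%N -> tail_le x M t -> tail_le x M' t.
Proof.
move=> MM' HM L; apply: le_trans (HM L).
rewrite [leRHS](bigID (fun n : 'I_L => (M' <= n)%N)) /=.
have -> : \sum_(n < L | (M <= n)%N && (M' <= n)%N) energy x n = \sum_(n < L | (M' <= n)%N) energy x n.
  by apply: eq_bigl => n /=; case: (leqP M' n) => [h|]; rewrite ?andbF// andbT (leq_trans MM').
by rewrite lerDl sumr_ge0// => n _; exact: energy_ge0.
Qed.

(** At the rate [1] the previous gain degenerates, but doubling the cutoff of
    the tail still gains: if the conjugated index [k] is below [M], the binomial
    weight is exponentially small; otherwise [n + k >= 3 M], and one of the two
    other indices lies in the tail together with [k]. *)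
Lemma tail_step (R : realType) (x : nat -> R) (lambda mu K A t : R) (M : nat) :
  cubic_control x lambda mu K -> energy_le x 1 A -> tail_le x M t ->
  forall L, \sum_(n < L | (M.*2 <= n)%N) (lambda + mu * n%:R) ^+ 2 * energy x n <=
    K * (2 * A ^+ 3 * (8 / 9) ^+ M + 4 * A * t ^+ 2).
Proof.
move=> HK HA Ht L.
have A0 : 0 <= A by have := HA 0%N; rewrite big_ord0.
have t0 : 0 <= t by have := Ht 0%N; rewrite big_ord0.
have {}HA N : \sum_(n < N) energy x n <= A.
  apply: le_trans (HA N); apply: ler_sum => n _; by rewrite expr1n divr1.
pose Y := convol (energy x) (energy x).
have Y0 m : 0 <= Y m by exact: energy_convol_ge0.
have YA P : \sum_(m < P) Y m <= A ^+ 2.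
  apply: le_trans (sum_convol_le _ (energy_ge0 x) (energy_ge0 x)) _.
  by rewrite expr2; apply: ler_pM => //; apply: sumr_ge0 => n _; exact: energy_ge0.
rewrite big_mkcond /=.
rewrite (eq_bigr (fun n : 'I_L => (M.*2 <= n)%N%:R * ((lambda + mu * n%:R) ^+ 2 * energy x n)));
  last by move=> n _; case: leqP; rewrite ?mul1r ?mul0r.
apply: (HK L (fun n => (M.*2 <= n)%N%:R)) => [n|N]; first by [].
pose lowP := [pred k : nat | (k < M)%N]; pose highP := [pred k : nat | (M <= k)%N].
have split2 n : cubic_sum x predT N n ^+ 2 / n`!%:R <=
   2 * (cubic_sum x lowP N n ^+ 2 / n`!%:R) + 2 * (cubic_sum x highP N n ^+ 2 / n`!%:R).
  have -> : cubic_sum x predT N n = cubic_sum x lowP N n + cubic_sum x highP N n.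
    rewrite /cubic_sum (bigID (fun k : 'I_N => (k < M)%N)) /=; congr (_ + _).
    by apply: eq_bigl => k; rewrite -leqNgt.
  have f0 : 0 <= (n`!%:R)^-1 :> R by rewrite invr_ge0.
  rewrite !mulrA -mulrDl ler_wpM2r//.
  by have := sqr_ge0 (cubic_sum x lowP N n - cubic_sum x highP N n); lra.
apply: (@le_trans _ _ (2 * (\sum_(n < L) (M.*2 <= n)%N%:R * (cubic_sum x lowP N n ^+ 2 / n`!%:R)) +
    2 * (\sum_(n < L) (M.*2 <= n)%N%:R * (cubic_sum x highP N n ^+ 2 / n`!%:R)))%R).
  rewrite !mulr_sumr -big_split /=; apply: ler_sum => n _.
  have d0 : 0 <= (M.*2 <= n)%N%:R :> R by [].
  apply: le_trans (ler_wpM2l d0 (split2 n)) _.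
  by rewrite mulrDr mulrCA [X in _ + X]mulrCA.
have low : \sum_(n < L) (M.*2 <= n)%N%:R * (cubic_sum x lowP N n ^+ 2 / n`!%:R) <=
    A ^+ 3 * (8 / 9) ^+ M.
  (* For [k < M] and [2 M <= n] the weights [(1 / 2) ^ k] and [(3 / 2) ^ n], whose
     bases have mean [1], multiply to at least [(9 / 8) ^ M]. *)
  apply: (@le_trans _ _ (A * (8 / 9) ^+ M * \sum_(n < L) \sum_(k < N)
    (1 / 2) ^+ k * (3 / 2) ^+ n * 'C(n + k, k)%:R / 2 ^+ (n + k) * Y (n + k)%N)).
    rewrite mulr_sumr; apply: ler_sum => n _.
    have T0 k : 0 <= (1 / 2) ^+ k * (3 / 2) ^+ n * 'C(n + k, k)%:R / 2 ^+ (n + k) * Y (n + k)%N.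
      by rewrite mulr_ge0// divr_ge0 ?exprn_ge0// !mulr_ge0// exprn_ge0// divr_ge0.
    have A89 : 0 <= A * (8 / 9) ^+ M by rewrite mulr_ge0// exprn_ge0// divr_ge0.
    have [Mn|_] := leqP M.*2 n; last by rewrite mul0r mulr_ge0// sumr_ge0.
    rewrite [true%:R * _]mul1r; apply: le_trans (cubic_sum_cauchy_schwarz x lowP N n ltr01) _.
    rewrite -[leRHS]mulrA; apply: ler_pM.
    - by apply: sumr_ge0 => k _; rewrite expr1n divr1 energy_ge0.
    - by apply: sumr_ge0 => k _; rewrite mulr_ge0 ?energy_convol_ge0// divr_ge0 ?exprn_ge0// mulr_ge0// exprn_ge0.
    - apply: le_trans (HA N); rewrite [leRHS](bigID (fun k : 'I_N => lowP k)) /=.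
      rewrite (eq_bigr (fun k : 'I_N => energy x k)); last by move=> k _; rewrite expr1n divr1.
      by rewrite lerDl sumr_ge0// => k _; exact: energy_ge0.
    rewrite mulr_sumr [leRHS](bigID (fun k : 'I_N => lowP k)) /= -[leLHS]addr0.
    apply: lerD; last by apply: sumr_ge0 => k _; rewrite mulr_ge0// exprn_ge0// divr_ge0.
    apply: ler_sum => k kM; rewrite -/(Y (n + k)%N) expr1n mul1r !mulrA.
    rewrite ler_wpM2r// ler_wpM2r ?invr_ge0 ?exprn_ge0//.
    rewrite -[leLHS]mul1r ler_wpM2r//.
    have -> : (8 / 9) ^+ M = (2 ^+ M) * ((2 / 3) ^+ M.*2) :> R.
      by rewrite -mul2n exprM -exprMn; congr (_ ^+ _); field.
    have h1 : 1 <= 2 ^+ M * (1 / 2) ^+ k :> R.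
      rewrite -(subnK (ltnW kM)) exprD -mulrA -exprMn.
      have -> : 2 * (1 / 2) = 1 :> R by field.
      by rewrite expr1n mulr1 exprn_ege1// ler1n.
    have h2 : 1 <= (2 / 3) ^+ M.*2 * (3 / 2) ^+ n :> R.
      rewrite -(subnKC Mn) exprD mulrA -exprMn.
      have -> : 2 / 3 * (3 / 2) = 1 :> R by field.
      by rewrite expr1n mul1r exprn_ege1//; lra.
    have := ler_pM ler01 ler01 h1 h2; rewrite mulr1 => /le_trans; apply.
    by rewrite le_eqVlt; apply/orP; left; apply/eqP; ring.
  have -> : A ^+ 3 * (8 / 9) ^+ M = A * (8 / 9) ^+ M * A ^+ 2 by ring.
  rewrite ler_wpM2l ?mulr_ge0 ?exprn_ge0 ?divr_ge0//.
  apply: le_trans (binomial_double_sum _ _ Y0 _ _) _; rewrite ?divr_ge0//.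
  apply: le_trans (YA (L + N)%N); apply: ler_sum => m _.
  have -> : (1 / 2 + 3 / 2) / 2 = 1 :> R by field.
  by rewrite expr1n mulr1.
have high : \sum_(n < L) (M.*2 <= n)%N%:R * (cubic_sum x highP N n ^+ 2 / n`!%:R) <=
    2 * A * t ^+ 2.
  (* As [3 M <= n + k = i + j], one of [i] and [j] is at least [M]. *)
  pose y1 n := if (M <= n)%N then energy x n else 0.
  have y10 n : 0 <= y1 n by rewrite /y1; case: ifP => // _; exact: energy_ge0.
  have y1t P : \sum_(n < P) y1 n <= t by rewrite -big_mkcond; exact: Ht.
  pose Y' m := convol y1 (energy x) m + convol (energy x) y1 m.
  have Y'0 m : 0 <= Y' m by rewrite addr_ge0// convol_ge0//; exact: energy_ge0.
  have YY' n k : (M.*2 <= n)%N -> (M <= k)%N -> Y (n + k)%N <= Y' (n + k)%N.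
    move=> Mn Mk; rewrite /Y /Y' /convol -big_split /=; apply: ler_sum => -[i im] _ /=.
    have e0 := energy_ge0 x; rewrite ltnS in im.
    have [Mi|iM] := leqP M i.
      by rewrite /y1 Mi lerDl mulr_ge0//; case: ifP.
    have Mmi : (M <= n + k - i)%N.
      rewrite -(subnKC Mn) -addnn; have := ltnW iM; lia.
    by rewrite {2}/y1 Mmi lerDr mulr_ge0.
  apply: (@le_trans _ _ (t * \sum_(n < L) \sum_(k < N)
    1 ^+ k * 1 ^+ n * 'C(n + k, k)%:R / 2 ^+ (n + k) * Y' (n + k)%N)).
    rewrite mulr_sumr; apply: ler_sum => n _.
    have T0 k : 0 <= 1 ^+ k * 1 ^+ n * 'C(n + k, k)%:R / 2 ^+ (n + k) * Y' (n + k)%N.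
      by rewrite mulr_ge0// divr_ge0 ?exprn_ge0// !mulr_ge0// exprn_ge0.
    have [Mn|_] := leqP M.*2 n; last by rewrite mul0r mulr_ge0// sumr_ge0.
    rewrite [true%:R * _]mul1r; apply: le_trans (cubic_sum_cauchy_schwarz x highP N n ltr01) _.
    apply: ler_pM.
    - by apply: sumr_ge0 => k _; rewrite expr1n divr1 energy_ge0.
    - by apply: sumr_ge0 => k _; rewrite mulr_ge0 ?energy_convol_ge0// divr_ge0 ?exprn_ge0// mulr_ge0// exprn_ge0.
    - apply: le_trans (Ht N); apply: ler_sum => k _; by rewrite expr1n divr1.
    rewrite [leRHS](bigID (fun k : 'I_N => highP k)) /= -[leLHS]addr0.
    apply: lerD; last by apply: sumr_ge0.
    apply: ler_sum => k Mk; rewrite [1 ^+ n]expr1n mulr1; apply: ler_wpM2l; last exact: YY'.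
    by rewrite divr_ge0 ?exprn_ge0// mulr_ge0// exprn_ge0.
  have -> : 2 * A * t ^+ 2 = t * (2 * A * t) by ring.
  rewrite ler_wpM2l//; apply: le_trans (binomial_double_sum _ _ Y'0 ler01 ler01) _.
  rewrite (eq_bigr (fun m : 'I_(L + N) => convol y1 (energy x) m + convol (energy x) y1 m)); last first.
    move=> m _; have -> : (1 + 1) / 2 = 1 :> R by field.
    by rewrite expr1n mulr1.
  rewrite big_split /=; have -> : 2 * A * t = t * A + A * t by ring.
  have y1s P : 0 <= \sum_(n < P) y1 n by exact: sumr_ge0.
  have es P : 0 <= \sum_(n < P) energy x n by apply: sumr_ge0 => n _; exact: energy_ge0.
  apply: lerD.
    by apply: le_trans (sum_convol_le _ y10 (energy_ge0 x)) _; exact: ler_pM.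
  by apply: le_trans (sum_convol_le _ (energy_ge0 x) y10) _; exact: ler_pM.
have -> : 2 * A ^+ 3 * (8 / 9) ^+ M + 4 * A * t ^+ 2 =
  2 * (A ^+ 3 * (8 / 9) ^+ M) + 2 * (2 * A * t ^+ 2) by ring.
by apply: lerD; rewrite ler_wpM2l.
Qed.

(** * Absorbing the linear factor *)

Lemma geometric_small (R : realType) (r e : R) : 0 <= r -> r < 1 -> 0 < e ->
  exists N, forall n, (N <= n)%N -> r ^+ n <= e.
Proof.
move=> r0 r1 e0.
have /cvgrPdist_le/(_ e e0)[N _ HN] : (GRing.exp r : R^nat) @ \oo --> (0 : R).
  by apply: cvg_expr; rewrite ger0_norm.
exists N => n Nn; have := HN n Nn.
by rewrite sub0r normrN ger0_norm// exprn_ge0.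
Qed.

Lemma geometric_sum_le (R : realType) (r : R) N : 0 <= r -> r < 1 ->
  \sum_(n < N) r ^+ n <= (1 - r)^-1.
Proof.
move=> r0 r1; have := subrX1 r N.
have p : 0 < 1 - r by rewrite subr_gt0.
rewrite -[leRHS]mul1r ler_pdivlMr// => h.
have := exprn_ge0 N r0; set S := \sum_(i < N) _ in h *; nra.
Qed.

Lemma bernoulli_sub (R : realType) (x : R) m : 0 <= x -> x <= 1 ->
  1 - m%:R * x <= (1 - x) ^+ m.
Proof.
move=> x0 x1; elim: m => [|m IH]; first by rewrite mul0r subr0 expr0.
rewrite exprS; have x1' : 0 <= 1 - x by rewrite subr_ge0.
apply: le_trans (ler_wpM2l x1' IH); rewrite -natr1.
have : 0 <= m%:R :> R by []. nra.
Qed.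

Lemma linear_lower (R : realType) (lambda mu : R) : lambda <> 0 \/ mu <> 0 ->
  exists n1 c, 0 < c /\ forall n, (n1 <= n)%N -> c <= (lambda + mu * n%:R) ^+ 2.
Proof.
have [mu0|mu0] := eqVneq mu 0.
  move=> [/eqP l0|//]; exists 0%N, (lambda ^+ 2); split; last by rewrite mu0 => n _; rewrite mul0r addr0.
  by rewrite lt_def sqr_ge0 expf_neq0.
move=> _; have m0 : 0 < `|mu| by rewrite normr_gt0.
exists (Num.truncn ((`|lambda| + 1) / `|mu|)).+1, 1; split=> // n nn.
have h : `|lambda| + 1 <= `|mu| * n%:R.
  rewrite mulrC -ler_pdivrMr//; apply: (le_trans (ltW (truncnS_gt _))).
  by rewrite ler_nat.
have : 1 <= `|lambda + mu * n%:R|.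
  have := ler_normB (lambda + mu * n%:R) lambda.
  rewrite [X in X - lambda]addrC addrK normrM [X in _ * X]ger0_norm//; lra.
by move=> h1; rewrite -real_normK ?num_real// exprn_ege1.
Qed.

Definition cubing_step (R : realType) (x : nat -> R) (K1 : R) : Prop :=
  forall q q' A, 1 <= A -> 0 < q -> 0 < q' -> q ^+ 2 + q / q' <= 2 ->
  energy_le x q A -> energy_le x q' (K1 * A ^+ 3).

(** The linear factor is bounded below except on finitely many modes, on which a
    change of the rate only costs a constant; so the estimate of [energy_step]
    closes up for [energy_le]. *)
Lemma energy_improve (R : realType) (x : nat -> R) (lambda mu K : R) :
  cubic_control x lambda mu K -> 0 <= K -> lambda <> 0 \/ mu <> 0 ->
  exists K1, 1 <= K1 /\ cubing_step x K1.
Proof.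
move=> HK K0 /linear_lower[n1 [c [c0 Hc]]].
have Kc : 0 <= K / c by rewrite divr_ge0// ltW.
exists (2 ^+ n1 + K / c); split.
  by rewrite -[leLHS]addr0 lerD// exprn_ege1// ler1n.
move=> q q' A A1 q0 q'0 qq HA L.
have qq2 : q / q' <= 2 by apply: le_trans qq; rewrite lerDr sqr_ge0.
have q'n n : 0 < q' ^+ n by exact: exprn_gt0.
have y0 n : 0 <= energy x n / q' ^+ n by rewrite divr_ge0 ?energy_ge0// ltW.
rewrite (bigID (fun n : 'I_L => (n < n1)%N)) /= mulrDl; apply: lerD.
  apply: (@le_trans _ _ (2 ^+ n1 * \sum_(n < L) energy x n / q ^+ n)).
    rewrite mulr_sumr [leRHS](bigID (fun n : 'I_L => (n < n1)%N)) /= -[leLHS]addr0.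
    apply: lerD; last first.
      apply: sumr_ge0 => n _; rewrite mulr_ge0 ?exprn_ge0// divr_ge0 ?energy_ge0//.
      by rewrite exprn_ge0// ltW.
    apply: ler_sum => n nn1.
    have -> : energy x n / q' ^+ n = (q / q') ^+ n * (energy x n / q ^+ n).
      by rewrite expr_div_n; field; rewrite !gt_eqF// exprn_gt0.
    rewrite ler_wpM2r ?divr_ge0 ?energy_ge0 ?exprn_ge0 ?(ltW q0)//.
    apply: (@le_trans _ _ (2 ^+ n)).
      by rewrite lerXn2r ?nnegrE ?divr_ge0 ?(ltW q0) ?(ltW q'0).
    by rewrite ler_weXn2l ?ler1n// ltnW.
  rewrite ler_wpM2l ?exprn_ge0//; apply: le_trans (HA L) _.
  by rewrite -[leLHS]expr1 ler_weXn2l.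
have := energy_step HK q0 q'0 qq HA L.
rewrite (bigID (fun n : 'I_L => (n < n1)%N)) /= => h.
rewrite mulrAC ler_pdivlMr// mulr_suml; apply: le_trans h.
rewrite -[leLHS]add0r; apply: lerD.
  by apply: sumr_ge0 => n _; rewrite -mulrA mulr_ge0// sqr_ge0.
apply: ler_sum => n; rewrite -leqNgt => /Hc h.
by rewrite -mulrA [leRHS]mulrC ler_wpM2l.
Qed.

Lemma tail_improve (R : realType) (x : nat -> R) (lambda mu K A : R) :
  cubic_control x lambda mu K -> 0 <= K -> lambda <> 0 \/ mu <> 0 -> energy_le x 1 A ->
  exists n1 K2, 1 <= K2 /\ forall M t, (n1 <= M)%N -> tail_le x M t ->
  tail_le x M.*2 (K2 * (t ^+ 2 + (8 / 9) ^+ M)).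
Proof.
move=> HK K0 /linear_lower[n1 [c [c0 Hc]]] HA.
have A0 : 0 <= A by have := HA 0%N; rewrite big_ord0.
have Kc : 0 <= K / c by rewrite divr_ge0// ltW.
have A3 : 0 <= A ^+ 3 by exact: exprn_ge0.
exists n1, (K / c * (2 * A ^+ 3 + 4 * A) + 1); split.
  by rewrite lerDr mulr_ge0// addr_ge0// mulr_ge0.
move=> M t n1M Ht L.
have := tail_step HK HA Ht L => h.
have h1 : \sum_(n < L | (M.*2 <= n)%N) energy x n <=
    K / c * (2 * A ^+ 3 * (8 / 9) ^+ M + 4 * A * t ^+ 2).
  rewrite mulrAC ler_pdivlMr// mulr_suml; apply: le_trans h.
  apply: ler_sum => n Mn; rewrite mulrC ler_wpM2r ?energy_ge0//; apply: Hc.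
  by apply: leq_trans Mn; apply: (leq_trans n1M); rewrite -addnn leq_addr.
apply: le_trans h1 _; have e0 : 0 <= (8 / 9) ^+ M :> R by rewrite exprn_ge0// divr_ge0.
have t20 := sqr_ge0 t; move: (_ ^+ M) (A ^+ 3) (t ^+ 2) (K / c) e0 t20 A3 Kc => e a3 t2 k *.
have : 0 <= k * (2 * a3 * t2) by rewrite !mulr_ge0.
have : 0 <= k * (4 * A * e) by rewrite !mulr_ge0.
nra.
Qed.

(** Otherwise the partial sums could be increased by [e] indefinitely. *)
Lemma tail_small (R : realType) (x : nat -> R) (A e : R) : energy_le x 1 A -> 0 < e ->
  exists M, tail_le x M e.
Proof.
move=> HA e0; apply: contrapT => H.
have key k : exists N, k%:R * e <= \sum_(n < N) energy x n.
  elim: k => [|k [N IH]]; first by exists 0%N; rewrite mul0r big_ord0.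
  have /existsNP[L /negP] : ~ tail_le x N e by move=> h; apply: H; exists N.
  rewrite -ltNge => h; exists L.
  have NL : (N <= L)%N.
    rewrite leqNgt; apply/negP => LN; move: h; rewrite big_pred0 ?ltNge ?(ltW e0)//.
    by move=> n; apply/negP => /(leq_trans LN)/ltnW; rewrite leqNgt ltn_ord.
  rewrite (bigID (fun n : 'I_L => (n < N)%N)) /= -natr1 mulrDl mul1r; apply: lerD.
    by rewrite -(big_ord_widen L (energy x) NL).
  by apply: ltW; rewrite (eq_bigl (fun n : 'I_L => (N <= n)%N))// => n; rewrite -leqNgt.
have [N] := key (Num.truncn (A / e)).+1.
apply/negP; rewrite -ltNge; apply: (@le_lt_trans _ _ A).
  apply: le_trans (HA N); apply: ler_sum => n _; by rewrite expr1n divr1.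
by rewrite -ltr_pdivrMr// truncnS_gt.
Qed.

(** * Iterating the gain *)

(** Each doubling of the cutoff squares the size of the tail, up to a constant:
    once the tail is small, it decays exponentially in the cutoff. *)
Lemma tail_dyadic (R : realType) (x : nat -> R) (K2 A : R) n1 :
  energy_le x 1 A -> 1 <= K2 ->
  (forall M t, (n1 <= M)%N -> tail_le x M t -> tail_le x M.*2 (K2 * (t ^+ 2 + (8 / 9) ^+ M))) ->
  exists M0, (0 < M0)%N /\ forall j, tail_le x (2 ^ j * M0) ((1 / 2) ^+ (2 ^ j)).
Proof.
move=> HA K21 H; have K20 : 0 < K2 by exact: lt_le_trans K21.
have e0 : 0 < (16 * K2 ^+ 2)^-1 by rewrite invr_gt0 mulr_gt0// exprn_gt0.
have [N1 HN1] : exists N, forall n, (N <= n)%N -> (8 / 9) ^+ n <= (16 * K2 ^+ 2)^-1.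
  by apply: geometric_small => //; lra.
have [N2 HN2] : exists M, tail_le x M (4 * K2)^-1.
  by apply: tail_small HA _; rewrite invr_gt0 mulr_gt0.
pose M0 := (n1 + N1 + N2).+1.
(* The factor [1 / (2 * K2)] absorbs the constant of each squaring. *)
have claim j : tail_le x (2 ^ j * M0) ((1 / 2) ^+ (2 ^ j) / (2 * K2)).
  elim: j => [|j IH].
    rewrite expn0 mul1n.
    have -> : (1 / 2) ^+ 1 / (2 * K2) = (4 * K2)^-1 by field; rewrite gt_eqF.
    apply: tail_le_mono HN2; rewrite /M0; lia.
  have -> : (2 ^ j.+1 * M0 = (2 ^ j * M0).*2)%N by rewrite expnS -mul2n mulnA.
  have p2 : (0 < 2 ^ j)%N by rewrite expn_gt0.
  have n1M : (n1 <= 2 ^ j * M0)%N by rewrite /M0; nia.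
  move=> L; apply: le_trans (H _ _ n1M IH L) _.
  have h89 : (8 / 9) ^+ (2 ^ j * M0) <= ((16 * K2 ^+ 2)^-1) ^+ (2 ^ j).
    rewrite mulnC exprM lerXn2r ?nnegrE ?exprn_ge0 ?divr_ge0 ?(ltW e0)//.
    by apply: HN1; rewrite /M0; lia.
  have hK : ((16 * K2 ^+ 2)^-1) ^+ (2 ^ j) <= (1 / 4) ^+ (2 ^ j) / (4 * K2 ^+ 2).
    have -> : (16 * K2 ^+ 2)^-1 = 1 / 4 * (4 * K2 ^+ 2)^-1 by field; rewrite gt_eqF.
    rewrite exprMn ler_wpM2l ?exprn_ge0 ?divr_ge0// -[leRHS]expr1.
    have K22 : 1 <= K2 ^+ 2 by exact: exprn_ege1.
    apply: ler_wiXn2l => //; first by rewrite invr_ge0 mulr_ge0// exprn_ge0// ltW.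
    by rewrite invf_le1 ?mulr_gt0 ?exprn_gt0//; lra.
  have e14 : (1 / 4) ^+ (2 ^ j) = ((1 / 2) ^+ (2 ^ j)) ^+ 2 :> R.
    by rewrite -exprM mulnC exprM; congr (_ ^+ _); field.
  have e12 : (1 / 2) ^+ (2 ^ j.+1) = ((1 / 2) ^+ (2 ^ j)) ^+ 2 :> R.
    by rewrite -exprM expnS mulnC.
  rewrite e12; rewrite e14 in hK; have := le_trans h89 hK.
  move: (_ ^+ (2 ^ j)) (_ ^+ (2 ^ j * M0)) => s b hb.
  apply: le_trans (ler_wpM2l (ltW K20) (lerD (lexx _) hb)) _.
  by rewrite le_eqVlt; apply/orP; left; apply/eqP; field; rewrite gt_eqF.
exists M0; split=> // j L; apply: le_trans (claim j L) _.
rewrite ler_pdivrMr ?mulr_gt0// ler_peMr ?exprn_ge0 ?divr_ge0//; lra.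
Qed.

(** On the block [2 ^ j * M0 <= n < 2 ^ j.+1 * M0] the bound [(1 / 2) ^ 2 ^ j]
    is at most geometric in [n]. *)
Lemma energy_geometric (R : realType) (x : nat -> R) M0 : (0 < M0)%N ->
  (forall j, tail_le x (2 ^ j * M0) ((1 / 2) ^+ (2 ^ j))) ->
  exists q A', [/\ 0 < q, q < 1 & energy_le x q A'].
Proof.
move=> M00 H; have m0 : 0 < M0%:R :> R by rewrite ltr0n.
have m1 : 1 <= M0%:R :> R by rewrite ler1n.
(* By Bernoulli's inequality [s ^ (2 * M0) >= 1 / 2]. *)
pose s : R := 1 - (4 * M0%:R)^-1.
have i0 : 0 < (4 * M0%:R)^-1 :> R by rewrite invr_gt0 mulr_gt0.
have i1 : (4 * M0%:R)^-1 <= 1 / 4 :> R.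
  by rewrite div1r lef_pV2 ?posrE ?mulr_gt0//; lra.
have s0 : 0 < s by rewrite /s; lra.
have s1 : s < 1 by rewrite /s; lra.
have s2 : 1 / 2 <= s ^+ (2 * M0).
  apply: le_trans (bernoulli_sub _ (ltW i0) _); last by lra.
  by rewrite natrM le_eqVlt; apply/orP; left; apply/eqP; field; rewrite gt_eqF.
have ys n : (M0 <= n)%N -> energy x n <= s ^+ n.
  move=> Mn; have d0 : (0 < n %/ M0)%N by rewrite divn_gt0.
  have := trunc_log_bounds (isT : (1 < 2)%N) d0; move: (trunc_log _ _) => j /andP[j1 j2].
  have j1' : (2 ^ j * M0 <= n)%N by rewrite -leq_divRL.
  have j2' : (n <= 2 * M0 * 2 ^ j)%N.
    by move: j2; rewrite ltn_divLR// expnS => /ltnW; rewrite mulnAC.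
  apply: (@le_trans _ _ ((1 / 2) ^+ (2 ^ j))).
    apply: le_trans (H j n.+1); rewrite big_mkcond big_ord_recr /= j1' lerDr.
    by apply: sumr_ge0 => k _; case: ifP => // _; exact: energy_ge0.
  apply: (@le_trans _ _ (s ^+ (2 * M0 * 2 ^ j))).
    by rewrite exprM lerXn2r ?nnegrE ?divr_ge0 ?exprn_ge0// ltW.
  by apply: ler_wiXn2l => //; exact: ltW.
pose q : R := (1 + s) / 2.
have q0 : 0 < q by rewrite /q; lra.
have q1 : q < 1 by rewrite /q; lra.
have sq0 : 0 <= s / q by rewrite divr_ge0// ltW.
have sq1 : s / q < 1 by rewrite ltr_pdivrMr// mul1r /q; lra.
exists q, (\sum_(n < M0) energy x n / q ^+ n + (1 - s / q)^-1); split=> // L.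
have y0 n : 0 <= energy x n / q ^+ n by rewrite divr_ge0 ?energy_ge0// exprn_ge0// ltW.
apply: le_trans (sum_le_ord (b := M0 + L) y0 (leq_addl _ _)) _.
rewrite big_split_ord /= lerD2l; apply: le_trans (geometric_sum_le L sq0 sq1).
apply: ler_sum => n _; apply: (@le_trans _ _ ((s / q) ^+ (M0 + n))).
  rewrite [leRHS]expr_div_n; apply: ler_wpM2r; first by rewrite invr_ge0 exprn_ge0 ?(ltW q0).
  by apply: ys; rewrite leq_addr.
by apply: ler_wiXn2l; rewrite ?leq_addl// ltW.
Qed.

Lemma energy_le_mono (R : realType) (x : nat -> R) (q A A' : R) :
  A <= A' -> energy_le x q A -> energy_le x q A'.
Proof. by move=> AA' H N; exact: le_trans (H N) AA'. Qed.

(** Multiplying the rate by [k] costs a cube; the condition on [q] and [k]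
    persists because the rates decrease. *)
Lemma energy_iterate (R : realType) (x : nat -> R) (K1 A q k : R) :
  1 <= K1 -> cubing_step x K1 -> 0 < k -> k <= 1 -> 0 < q -> q ^+ 2 + k^-1 <= 2 ->
  energy_le x q A ->
  exists D, 1 <= D /\ forall j, energy_le x (q * k ^+ j) (D ^+ (3 ^ j)).
Proof.
move=> K11 H k0 k1 q0 qk HA; have K10 : 0 < K1 by exact: lt_le_trans K11.
pose A1 := Num.max 1 A.
have A11 : 1 <= A1 by rewrite le_max lexx.
pose D := K1 * A1.
have D1 : 1 <= D by rewrite -[leLHS]mul1r; apply: ler_pM.
(* The division by [K1] makes the induction close:
   [K1 * (D ^ 3 ^ j / K1) ^ 3 <= D ^ 3 ^ j.+1 / K1]. *)
have claim j : energy_le x (q * k ^+ j) (D ^+ (3 ^ j) / K1).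
  elim: j => [|j IH].
    rewrite expn0 expr1 expr0 mulr1; apply: energy_le_mono HA.
    by rewrite /D mulrC mulKf ?gt_eqF// le_max lexx orbT.
  have qj : 0 < q * k ^+ j by rewrite mulr_gt0// exprn_gt0.
  apply: (@energy_le_mono _ _ _ (K1 * (D ^+ (3 ^ j) / K1) ^+ 3)).
    rewrite expr_div_n -exprM -expnSr.
    have : 0 <= D ^+ (3 ^ j.+1) by rewrite exprn_ge0// (le_trans ler01).
    move: (D ^+ _) => E E0.
    have -> : K1 * (E / K1 ^+ 3) = E / K1 / K1 by field; rewrite gt_eqF.
    by rewrite ler_pdivrMr// ler_peMr// divr_ge0// ltW.
  apply: H IH => //.
  - rewrite ler_pdivlMr// mul1r; apply: (@le_trans _ _ D).
      by rewrite /D ler_peMr// ltW.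
    rewrite -[leLHS]expr1; apply: ler_weXn2l => //; by rewrite expn_gt0.
  - by rewrite mulr_gt0// exprn_gt0.
  apply: le_trans qk; apply: lerD.
    by rewrite lerXn2r ?nnegrE ?(ltW q0) ?(ltW qj)// ler_piMr ?(ltW q0)// exprn_ile1 ?(ltW k0).
  by rewrite exprS le_eqVlt; apply/orP; left; apply/eqP; field; rewrite !gt_eqF// exprn_gt0.
exists D; split=> // j; apply: energy_le_mono (claim j).
by rewrite ler_pdivrMr// ler_peMr// exprn_ge0// (le_trans ler01).
Qed.

(** A first iteration with a ratio close to [1] makes the rate as small as
    desired; from a small rate the ratio [k] is admissible as soon as
    [1 / k < 2]. *)
Lemma energy_cubic_growth (R : realType) (x : nat -> R) (lambda mu K A k : R) :
  cubic_control x lambda mu K -> 0 <= K -> lambda <> 0 \/ mu <> 0 -> energy_le x 1 A ->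
  1 / 2 < k -> k < 1 ->
  exists q D, [/\ 0 < q, 1 <= D & forall j, energy_le x (q * k ^+ j) (D ^+ (3 ^ j))].
Proof.
move=> HK K0 nz HA k12 k1.
have [K1 [K11 Hstep]] := energy_improve HK K0 nz.
have [n1 [K2 [K21 Htail]]] := tail_improve HK K0 nz HA.
have [M0 [M00 Hdy]] := tail_dyadic HA K21 Htail.
have [q [A' [q0 q1 Hq]]] := energy_geometric M00 Hdy.
have q21 : q ^+ 2 < 1 by rewrite expr2; nra.
have q2 : 0 < q ^+ 2 by rewrite exprn_gt0.
(* The smallest ratio admissible from the rate [q]. *)
pose h := (2 - q ^+ 2)^-1.
have h0 : 0 < h by rewrite invr_gt0; lra.
have h1 : h < 1 by rewrite invf_lt1; lra.
have qh : q ^+ 2 + h^-1 <= 2 by rewrite invrK; lra.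
have [E [E1 HE]] := energy_iterate K11 Hstep h0 (ltW h1) q0 qh Hq.
have k0 : 0 < k by lra.
have kV : k^-1 < 2 by rewrite -(invrK 2) ltf_pV2 ?posrE ?invr_gt0//; lra.
have d0 : 0 < 2 - k^-1 by lra.
have [j Hj] := geometric_small (ltW h0) h1 d0.
have := Hj j (leqnn j) => hj.
have hj1 : h ^+ j <= 1 by rewrite exprn_ile1// ltW.
have hj0 : 0 < h ^+ j by rewrite exprn_gt0.
have qj0 : 0 < q * h ^+ j by rewrite mulr_gt0.
have qjk : (q * h ^+ j) ^+ 2 + k^-1 <= 2.
  have : (q * h ^+ j) ^+ 2 <= h ^+ j.
    rewrite exprMn expr2 [X in _ * X]expr2.
    move: (h ^+ j) hj0 hj1 => b b0 b1.
    have : q * q <= 1 by nra.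
    have : 0 <= q * q by nra.
    move: (q * q) => c c0 c1; have : b * b <= b by nra. nra.
  lra.
have [D [D1 HD]] := energy_iterate K11 Hstep k0 (ltW k1) qj0 qjk (HE j).
by exists (q * h ^+ j), D; split.
Qed.

(** * Cubic moments of polynomials *)

Lemma ccvgM (R : realType) (u v : nat -> R[i]) (l m : R[i]) :
  ccvg u l -> ccvg v m -> ccvg (fun n => u n * v n) (l * m).
Proof.
move=> ul vm.
apply: (ccvg_squeeze (v := fun n => cabs (u n - l) * cabs (v n - m) +
   (cabs l * cabs (v n - m) + cabs m * cabs (u n - l)))).
  move=> n.
  have -> : u n * v n - l * m = (u n - l) * (v n - m) + (l * (v n - m) + m * (u n - l)) by ring.
  apply: le_trans (cabsD _ _) _; rewrite cabsM lerD2l.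
  by apply: le_trans (cabsD _ _) _; rewrite !cabsM.
have -> : 0 = 0 * 0 + (cabs l * 0 + cabs m * 0) :> R by rewrite !mulr0 !addr0.
by apply: cvgD; [exact: cvgM|apply: cvgD; apply: cvgM => //; exact: cvg_cst].
Qed.

Lemma ccvg_conj (R : realType) (u : nat -> R[i]) (l : R[i]) :
  ccvg u l -> ccvg (fun n => conjc (u n)) (conjc l).
Proof.
rewrite /ccvg => h; have -> : (fun n => cabs (conjc (u n) - conjc l)) = (fun n => cabs (u n - l)).
  by apply/funext => n; rewrite -rmorphB cabs_conj.
by [].
Qed.

Lemma ccvg_cabs (R : realType) (u : nat -> R[i]) (l : R[i]) :
  ccvg u l -> (fun n => cabs (u n)) @ \oo --> cabs l.
Proof.
move=> /ccvgP h; apply/cvgrPdist_le => e e0; have [N HN] := h e e0.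
exists N => // n Nn; have := HN n Nn => hn.
have h1 := cabsD (u n - l) l; have h2 := cabsD (l - u n) (u n).
rewrite subrK in h1; rewrite subrK -opprB cabsN in h2.
by rewrite ler_norml; apply/andP; split; lra.
Qed.

Definition psum (R : realType) (a : nat -> R[i]) (N : nat) (z : R[i]) : R[i] :=
  \sum_(k < N) a k * z ^+ k.

Lemma cmeas_psum (R : realType) (a : nat -> R[i]) N : cmeas (psum a N).
Proof.
apply: (cmeas_sum (F := fun k z => a k * z ^+ k)) => k.
by apply: cmeasM; [exact: cmeas_cst|apply: cmeasX; exact: cmeas_id].
Qed.

Lemma cintble_moment (R : realType) (c : R) m n : 0 < c ->
  cintble (fun w : R[i] => w ^+ m * (gauss c w)%:C * conjc w ^+ n).
Proof.
move=> c0; apply: (rintble_kernel (v := fun w => w ^+ m * (gauss c w)%:C)).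
  apply: cmeasM; first by apply: cmeasX; exact: cmeas_id.
  by apply: cmeas_real; exact: rmeas_gauss.
move=> B; have := rintble_monomial (R := R) B m c0.
congr (rintble _); apply/funext => w.
by rewrite cabsM cabsX cabs_real ger0_norm ?(ltW (gauss_gt0 _ _))// expRD mulrA mulrAC.
Qed.

(** By orthogonality of the monomials only the terms with [i + j = n + k]
    survive. *)
Lemma cubic_moment_psum (R : realType) (a : nat -> R[i]) N n :
  cubic_moment (psum a N) n =
  \sum_(k < N) conjc (a k) * \sum_(i < N) \sum_(j < N) a i * a j *
    (if (i + j == n + k)%N then (rint (gauss 2 : R[i] -> R) * (n + k)`!%:R / 2 ^+ (n + k))%:C else 0).
Proof.
have two0 : (0 : R) < 2 by [].
pose M m p (w : R[i]) := w ^+ m * (gauss 2 w)%:C * conjc w ^+ p.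
have Mi m p : cintble (M m p) by exact: cintble_moment.
rewrite /cubic_moment.
transitivity (cintegral (fun w => \sum_(k < N) (conjc (a k) * \sum_(i < N) \sum_(j < N)
   a i * a j * M (i + j)%N (n + k)%N w))).
  congr cintegral; apply/funext => w; rewrite real_cM -[LHS]/(_ * _ * _ * _).
  have -> : (cabs (psum a N w) ^+ 2)%:C = conjc (psum a N w) * psum a N w by rewrite mulc_conj.
  rewrite [conjc _](_ : _ = \sum_(k < N) conjc (a k) * conjc w ^+ k); last first.
    rewrite /psum rmorph_sum; apply: eq_bigr => k _; by rewrite rmorphM rmorphXn.
  rewrite !mulr_suml; apply: eq_bigr => k _.
  rewrite -!mulrA; congr (_ * _).
  transitivity (conjc w ^+ k * (gauss 2 w)%:C * conjc w ^+ n * (psum a N w * psum a N w)); first by ring.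
  rewrite /psum mulr_suml mulr_sumr; apply: eq_bigr => i _.
  rewrite !mulr_sumr; apply: eq_bigr => j _.
  by rewrite /M !exprD; ring.
have Gi k : cintble (fun w => \sum_(i < N) \sum_(j < N) a i * a j * M (i + j)%N (n + k)%N w).
  apply: (cintble_sum (F := fun i w => \sum_(j < N) a i * a j * M (i + j)%N (n + k)%N w)) => i.
  apply: (cintble_sum (F := fun j w => a i * a j * M (i + j)%N (n + k)%N w)) => j.
  exact: cintbleZ.
rewrite (cintegral_sum (F := fun k w => conjc (a k) * \sum_(i < N) \sum_(j < N)
   a i * a j * M (i + j)%N (n + k)%N w)); last by move=> k; exact: cintbleZ.
apply: eq_bigr => k _; rewrite cintegralZ//; congr (_ * _).
rewrite (cintegral_sum (F := fun i w => \sum_(j < N) a i * a j * M (i + j)%N (n + k)%N w)); last first.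
  move=> i; apply: (cintble_sum (F := fun j w => a i * a j * M (i + j)%N (n + k)%N w)) => j.
  exact: cintbleZ.
apply: eq_bigr => i _.
rewrite (cintegral_sum (F := fun j w => a i * a j * M (i + j)%N (n + k)%N w)); last first.
  by move=> j; exact: cintbleZ.
apply: eq_bigr => j _; rewrite cintegralZ//; congr (_ * _).
by rewrite /M gauss_moment//.
Qed.

Lemma antidiagonal_sum_le (R : realType) (x : nat -> R) N m : (forall n, 0 <= x n) ->
  \sum_(i < N) \sum_(j < N) (if (i + j == m)%N then x i * x j else 0) <= convol x x m.
Proof.
move=> x0; pose G i := if (i < m.+1)%N then x i * x (m - i)%N else 0.
have G0 i : 0 <= G i by rewrite /G; case: ifP => // _; exact: mulr_ge0.
apply: (@le_trans _ _ (\sum_(i < N) G i)).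
  apply: ler_sum => i _; rewrite /G ltnS; have [im|mi] := leqP i m; last first.
    by rewrite big1// => j _; case: ifP => // /eqP E; exfalso; move: mi E; clear; lia.
  rewrite (eq_bigr (fun j : 'I_N => ((j : nat) == (m - i)%N)%:R * (x i * x j))).
    by rewrite (sum_delta (fun j => x i * x j)); case: (m - i < N)%N; rewrite ?mul1r ?mul0r ?mulr_ge0//.
  move=> j _; have -> : (i + j == m)%N = (j == m - i :> nat)%N by apply/eqP/eqP; lia.
  by case: eqP => _; rewrite ?mul1r ?mul0r.
apply: le_trans (sum_le_ord (b := N + m.+1) G0 (leq_addr _ _)) _.
rewrite /convol (big_ord_widen (N + m.+1) (fun i => x i * x (m - i)%N)) ?leq_addl//.
by rewrite [leRHS]big_mkcond.
Qed.

Lemma cubic_moment_psum_le (R : realType) (a : nat -> R[i]) N n :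
  cabs (cubic_moment (psum a N) n) <=
  rint (gauss 2 : R[i] -> R) * cubic_sum (fun n => cabs (a n)) predT N n.
Proof.
have J0 : 0 <= rint (gauss 2 : R[i] -> R) by apply: ltW; exact: rint_gauss_gt0.
rewrite cubic_moment_psum; apply: le_trans (cabs_sum _ _ _) _.
rewrite /cubic_sum mulr_sumr; apply: ler_sum => k _.
rewrite cabsM cabs_conj mulrCA; apply: ler_wpM2l; first exact: cabs_ge0.
set J := rint _ * _ / _; have JJ0 : 0 <= J by rewrite /J divr_ge0 ?exprn_ge0// mulr_ge0.
apply: (@le_trans _ _ (J * \sum_(i < N) \sum_(j < N)
    (if (i + j == n + k)%N then cabs (a i) * cabs (a j) else 0))).
  rewrite mulr_sumr; apply: le_trans (cabs_sum _ _ _) _; apply: ler_sum => i _.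
  rewrite mulr_sumr; apply: le_trans (cabs_sum _ _ _) _; apply: ler_sum => j _.
  rewrite !cabsM; case: ifP => _; rewrite ?cabs0 ?mulr0//.
  by rewrite cabs_real ger0_norm// mulrC.
rewrite /J -!mulrA; apply: ler_wpM2l => //; rewrite !mulrA; apply: ler_wpM2l.
  by rewrite divr_ge0 ?exprn_ge0.
by apply: (antidiagonal_sum_le (x := fun n => cabs (a n))) => i; exact: cabs_ge0.
Qed.

(** * Cubic moments of the solution *)

Lemma psum_le (R : realType) (a : nat -> R[i]) (A : R) :
  energy_le (fun n => cabs (a n)) 1 A ->
  forall N z, cabs (psum a N z) <= (A + 1) / 2 * expR (cabs z ^+ 2 / 2).
Proof.
move=> HA N z; apply: le_trans (cabs_sum _ _ _) _.
rewrite (eq_bigr (fun k : 'I_N => cabs (a k) * cabs z ^+ k)); last by move=> k _; rewrite cabsM cabsX.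
have := coef_growth N ltr01 (cabs_ge0 z) HA.
by rewrite mul1r.
Qed.

(** The partial sums share the pointwise bound of [coef_growth], whose cube is
    dominated by [gauss 2] with room to spare. *)
Lemma cubic_moment_cvg (R : realType) (f : R[i] -> R[i]) (a : nat -> R[i]) (A : R) n :
  cmeas f -> sums_to a f -> energy_le (fun n => cabs (a n)) 1 A ->
  ccvg (fun N => cubic_moment (psum a N) n) (cubic_moment f n).
Proof.
move=> mf af HA; have A0 : 0 <= A by have := HA 0%N; rewrite big_ord0.
have [C [C0 HC]] : exists C : R, 0 <= C /\
    forall N w, cabs (psum a N w) <= C * expR (cabs w ^+ 2 / 2).
  by exists ((A + 1) / 2); split; [rewrite divr_ge0// addr_ge0|exact: psum_le].
have half0 : (0 : R) < 1 / 2 by [].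
have m3 (g : R[i] -> R[i]) : cmeas g ->
    cmeas (fun w => (cabs (g w) ^+ 2 * gauss 2 w)%:C * g w * conjc w ^+ n).
  move=> mg; apply: cmeasM; last by apply: cmeasX; apply: cmeas_conj; exact: cmeas_id.
  apply: cmeasM => //; apply: cmeas_real; apply: rmeasM; last exact: rmeas_gauss.
  by apply: rmeasX; exact: rmeas_cabs.
apply: (cintegral_dominated (F := fun N w => (cabs (psum a N w) ^+ 2 * gauss 2 w)%:C * psum a N w * conjc w ^+ n)
  (g := fun w => C ^+ 3 * (cabs w ^+ n * expR (0 * cabs w - 1 / 2 * cabs w ^+ 2)))).
- by move=> N; apply: m3; exact: cmeas_psum.
- exact: m3.
- by apply: rintbleZ; exact: rintble_monomial.
- move=> N w; have h := HC N w.
  rewrite !cabsM cabs_real ger0_norm; last by rewrite mulr_ge0 ?sqr_ge0// ltW// gauss_gt0.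
  rewrite cabsX cabs_conj.
  have -> : cabs (psum a N w) ^+ 2 * gauss 2 w * cabs (psum a N w) * cabs w ^+ n =
     cabs (psum a N w) ^+ 3 * (cabs w ^+ n * gauss 2 w) by ring.
  have -> : C ^+ 3 * (cabs w ^+ n * expR (0 * cabs w - 1 / 2 * cabs w ^+ 2)) =
     (C * expR (cabs w ^+ 2 / 2)) ^+ 3 * (cabs w ^+ n * gauss 2 w).
    have -> : expR (0 * cabs w - 1 / 2 * cabs w ^+ 2) = expR (cabs w ^+ 2 / 2) ^+ 3 * gauss 2 w.
      by rewrite -expRM_natl -expRD; congr expR; field.
    by ring.
  apply: ler_wpM2r; first by rewrite mulr_ge0 ?exprn_ge0 ?cabs_ge0// ltW// gauss_gt0.
  by rewrite lerXn2r ?nnegrE ?cabs_ge0// (le_trans _ h) ?cabs_ge0.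
move=> w; have pf : ccvg (psum a ^~ w) (f w) by exact: af.
have e (g : R[i] -> R[i]) : (cabs (g w) ^+ 2 * gauss 2 w)%:C * g w * conjc w ^+ n =
   conjc (g w) * g w * g w * ((gauss 2 w)%:C * conjc w ^+ n).
  by rewrite real_cM mulc_conj; ring.
rewrite e; have -> : (fun N => (cabs (psum a N w) ^+ 2 * gauss 2 w)%:C * psum a N w * conjc w ^+ n) =
  (fun N => conjc (psum a N w) * psum a N w * psum a N w * ((gauss 2 w)%:C * conjc w ^+ n)).
  by apply/funext => N; exact: e.
apply: ccvgM; last exact: ccvg_cst.
by apply: ccvgM => //; apply: ccvgM => //; exact: ccvg_conj.
Qed.

Lemma sum_sqr_cvg (R : realType) (d : nat -> R) (u : nat -> nat -> R) (l : nat -> R) L :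
  (forall n, (u ^~ n) @ \oo --> l n) ->
  (fun N => \sum_(n < L) d n * u N n ^+ 2) @ \oo --> \sum_(n < L) d n * l n ^+ 2.
Proof.
move=> h; elim: L => [|L IH].
  rewrite big_ord0 (_ : (fun N => _) = (fun=> 0)); first exact: cvg_cst.
  by apply/funext => N; rewrite big_ord0.
rewrite big_ord_recr /= (_ : (fun N => _) = (fun N => \sum_(n < L) d n * u N n ^+ 2 + d L * u N L ^+ 2)).
  by apply: cvgD => //; apply: cvgM; [exact: cvg_cst|rewrite !expr2; apply: cvgM].
by apply/funext => N; rewrite big_ord_recr.
Qed.

(** The equation bounds a coefficient by a cubic moment, a limit of cubic
    moments of polynomials, which are estimated by [cubic_sum]. *)
Lemma stationary_cubic_control (R : realType) (f : R[i] -> R[i]) (a : nat -> R[i])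
    (lambda mu A : R) :
  cmeas f -> sums_to a f -> energy_le (fun n => cabs (a n)) 1 A ->
  (forall n, (lambda + mu * n%:R)%:C * a n = (pi^-1)%:C * ((n`!%:R)^-1 * cubic_moment f n)) ->
  cubic_control (fun n => cabs (a n)) lambda mu ((pi^-1 * rint (gauss 2 : R[i] -> R)) ^+ 2).
Proof.
move=> mf af HA eqn L d B d0 HB; set J := rint _.
move: (pi^-1) eqn => p eqn.
have J0 : 0 <= J by apply: ltW; exact: rint_gauss_gt0.
pose c n := p ^+ 2 * (d n / n`!%:R).
have c0 n : 0 <= c n by rewrite mulr_ge0 ?sqr_ge0// divr_ge0.
have -> : \sum_(n < L) d n * ((lambda + mu * n%:R) ^+ 2 * energy (fun n => cabs (a n)) n) =
   \sum_(n < L) c n * cabs (cubic_moment f n) ^+ 2.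
  apply: eq_bigr => n _; have := congr1 (@cabs R) (eqn n).
  rewrite !cabsM !cabs_real cabsV cabs_nat => h.
  have f0 : n`!%:R != 0 :> R by rewrite pnatr_eq0 -lt0n fact_gt0.
  have -> : (lambda + mu * n%:R) ^+ 2 * energy (fun n => cabs (a n)) n =
     n`!%:R * (`|lambda + mu * n%:R| * cabs (a n)) ^+ 2.
    by rewrite /energy exprMn real_normK ?num_real//; ring.
  rewrite h !exprMn real_normK ?num_real// /c exprVn.
  by move: (cabs _) => s; field.
have cv := sum_sqr_cvg (d := c) (u := fun N n => cabs (cubic_moment (psum a N) n))
  (l := fun n => cabs (cubic_moment f n)) (L := L)
  (fun n => ccvg_cabs (@cubic_moment_cvg R f a A n mf af HA)).
rewrite -(cvg_lim _ cv)//; apply: limr_le; first by apply/cvg_ex; eexists; exact: cv.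
near=> N; apply: (@le_trans _ _ ((p * J) ^+ 2 * \sum_(n < L) d n *
   (cubic_sum (fun n => cabs (a n)) predT N n ^+ 2 / n`!%:R))).
  rewrite mulr_sumr; apply: ler_sum => n _.
  have -> : (p * J) ^+ 2 * (d n * (cubic_sum (fun n => cabs (a n)) predT N n ^+ 2 / n`!%:R)) =
    c n * (J * cubic_sum (fun n => cabs (a n)) predT N n) ^+ 2 by rewrite /c; ring.
  apply: ler_wpM2l => //; have := cubic_moment_psum_le a N n; rewrite -/J => h.
  by rewrite lerXn2r ?nnegrE ?cabs_ge0// (le_trans _ h) ?cabs_ge0.
by apply: ler_wpM2l; [exact: sqr_ge0|exact: HB].
Unshelve. all: by end_near.
Qed.

(** * The degenerate equation *)

(** Expand one factor [conj f] into its partial sums: each term is a multiple of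
    a cubic moment. *)
Lemma quartic_vanishes (R : realType) (f : R[i] -> R[i]) (a : nat -> R[i]) (A C : R) :
  cmeas f -> sums_to a f -> energy_le (fun n => cabs (a n)) 1 A ->
  (forall z, cabs (f z) <= C * expR (cabs z ^+ 2 / 2)) ->
  rintble (fun w => cabs (f w) ^+ 2 * gauss 1 w) ->
  (forall n, cubic_moment f n = 0) ->
  rintble (fun w => cabs (f w) ^+ 4 * gauss 2 w) /\ rint (fun w => cabs (f w) ^+ 4 * gauss 2 w) = 0.
Proof.
move=> mf af HA fC f2 cm0.
have [C1 [C10 HC1]] : exists C1 : R, 0 <= C1 /\ forall N w, cabs (psum a N w) <= C1 * expR (cabs w ^+ 2 / 2).
  have A0 : 0 <= A by have := HA 0%N; rewrite big_ord0.
  by exists ((A + 1) / 2); split; [rewrite divr_ge0// addr_ge0|exact: psum_le].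
have C0 : 0 <= C.
  have := le_trans (cabs_ge0 _) (fC 0); rewrite pmulr_lge0 //; exact: expR_gt0.
pose v w := (cabs (f w) ^+ 2 * gauss 2 w)%:C * f w.
have mv : cmeas v.
  apply: cmeasM => //; apply: cmeas_real; apply: rmeasM; last exact: rmeas_gauss.
  by apply: rmeasX; exact: rmeas_cabs.
have vi n : cintble (fun w => v w * conjc w ^+ n).
  by apply: rintble_kernel => // B; exact: (rintble_cubic B mf fC).
pose q w := cabs (f w) ^+ 4 * gauss 2 w.
have q0 w : 0 <= q w by rewrite mulr_ge0 ?exprn_ge0 ?cabs_ge0// ltW// gauss_gt0.
have g1 w : expR (cabs w ^+ 2 / 2) ^+ 2 * gauss 2 w = gauss 1 w.
  by rewrite /gauss -expRM_natl -expRD; congr expR; field.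
have qi : rintble q.
  apply: (rintble_le (g := fun w => C ^+ 2 * (cabs (f w) ^+ 2 * gauss 1 w))).
  - by apply: rmeasM; [apply: rmeasX; exact: rmeas_cabs|exact: rmeas_gauss].
  - exact: rintbleZ.
  move=> w; rewrite ger0_norm// /q -g1.
  have -> : C ^+ 2 * (cabs (f w) ^+ 2 * (expR (cabs w ^+ 2 / 2) ^+ 2 * gauss 2 w)) =
     (C * expR (cabs w ^+ 2 / 2)) ^+ 2 * (cabs (f w) ^+ 2 * gauss 2 w) by ring.
  have -> : cabs (f w) ^+ 4 * gauss 2 w = cabs (f w) ^+ 2 * (cabs (f w) ^+ 2 * gauss 2 w) by ring.
  apply: ler_wpM2r; first by rewrite mulr_ge0 ?exprn_ge0 ?cabs_ge0// ltW// gauss_gt0.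
  by rewrite lerXn2r ?nnegrE ?cabs_ge0// (le_trans _ (fC w)) ?cabs_ge0.
split=> //.
pose F N w := \sum_(k < N) conjc (a k) * (v w * conjc w ^+ k).
have F0 N : cintegral (F N) = 0.
  rewrite /F (cintegral_sum (F := fun k w => conjc (a k) * (v w * conjc w ^+ k))); last first.
    by move=> k; exact: cintbleZ.
  by rewrite big1// => k _; rewrite cintegralZ// [X in _ * X]cm0 mulr0.
have FE N w : F N w = conjc (psum a N w) * v w.
  rewrite /F /psum rmorph_sum mulr_suml; apply: eq_bigr => k _.
  by rewrite rmorphM rmorphXn; ring.
have Fq : ccvg (fun N => cintegral (F N)) (cintegral (fun w => (q w)%:C)).
  apply: (cintegral_dominated (g := fun w => (C1 * C) * (cabs (f w) ^+ 2 * gauss 1 w))).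
  - move=> N; rewrite (_ : F N = fun w => conjc (psum a N w) * v w); last by apply/funext => w; exact: FE.
    by apply: cmeasM => //; apply: cmeas_conj; exact: cmeas_psum.
  - by apply: cmeas_real; exact: rintble_meas.
  - exact: rintbleZ.
  - move=> N w; rewrite FE /v !cabsM cabs_conj cabs_real ger0_norm; last first.
      by rewrite mulr_ge0 ?exprn_ge0 ?cabs_ge0// ltW// gauss_gt0.
    rewrite -g1.
    have -> : C1 * C * (cabs (f w) ^+ 2 * (expR (cabs w ^+ 2 / 2) ^+ 2 * gauss 2 w)) =
      (C1 * expR (cabs w ^+ 2 / 2)) * ((cabs (f w) ^+ 2 * gauss 2 w) * (C * expR (cabs w ^+ 2 / 2))) by ring.
    have gg : 0 <= cabs (f w) ^+ 2 * gauss 2 w by rewrite mulr_ge0 ?exprn_ge0 ?cabs_ge0// ltW// gauss_gt0.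
    apply: ler_pM; [exact: cabs_ge0|by rewrite mulr_ge0 ?cabs_ge0|exact: HC1|].
    exact: ler_wpM2l.
  move=> w; have -> : (q w)%:C = conjc (f w) * v w.
    rewrite /q /v (_ : cabs (f w) ^+ 4 * gauss 2 w = cabs (f w) ^+ 2 * gauss 2 w * cabs (f w) ^+ 2); last by ring.
    by rewrite real_cM -(mulc_conj (f w)); ring.
  have -> : F ^~ w = fun N => conjc (psum a N w) * v w by apply/funext => N; exact: FE.
  by apply: ccvgM; [apply: ccvg_conj; exact: af|exact: ccvg_cst].
have : cintegral (fun w => (q w)%:C) = 0.
  apply: ccvg_uniq Fq _; rewrite (_ : (fun N => _) = fun=> 0); first exact: ccvg_cst.
  by apply/funext => N; exact: F0.
by rewrite cintegralE => /(congr1 (@complex.Re R)).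
Qed.

Lemma monomial_gauss_bounded (R : realType) n (w : R[i]) :
  cabs w ^+ n * expR (- (cabs w ^+ 2 / 2)) <= n`!%:R * expR (1 / 2).
Proof.
have f0 : 0 < n`!%:R :> R by rewrite ltr0n fact_gt0.
have := sum_exp_le n.+1 (cabs_ge0 w); rewrite big_ord_recr /= => h.
have {}h : cabs w ^+ n <= n`!%:R * expR (cabs w).
  rewrite mulrC -ler_pdivrMr//; apply: le_trans h; rewrite lerDr.
  by apply: sumr_ge0 => k _; rewrite divr_ge0// exprn_ge0// cabs_ge0.
apply: (@le_trans _ _ (n`!%:R * expR (cabs w) * expR (- (cabs w ^+ 2 / 2)))).
  by apply: ler_wpM2r => //; exact: expR_ge0.
rewrite -mulrA ler_wpM2l ?(ltW f0)// -expRD ler_expR.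
have := sqr_ge0 (cabs w - 1); move: (cabs w) => x; nra.
Qed.

(** Since [p <= e + p ^ 4 / e ^ 3] for every [e > 0], the fourth power controls
    the first. *)
Lemma quartic_zero_moment (R : realType) (f : R[i] -> R[i]) n :
  cmeas f -> rintble (fun w => cabs (f w) ^+ 2 * gauss 1 w) ->
  rintble (fun w => cabs (f w) ^+ 4 * gauss 2 w) ->
  rint (fun w => cabs (f w) ^+ 4 * gauss 2 w) = 0 ->
  cintegral (fun w => f w * (gauss 1 w)%:C * conjc w ^+ n) = 0.
Proof.
move=> mf f2 qi q0; apply/eqP; rewrite -cabs_eq0 eq_le cabs_ge0 andbT.
pose b (w : R[i]) := cabs w ^+ n * expR (0 * cabs w - 1 / 2 * cabs w ^+ 2).
have bi : rintble b by apply: rintble_monomial.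
pose M : R := n`!%:R * expR (1 / 2).
have bM w : b w <= M.
  apply: le_trans (monomial_gauss_bounded n w).
  by rewrite /b (_ : 0 * cabs w - _ = - (cabs w ^+ 2 / 2))//; field.
have b0 w : 0 <= b w by rewrite mulr_ge0 ?exprn_ge0 ?cabs_ge0// expR_ge0.
have ci : cintble (fun w => f w * (gauss 1 w)%:C * conjc w ^+ n).
  apply: (rintble_kernel (v := fun w => f w * (gauss 1 w)%:C)).
    by apply: cmeasM => //; apply: cmeas_real; exact: rmeas_gauss.
  move=> B; have := rintble_L2_exp B mf f2.
  congr (rintble _); apply/funext => w.
  by rewrite cabsM cabs_real ger0_norm ?(ltW (gauss_gt0 _ _))// expRD mulrA mulrAC.
have key e : 0 < e -> cabs (cintegral (fun w => f w * (gauss 1 w)%:C * conjc w ^+ n)) <= 2 * (e * rint b).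
  move=> e0.
  have -> : e * rint b = rint (fun w => e * b w + M / e ^+ 3 * (cabs (f w) ^+ 4 * gauss 2 w)).
    by rewrite rintD ?rintZ ?q0 ?mulr0 ?addr0//; exact: rintbleZ.
  apply: cintegral_norm => //; first by apply: rintbleD; exact: rintbleZ.
  move=> w; rewrite !cabsM cabsX cabs_conj cabs_real ger0_norm ?(ltW (gauss_gt0 _ _))//.
  pose p := cabs (f w) * expR (- (cabs w ^+ 2 / 2)).
  have p0 : 0 <= p by rewrite mulr_ge0 ?cabs_ge0// expR_ge0.
  have -> : cabs (f w) * gauss 1 w * cabs w ^+ n = p * b w.
    rewrite /p /b /gauss.
    have -> : - (1 * cabs w ^+ 2) = - (cabs w ^+ 2 / 2) + (0 * cabs w - 1 / 2 * cabs w ^+ 2) by field.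
    by rewrite expRD; ring.
  have -> : cabs (f w) ^+ 4 * gauss 2 w = p ^+ 4.
    by rewrite /p exprMn -expRM_natl /gauss; congr (_ * expR _); field.
  have hp : p <= e + p ^+ 4 / e ^+ 3.
    have e3 : 0 < e ^+ 3 by rewrite exprn_gt0.
    have [pe|ep] := leP p e; first by rewrite (le_trans pe)// lerDl divr_ge0 ?exprn_ge0// ltW.
    rewrite -[leLHS]add0r; apply: lerD; first exact: ltW.
    rewrite ler_pdivlMr// [p ^+ 4]exprS ler_wpM2l// lerXn2r ?nnegrE//; exact: ltW.
  apply: le_trans (ler_wpM2r (b0 w) hp) _; rewrite mulrDl lerD2l.
  rewrite [leRHS]mulrC [leRHS]mulrCA [leRHS]mulrC; apply: ler_wpM2l; last exact: bM.
  by rewrite divr_ge0 ?exprn_ge0// ltW.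
apply/ler_addgt0Pl => d d0; rewrite addr0.
have r0 : 0 <= rint b by exact: rint_ge0.
have e0 : 0 < d / (2 * (rint b + 1)) by rewrite divr_gt0// mulr_gt0// ltr_pwDr.
apply: le_trans (key _ e0) _.
move: r0; move: (rint b) => r r0.
have -> : 2 * (d / (2 * (r + 1)) * r) = d * (r / (r + 1)) by field; lra.
by rewrite ler_piMr ?(ltW d0)// ler_pdivrMr; lra.
Qed.

(** If [lambda = mu = 0] all cubic moments vanish and so does the solution;
    otherwise the iteration applies, starting from the square summability given
    by [bessel]. *)
Lemma stationary_energy (R : realType) (u : R[i] -> R[i]) (lambda mu : R) :
  bargmann_fock u -> (exists z, u z <> 0) ->
  (forall z, lambda%:C * u z + mu%:C * Lambda u z =
     proj_bf (fun w => (cabs (u w) ^+ 2)%:C * u w) z) ->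
  exists f a, [/\ (forall z, u z = (expR (- (cabs z ^+ 2 / 2)))%:C * f z),
    sums_to a f &
    forall k : R, 1 / 2 < k -> k < 1 ->
      exists q D, [/\ 0 < q, 1 <= D &
        forall j, energy_le (fun n => cabs (a n)) (q * k ^+ j) (D ^+ (3 ^ j))]].
Proof.
move=> uBF [z0 uz0] ueq; have [f [hf mf uf f2]] := bargmann_fock_holo uBF.
have [ea af] := reproducing_series ltr01 hf mf (fun B => rintble_L2_exp B mf f2).
set a := gauss_coef 1 f in ea af.
have J0 : 0 < rint (gauss 1 : R[i] -> R) by exact: rint_gauss_gt0.
have [A HA] : exists A, energy_le (fun n => cabs (a n)) 1 A.
  exists (rint (fun w => cabs (f w) ^+ 2 * gauss 1 w) / rint (gauss 1 : R[i] -> R)) => N.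
  rewrite ler_pdivlMr// mulrC; apply: le_trans (bessel N mf f2).
  apply: ler_wpM2l; first exact: ltW.
  by apply: ler_sum => n _; rewrite expr1n divr1.
have fC z : cabs (f z) <= (A + 1) / 2 * expR (cabs z ^+ 2 / 2).
  by apply: ccvg_bounded (af z) _ => N; exact: psum_le HA N z.
have eqn := stationary_coef hf mf uf ea af fC ueq.
exists f, a; split=> // k k12 k1.
apply: (energy_cubic_growth (stationary_cubic_control mf af HA eqn) _ _ HA k12 k1).
  exact: sqr_ge0.
have [mu0|] := eqVneq mu 0; last by move=> /eqP; right.
have [l0|/eqP] := eqVneq lambda 0; last by left.
exfalso; apply: uz0.
have cm0 n : cubic_moment f n = 0.
  have := eqn n; rewrite l0 mu0 mul0r add0r mul0r => /esym/eqP.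
  rewrite mulf_eq0 => /orP[|].
    by rewrite -cabs_eq0 cabs_real normr_eq0 invr_eq0 gt_eqF// pi_gt0.
  by rewrite mulf_eq0 => /orP[|/eqP//]; rewrite invr_eq0 (negbTE (fact_neq0 _ _)).
have [qi q0] := quartic_vanishes mf af HA fC f2 cm0.
have a0 n : a n = 0.
  by rewrite /a /gauss_coef quartic_zero_moment// !mulr0.
rewrite uf (_ : f z0 = 0) ?mulr0//; apply: ccvg_uniq (af z0) _.
rewrite (_ : (fun N => _) = fun=> 0); first exact: ccvg_cst.
by apply/funext => N; rewrite big1// => n _; rewrite a0 mul0r.
Qed.

(** * From the coefficients to the order of growth *)

Lemma powR_expR (R : realType) (x y : R) : 0 < x -> x `^ y = expR (y * ln x).
Proof. by move=> x0; rewrite /powR gt_eqF. Qed.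

(** The estimate at radius [r] uses the iterate [j] with [3 ^ j ~ r ^ m]: by the
    choice of [k] both [D ^ 3 ^ j] and the Gaussian factor
    [exp (q k ^ j r ^ 2 / 2)] are then [exp (O (r ^ m))]. *)
Lemma coef_sum_scale (R : realType) (a : nat -> R[i]) (q D k m : R) :
  0 < q -> 1 <= D -> 1 <= m -> k = expR ((1 - 2 / m) * ln 3) ->
  (forall j, energy_le (fun n => cabs (a n)) (q * k ^+ j) (D ^+ (3 ^ j))) ->
  exists L, 0 <= L /\ forall r, 1 <= r -> forall N,
    \sum_(n < N) cabs (a n) * r ^+ n <= expR (L * r `^ m).
Proof.
move=> q0 D1 m1 kE H; have D0 : 0 < D by exact: lt_le_trans D1.
have m0 : 0 < m by exact: lt_le_trans m1.
have k0 : 0 < k by rewrite kE expR_gt0.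
have lD : 0 <= ln D by exact: ln_ge0.
have l3 : 0 < ln 3 :> R by rewrite ln_gt0// ltr1n.
exists (ln D + 9 * q / 2); split.
  by rewrite addr_ge0// divr_ge0// mulr_ge0// ltW.
move=> r r1 N; have r0 : 0 < r by exact: lt_le_trans r1.
set X := r `^ m; have XE : X = expR (m * ln r) by exact: powR_expR.
have lr : 0 <= ln r by exact: ln_ge0.
have X1 : 1 <= X by rewrite XE -expR0 ler_expR mulr_ge0// ltW.
have X0 : 0 < X by exact: lt_le_trans X1.
have t0 : (0 < Num.truncn X)%N by rewrite truncn_gt0.
have := trunc_log_bounds (isT : (1 < 3)%N) t0; move: (trunc_log _ _) => j /andP[j1 j2].
have {}j1 : 3 ^+ j <= X.
  rewrite -natrX; apply: (@le_trans _ _ (Num.truncn X)%:R); first by rewrite ler_nat.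
  by rewrite truncn_le ltW.
have {}j2 : X <= 3 ^+ j.+1.
  apply: (le_trans (ltW (truncnS_gt X))); by rewrite -natrX ler_nat.
have e3 i : 3 ^+ i = expR (i%:R * ln 3) :> R by rewrite expRM_natl lnK// posrE.
rewrite e3 XE ler_expR in j1; rewrite e3 XE ler_expR in j2.
have kr : k ^+ j * r ^+ 2 <= 9 * X.
  have -> : k ^+ j = expR (j%:R * ((1 - 2 / m) * ln 3)) by rewrite kE expRM_natl.
  have -> : r ^+ 2 = expR (2 * ln r) by rewrite expRM_natl lnK// posrE.
  have -> : 9 = expR (2 * ln 3) :> R by rewrite expRM_natl lnK ?posrE//; ring.
  rewrite XE -!expRD ler_expR.
  have -> : 2 * ln r = 2 / m * (m * ln r) by field; rewrite gt_eqF.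
  rewrite -natr1 mulrDl mul1r in j2.
  have m2 : 2 / m <= 2 by rewrite ler_pdivrMr// ler_peMr.
  have m20 : 0 <= 2 / m by rewrite divr_ge0// ltW.
  move: (2 / m) (m * ln r) m2 m20 j1 j2 => b t b2 b0 j1 j2.
  have -> : j%:R * ((1 - b) * ln 3) + b * t = j%:R * ln 3 + b * (t - j%:R * ln 3) by ring.
  have : b * (t - j%:R * ln 3) <= b * ln 3 by rewrite ler_wpM2l// lerBlDl.
  have : b * ln 3 <= 2 * ln 3 by rewrite ler_wpM2r// ltW.
  lra.
have qk0 : 0 < q * k ^+ j by rewrite mulr_gt0// exprn_gt0.
apply: le_trans (coef_growth N qk0 (ltW r0) (H j)) _.
have Dj : D ^+ (3 ^ j) <= expR (ln D * X).
  have {1}-> : D = expR (ln D) by rewrite lnK// posrE.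
  rewrite -expRM_natl ler_expR mulrC ler_wpM2l// natrX XE e3.
  by rewrite ler_expR.
have Dj1 : 1 <= D ^+ (3 ^ j) by exact: exprn_ege1.
rewrite [_ * X]mulrDl expRD; apply: ler_pM.
- by rewrite divr_ge0// addr_ge0// (le_trans ler01).
- exact: expR_ge0.
- by lra.
rewrite ler_expR.
have -> : q * k ^+ j * r ^+ 2 / 2 = q / 2 * (k ^+ j * r ^+ 2) by ring.
have -> : 9 * q / 2 * X = q / 2 * (9 * X) by ring.
by rewrite ler_wpM2l// divr_ge0// ltW.
Qed.

Lemma powR_absorb (R : realType) (L m eta : R) : 0 <= L -> 0 <= m -> m < eta ->
  exists K, 0 <= K /\ forall r, 1 <= r -> L * r `^ m <= K + r `^ eta.
Proof.
move=> L0 m0 me; have t0 : 0 < eta - m by rewrite subr_gt0.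
exists (L * L `^ (m / (eta - m))); split; first by rewrite mulr_ge0// powR_ge0.
move=> r r1; have r0 : 0 < r by exact: lt_le_trans r1.
have -> : r `^ eta = r `^ (eta - m) * r `^ m.
  by rewrite -powRD ?subrK//; apply/implyP => _; rewrite gt_eqF.
have p0 : 0 <= r `^ m by exact: powR_ge0.
have [Lr|rL] := leP L (r `^ (eta - m)).
  by apply: le_trans (ler_wpM2r p0 Lr) _; rewrite lerDr mulr_ge0// powR_ge0.
apply: (@le_trans _ _ (L * L `^ (m / (eta - m)))); last first.
  by rewrite lerDl mulr_ge0// powR_ge0.
rewrite ler_wpM2l//.
have -> : r `^ m = (r `^ (eta - m)) `^ (m / (eta - m)).
  by rewrite -powRrM mulrCA mulfV ?mulr1// gt_eqF.
apply: ge0_ler_powR; rewrite ?nnegrE ?powR_ge0//; last exact: ltW.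
by rewrite divr_ge0// ltW.
Qed.

(** The origin of the exponent: the ratio [k = 3 ^ (1 - 2 / m)] is admissible,
    that is [k > 1 / 2], exactly when [m > eta0]. *)
Lemma eta0_exponent (R : realType) (eta : R) : eta0 R < eta ->
  exists m, [/\ 1 <= m, m < eta, expR ((1 - 2 / m) * ln 3) < 1 &
    1 / 2 < expR ((1 - 2 / m) * ln 3)].
Proof.
move=> He.
have l3 : 0 < ln 3 :> R by rewrite ln_gt0// ltr1n.
have l2 : 0 < ln 2 :> R by rewrite ln_gt0// ltr1n.
have l23 : ln 2 < ln 3 :> R by rewrite ltr_ln ?posrE// ltr_nat.
pose s : R := ln 2 / ln 3.
have s0 : 0 < s by rewrite divr_gt0.
have s1 : s < 1 by rewrite ltr_pdivrMr// mul1r.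
have e0E : eta0 R = (2^-1 + 2^-1 * s)^-1 by [].
have d0 : 0 < 2^-1 + 2^-1 * s by lra.
have e1 : 1 <= eta0 R by rewrite e0E invf_ge1//; lra.
have e2 : eta0 R < 2 by rewrite e0E -[ltRHS]invrK ltf_pV2 ?posrE ?invr_gt0//; lra.
pose m := (eta0 R + Num.min eta 2) / 2.
have em : eta0 R < Num.min eta 2 by rewrite lt_min He.
have m1 : eta0 R < m by rewrite /m; lra.
have m2 : m < Num.min eta 2 by rewrite /m; lra.
have m_eta : m < eta by apply: lt_le_trans m2 _; rewrite ge_min lexx.
have m_2 : m < 2 by apply: lt_le_trans m2 _; rewrite ge_min lexx orbT.
have m0 : 0 < m by lra.
exists m; split=> //; first by lra.
  rewrite expR_lt1 pmulr_llt0// subr_lt0 ltr_pdivlMr//; lra.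
have -> : 1 / 2 = expR (- ln 2) :> R by rewrite expRN lnK ?posrE// div1r.
rewrite ltr_expR; have -> : - ln 2 = - s * ln 3 by rewrite mulNr /s divfK// gt_eqF.
rewrite ltr_pM2r//.
have : 2 / m < 1 + s.
  rewrite ltr_pdivrMr// mulrC -ltr_pdivrMr ?addr_gt0//; apply: le_lt_trans m1.
  by rewrite e0E le_eqVlt; apply/orP; left; apply/eqP; field; rewrite !gt_eqF//; lra.
lra.
Qed.

(** The multiplicative constant in the exponent is absorbed by an arbitrarily
    small increase of the order. *)
Lemma coef_sum_growth (R : realType) (a : nat -> R[i]) (eta : R) : eta0 R < eta ->
  (forall k : R, 1 / 2 < k -> k < 1 -> exists q D, [/\ 0 < q, 1 <= D &
     forall j, energy_le (fun n => cabs (a n)) (q * k ^+ j) (D ^+ (3 ^ j))]) ->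
  exists K, 0 <= K /\ forall r, 0 <= r -> forall N,
    \sum_(n < N) cabs (a n) * r ^+ n <= expR (K + r `^ eta).
Proof.
move=> /eta0_exponent[m [m1 me k1 k2]] /(_ _ k2 k1)[q [D [q0 D1 H]]].
have [L [L0 HL]] := coef_sum_scale q0 D1 m1 erefl H.
have m0 : 0 <= m by exact: le_trans m1.
have [K [K0 HK]] := powR_absorb L0 m0 me.
exists (K + 1); split; first by rewrite addr_ge0.
move=> r r0 N; have [r1|r1] := leP 1 r.
  by apply: le_trans (HL r r1 N) _; rewrite ler_expR; apply: le_trans (HK r r1) _; lra.
apply: (@le_trans _ _ (\sum_(n < N) cabs (a n) * 1 ^+ n)).
  apply: ler_sum => n _; apply: ler_wpM2l; first exact: cabs_ge0.
  by rewrite expr1n exprn_ile1// ltW.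
apply: le_trans (HL 1 (lexx 1) N) _; rewrite ler_expR; apply: le_trans (HK 1 (lexx 1)) _.
by rewrite powR1 lerDl powR_ge0.
Qed.

(** * Dividing power series by their roots *)

Definition series_root (R : realType) (c : nat -> R[i]) (z : R[i]) : Prop :=
  ccvg (fun N => \sum_(k < N) c k * z ^+ k) 0.

(** The coefficients of the quotient of the power series [c] by [z - alpha]. At
    a root [alpha] they are also [\sum_(k > n) c k * alpha ^ (k - n - 1)]. *)
Definition root_quotient (R : realType) (c : nat -> R[i]) (alpha : R[i]) (n : nat) : R[i] :=
  - (\sum_(k < n.+1) c k * alpha ^+ k) / alpha ^+ n.+1.

Lemma root_quotient_rec (R : realType) (c : nat -> R[i]) (alpha : R[i]) : alpha != 0 ->
  c 0%N = - alpha * root_quotient c alpha 0 /\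
  forall n, c n.+1 = root_quotient c alpha n - alpha * root_quotient c alpha n.+1.
Proof.
move=> a0; split.
  by rewrite /root_quotient big_ord_recl big_ord0 addr0 expr0 expr1 mulr1; field.
move=> n; rewrite /root_quotient.
have -> : \sum_(k < n.+2) c k * alpha ^+ k = \sum_(k < n.+1) c k * alpha ^+ k + c n.+1 * alpha ^+ n.+1.
  by rewrite big_ord_recr.
move: (\sum_(k < n.+1) _) => s; rewrite !exprS; field.
by rewrite a0 expf_neq0.
Qed.

Lemma geometric_antidiagonal_le (R : realType) (r rho : R) m : 0 <= r -> r < rho ->
  \sum_(n < m) rho ^+ n * r ^+ (m - n.+1) <= rho ^+ m / (rho - r).
Proof.
move=> r0 rr; have d0 : 0 < rho - r by rewrite subr_gt0.
rewrite ler_pdivlMr// mulrC.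
have -> : \sum_(n < m) rho ^+ n * r ^+ (m - n.+1) = \sum_(i < m) rho ^+ (m.-1 - i) * r ^+ i.
  rewrite (reindex_inj rev_ord_inj) /=; apply: eq_bigr => i _.
  by congr (_ ^+ _ * _ ^+ _); have := ltn_ord i; lia.
by rewrite -subrXX lerBlDr lerDl exprn_ge0.
Qed.

(** Insert the expression by tails of the series: each [c m] is weighted by
    [\sum_(n < m) rho ^ n * r ^ (m - n - 1) <= rho ^ m / (rho - r)]. *)
Lemma root_quotient_bound (R : realType) (c : nat -> R[i]) (alpha : R[i]) (r rho S : R) :
  alpha != 0 -> cabs alpha <= r -> r < rho -> series_root c alpha ->
  (forall N, \sum_(k < N) cabs (c k) * rho ^+ k <= S) ->
  forall N, \sum_(k < N) cabs (root_quotient c alpha k) * rho ^+ k <= S / (rho - r).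
Proof.
move=> a0 ar rr ra HS N.
have r0 : 0 <= r by exact: le_trans (cabs_ge0 _) ar.
have rho0 : 0 <= rho by rewrite ltW// (le_lt_trans r0).
have d0 : 0 < rho - r by rewrite subr_gt0.
(* Finite approximations of the expression by tails. *)
pose h M n := (\sum_(k < M) c k * alpha ^+ k - \sum_(k < n.+1) c k * alpha ^+ k) / alpha ^+ n.+1.
have hc n : ccvg (fun M => h M n) (root_quotient c alpha n).
  have -> : (fun M => h M n) = (fun M => (alpha ^+ n.+1)^-1 *
     (\sum_(k < M) c k * alpha ^+ k + (- \sum_(k < n.+1) c k * alpha ^+ k))).
    by apply/funext => M; rewrite /h mulrC.
  have -> : root_quotient c alpha n = (alpha ^+ n.+1)^-1 * (0 - \sum_(k < n.+1) c k * alpha ^+ k).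
    by rewrite /root_quotient mulrC sub0r.
  by apply: ccvgZ; apply: ccvgD => //; exact: ccvg_cst.
have hb M n : (n < M)%N ->
    cabs (h M n) <= \sum_(m < M) (if (n < m)%N then cabs (c m) * r ^+ (m - n.+1) else 0).
  move=> nM; rewrite -big_mkcond /=.
  have -> : h M n = \sum_(m < M | (n < m)%N) c m * alpha ^+ (m - n.+1).
    rewrite /h (bigID (fun k : 'I_M => (k < n.+1)%N)) /=.
    rewrite -(big_ord_widen M (fun k => c k * alpha ^+ k) nM) addrAC subrr add0r mulr_suml.
    apply: eq_big => m; first by rewrite -leqNgt.
    rewrite -leqNgt => nm.
    have -> : alpha ^+ m = alpha ^+ (m - n.+1) * alpha ^+ n.+1 by rewrite -exprD subnK.
    by rewrite mulrA mulfK// expf_neq0.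
  apply: le_trans (cabs_sum _ _ _) _; apply: ler_sum => m _; rewrite cabsM cabsX.
  by apply: ler_wpM2l; rewrite ?cabs_ge0// lerXn2r ?nnegrE ?cabs_ge0.
have hS M : (N <= M)%N -> \sum_(n < N) cabs (h M n) * rho ^+ n <= S / (rho - r).
  move=> NM.
  apply: (@le_trans _ _ (\sum_(n < N) \sum_(m < M) (if (n < m)%N then cabs (c m) * r ^+ (m - n.+1) else 0) * rho ^+ n)).
    apply: ler_sum => n _; rewrite -mulr_suml; apply: ler_wpM2r; first exact: exprn_ge0.
    by apply: hb; exact: leq_trans NM.
  rewrite exchange_big /=.
  apply: (@le_trans _ _ (\sum_(m < M) cabs (c m) * rho ^+ m / (rho - r))); last first.
    by rewrite -mulr_suml ler_wpM2r ?HS// invr_ge0 ltW.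
  apply: ler_sum => m _; rewrite -mulrA.
  apply: le_trans (ler_wpM2l (cabs_ge0 _) (geometric_antidiagonal_le m r0 rr)).
  pose G n := (if (n < m)%N then cabs (c m) * r ^+ (m - n.+1) else 0) * rho ^+ n.
  have G0 n : 0 <= G n.
    rewrite /G; case: ifP => _; last by rewrite mul0r.
    by rewrite !mulr_ge0 ?cabs_ge0 ?exprn_ge0.
  apply: le_trans (sum_le_ord (b := N + m) G0 (leq_addr _ _)) _.
  rewrite mulr_sumr (big_ord_widen (N + m) (fun n => cabs (c m) * (rho ^+ n * r ^+ (m - n.+1)))) ?leq_addl//.
  rewrite [leRHS]big_mkcond; apply: ler_sum => n _; rewrite /G; case: ifP => _; last by rewrite mul0r.
  by rewrite mulrAC mulrA.
have cv L : (fun M => \sum_(n < L) cabs (h M n) * rho ^+ n) @ \oo -->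
    \sum_(n < L) cabs (root_quotient c alpha n) * rho ^+ n.
  elim: L => [|L IH].
    rewrite big_ord0 (_ : (fun M => _) = (fun=> 0)); first exact: cvg_cst.
    by apply/funext => M; rewrite big_ord0.
  rewrite big_ord_recr /= (_ : (fun M => _) =
    (fun M => \sum_(n < L) cabs (h M n) * rho ^+ n + cabs (h M L) * rho ^+ L)).
    by apply: cvgD => //; apply: cvgM; [exact: ccvg_cabs|exact: cvg_cst].
  by apply/funext => M; rewrite big_ord_recr.
rewrite -(cvg_lim _ (cv N))//; apply: limr_le; first by apply/cvg_ex; eexists; exact: cv.
by near=> M; apply: hS; near: M; exact: nbhs_infty_ge.
Unshelve. all: by end_near.
Qed.

(** The recursion telescopes: at [beta], a partial sum of [c] is [beta - alpha]
    times one of the quotient, up to a boundary term that tends to [0] inside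
    the disc of radius [rho]. *)
Lemma root_quotient_root (R : realType) (c : nat -> R[i]) (alpha beta : R[i]) (rho S : R) :
  alpha != 0 -> beta != alpha -> cabs beta < rho -> series_root c beta ->
  (forall N, \sum_(k < N) cabs (root_quotient c alpha k) * rho ^+ k <= S) ->
  series_root (root_quotient c alpha) beta.
Proof.
move=> a0 ba brho rb HS; set g := root_quotient c alpha in HS *.
have [c0 cS] := root_quotient_rec c a0; rewrite -/g in c0 cS.
have rho0 : 0 < rho by exact: le_lt_trans (cabs_ge0 _) brho.
have ba0 : beta - alpha != 0 by rewrite subr_eq0.
have E N : \sum_(k < N.+1) c k * beta ^+ k =
    (beta - alpha) * (\sum_(k < N.+1) g k * beta ^+ k) - beta * (g N * beta ^+ N).
  elim: N => [|N IH]; first by rewrite !big_ord_recl !big_ord0 c0 /=; ring.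
  rewrite big_ord_recr /= IH [in RHS]big_ord_recr /= cS.
  by move: (\sum_(k < N.+1) _) => s; rewrite !exprS; ring.
have gb N : cabs (g N) * rho ^+ N <= S.
  apply: le_trans (HS N.+1); rewrite big_ord_recr /= lerDr.
  by apply: sumr_ge0 => k _; rewrite mulr_ge0 ?cabs_ge0 ?exprn_ge0// ltW.
have t0 : 0 <= cabs beta / rho by rewrite divr_ge0 ?cabs_ge0// ltW.
have t1 : cabs beta / rho < 1 by rewrite ltr_pdivrMr// mul1r.
have g0 : ccvg (fun N => g N * beta ^+ N) 0.
  apply: (ccvg_squeeze (v := fun N => S * (cabs beta / rho) ^+ N)) => [N|].
    rewrite subr0 cabsM cabsX.
    have -> : cabs (g N) * cabs beta ^+ N = cabs (g N) * rho ^+ N * (cabs beta / rho) ^+ N.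
      by rewrite -mulrA -exprMn mulrCA mulfV ?mulr1// gt_eqF.
    by apply: ler_wpM2r => //; exact: exprn_ge0.
  rewrite -(mulr0 S); apply: cvgM; first exact: cvg_cst.
  by apply: cvg_expr; rewrite ger0_norm.
have h : ccvg (fun N => (beta - alpha)^-1 * (\sum_(k < N.+1) c k * beta ^+ k + beta * (g N * beta ^+ N))) 0.
  rewrite -[X in ccvg _ X](mulr0 (beta - alpha)^-1); apply: ccvgZ.
  rewrite -[X in ccvg _ X](addr0 0); apply: ccvgD.
    move/ccvgP: rb => rb; apply/ccvgP => e e0; have [M HM] := rb e e0.
    by exists M => n Mn; apply: HM; exact: leqW.
  by rewrite -[X in ccvg _ X](mulr0 beta); apply: ccvgZ.
apply/ccvgP => e e0; move/ccvgP: h => /(_ e e0)[M HM].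
exists M.+1 => -[//|n] Mn; have := HM n Mn; rewrite E.
by rewrite subrK mulKf.
Qed.

(** A form of Jensen's inequality. Dividing out a root multiplies the absolute
    sum at radius [rho] by at most [1 / (rho - r)], and the constant coefficient
    by at least [1 / r]. *)
Lemma root_count_bound (R : realType) (s : seq R[i]) (c : nat -> R[i]) (r rho S : R) :
  0 <= r -> r < rho -> uniq s ->
  (forall z, z \in s -> [/\ z != 0, cabs z <= r & series_root c z]) ->
  (forall N, \sum_(k < N) cabs (c k) * rho ^+ k <= S) ->
  cabs (c 0%N) * (rho - r) ^+ size s <= S * r ^+ size s.
Proof.
move=> r0 rr; have d0 : 0 < rho - r by rewrite subr_gt0.
elim: s c S => [|alpha s IH] c S /=.
  by move=> _ _ /(_ 1%N); rewrite big_ord_recl big_ord0 !expr0 !mulr1 addr0.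
move=> /andP[as_ us] Hs HS.
have [a0 ar ra] := Hs alpha (mem_head _ _).
have gS := root_quotient_bound a0 ar rr ra HS.
have Hg z : z \in s -> [/\ z != 0, cabs z <= r & series_root (root_quotient c alpha) z].
  move=> zs; have [|z0 zr rz] := Hs z; first by rewrite inE zs orbT.
  split=> //; apply: root_quotient_root gS => //; last exact: le_lt_trans rr.
  by apply: contraNneq as_ => <-.
have := IH _ _ us Hg gS.
have [-> _] := root_quotient_rec c a0; rewrite (cabsM (- alpha)) (cabsN alpha).
move: (cabs (root_quotient c alpha 0)) (cabs_ge0 (root_quotient c alpha 0)) => g g0 h.
rewrite !exprS.
apply: (@le_trans _ _ (r * (rho - r) * (g * (rho - r) ^+ size s))).
  have -> : cabs alpha * g * ((rho - r) * (rho - r) ^+ size s) =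
    cabs alpha * ((rho - r) * (g * (rho - r) ^+ size s)) by ring.
  rewrite -mulrA; apply: ler_wpM2r => //; rewrite !mulr_ge0 ?exprn_ge0 ?(ltW d0)//.
apply: le_trans (ler_wpM2l _ h) _; first by rewrite mulr_ge0 ?(ltW d0).
by rewrite le_eqVlt; apply/orP; left; apply/eqP; field; rewrite gt_eqF.
Qed.

(** * Counting the zeros *)

(** An infinite set contains arbitrarily large finite subsets. *)
Lemma counting_le (R : realType) (T : choiceType) (A : set T) (b : R) :
  (forall s : seq T, uniq s -> (forall z, z \in s -> A z) -> (size s)%:R <= b) ->
  (counting A <= b%:E)%E.
Proof.
move=> H; rewrite /counting; case: asboolP => [fA|iA].
  rewrite lee_fin; apply: H; first exact: finmap.fset_uniq.
  by move=> z; rewrite in_fset_set// inE.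
exfalso; have [B BA nB] := infinite_set_fset (Num.truncn b).+1 iA.
have := H (finmap.enum_fset B) (finmap.fset_uniq B) BA.
apply/negP; rewrite -ltNge; apply: (lt_le_trans (truncnS_gt b)).
by rewrite ler_nat.
Qed.

(** Lowers the order of vanishing at the origin to zero. *)
Lemma series_root_shift (R : realType) (a : nat -> R[i]) (n0 : nat) (z : R[i]) :
  (forall k, (k < n0)%N -> a k = 0) -> z != 0 -> series_root a z ->
  series_root (fun n => a (n0 + n)%N) z.
Proof.
move=> a0 z0 ra; rewrite /series_root -[X in ccvg _ X](mulr0 (z ^+ n0)^-1).
have -> : (fun N => \sum_(k < N) a (n0 + k)%N * z ^+ k) =
    (fun N => (z ^+ n0)^-1 * \sum_(k < n0 + N) a k * z ^+ k).
  apply/funext => N; rewrite big_split_ord /= [X in X + _]big1 ?add0r; last first.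
    by move=> k _; rewrite (a0 k (ltn_ord k)) mul0r.
  rewrite mulr_sumr; apply: eq_bigr => k _.
  by rewrite exprD [RHS]mulrCA mulKf// expf_neq0.
apply: ccvgZ; move/ccvgP: ra => ra; apply/ccvgP => e e0; have [M HM] := ra e e0.
by exists M => n Mn; apply: HM; exact: leq_trans Mn (leq_addl _ _).
Qed.

(** With [rho = 3 r] each nonzero root in the disc of radius [r] contributes a
    factor of at least [2] to the growth of the majorant series. *)
Lemma zero_count (R : realType) (f : R[i] -> R[i]) (a : nat -> R[i]) (m K : R) :
  sums_to a f -> (exists z, f z <> 0) -> 0 <= m ->
  (forall r, 0 <= r -> forall N, \sum_(n < N) cabs (a n) * r ^+ n <= expR (K + r `^ m)) ->
  exists C, 0 <= C /\ forall r, 1 <= r -> forall s : seq R[i], uniq s ->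
    (forall z, z \in s -> f z = 0 /\ cabs z < r) -> (size s)%:R <= C * r `^ m.
Proof.
move=> af [z0 fz0] m0 HK.
have l2 : 0 < ln 2 :> R by rewrite ln_gt0// ltr1n.
have ex : exists n, a n != 0.
  apply: contrapT => H; apply: fz0; apply: ccvg_uniq (af z0) _.
  rewrite (_ : (fun N => _) = fun=> 0); first exact: ccvg_cst.
  apply/funext => N; rewrite big1// => n _.
  have [->|an] := eqVneq (a n) 0; first by rewrite mul0r.
  by exfalso; apply: H; exists n.
pose n0 := ex_minn ex; have an0 : a n0 != 0 by rewrite /n0; case: ex_minnP.
have a0 k : (k < n0)%N -> a k = 0.
  rewrite /n0; case: ex_minnP => n _ nm kn; apply/eqP; apply: contraT => /nm.
  by rewrite leqNgt kn.
have c0 : 0 < cabs (a n0) by rewrite cabs_gt0.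
pose C1 := (`|K - ln (cabs (a n0))| + 3 `^ m) / ln 2.
have C10 : 0 <= C1 by rewrite divr_ge0 ?addr_ge0 ?powR_ge0// ltW.
exists (C1 + 1); split; first by rewrite addr_ge0.
move=> r r1 s us Hs; have r0 : 0 < r by exact: lt_le_trans r1.
have rm1 : 1 <= r `^ m by rewrite -(powRr0 r) ler_powR.
pose s' := [seq z <- s | z != 0].
have ss' : (size s <= size s' + 1)%N.
  rewrite -(count_predC (fun z => z != 0) s) size_filter leq_add2l.
  rewrite (eq_count (a2 := pred1 0)); last by move=> z /=; rewrite negbK.
  by rewrite count_uniq_mem//; case: (_ \in _).
have r3 : r < 3 * r by lra.
have Hs' z : z \in s' -> [/\ z != 0, cabs z <= r & series_root (fun n => a (n0 + n)%N) z].
  rewrite mem_filter => /andP[zn0 /Hs[fz zr]]; split=> //; first exact: ltW.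
  by apply: series_root_shift => //; have := af z; rewrite fz.
have S N : \sum_(k < N) cabs (a (n0 + k)%N) * (3 * r) ^+ k <= expR (K + (3 * r) `^ m).
  have r3' : 1 <= 3 * r by lra.
  apply: le_trans (HK (3 * r) _ (n0 + N)%N); last by rewrite (le_trans ler01).
  rewrite big_split_ord /= -[leLHS]add0r; apply: lerD.
    by apply: sumr_ge0 => k _; rewrite mulr_ge0 ?cabs_ge0 ?exprn_ge0// (le_trans ler01).
  apply: ler_sum => k _; apply: ler_wpM2l; first exact: cabs_ge0.
  by apply: ler_weXn2l => //; rewrite leq_addl.
have := root_count_bound (ltW r0) r3 (filter_uniq _ us) Hs' S.
rewrite addn0; have -> : 3 * r - r = 2 * r by ring.
rewrite exprMn mulrA ler_pM2r ?exprn_gt0//.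
have -> : cabs (a n0) * 2 ^+ size s' = expR (ln (cabs (a n0)) + (size s')%:R * ln 2).
  by rewrite expRD expRM_natl !lnK ?posrE.
rewrite ler_expR powRM ?(ltW r0)// => h.
have h1 : (size s')%:R <= C1 * r `^ m.
  rewrite /C1 mulrAC ler_pdivlMr// mulrDl.
  have : K - ln (cabs (a n0)) <= `|K - ln (cabs (a n0))| * r `^ m.
    by apply: le_trans (ler_norm _) _; rewrite ler_peMr.
  by move: h; move: (_ * r `^ m) (3 `^ m * r `^ m) => x y; lra.
have : (size s)%:R <= (size s')%:R + 1 :> R by rewrite natr1 ler_nat -addn1.
by rewrite mulrDl mul1r; lra.
Qed.

Lemma powR_ratio_cvg0 (R : realType) (C m eta : R) : 0 <= C -> m < eta ->
  (C * r `^ m / r `^ eta) @[r --> +oo%R] --> (0 : R).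
Proof.
move=> C0 me; have t0 : 0 < eta - m by rewrite subr_gt0.
apply/cvgrPdist_le => e e0; near=> r.
have r1 : 1 <= r by near: r; exact: nbhs_pinfty_ge.
have r0 : 0 < r by exact: lt_le_trans r1.
have big : (C / e) `^ (eta - m)^-1 <= r by near: r; exact: nbhs_pinfty_ge.
have Ce : 0 <= C / e by rewrite divr_ge0// ltW.
have : C / e <= r `^ (eta - m).
  have := ge0_ler_powR (ltW t0) (powR_ge0 _ _) (ltW r0) big.
  by rewrite -powRrM mulVf ?gt_eqF// powRr1.
rewrite ler_pdivrMr// => h.
have -> : C * r `^ m / r `^ eta = C / r `^ (eta - m).
  have -> : r `^ eta = r `^ (eta - m) * r `^ m.
    by rewrite -powRD ?subrK//; apply/implyP => _; rewrite gt_eqF.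
  by field; rewrite !gt_eqF// powR_gt0.
rewrite sub0r normrN ger0_norm ?divr_ge0 ?powR_ge0//.
by rewrite ler_pdivrMr ?powR_gt0// mulrC.
Unshelve. all: by end_near.
Qed.

Theorem theorem1p3 (R : realType) (u0 : R[i] -> R[i]) (lambda mu : R)
    (u0_BF : bargmann_fock u0)
    (u0_neq0 : exists z, u0 z <> 0)
    (u0_sol : forall z : R[i],
       lambda%:C * u0 z + mu%:C * Lambda u0 z =
       proj_bf (fun w => (cabs (u0 w) ^+ 2)%:C * u0 w) z) :
  (forall eta : R, eta0 R < eta ->
     exists C : R, forall z : R[i],
       cabs (u0 z) <= C * expR (cabs z `^ eta - 2^-1 * cabs z ^+ 2)) /\
  (forall eta : R, eta0 R < eta ->
     (nb_zeros u0 r * ((r `^ eta)^-1)%:E)%E @[r --> +oo%R] --> 0%E).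
Proof.
have [f [a [uf af Hk]]] := stationary_energy u0_BF u0_neq0 u0_sol.
have u0f z : u0 z = 0 <-> f z = 0.
  rewrite uf; split=> [/eqP|->]; last by rewrite mulr0.
  by rewrite mulf_eq0 -cabs_eq0 cabs_real normr_eq0 gt_eqF ?expR_gt0// => /eqP.
split=> eta He.
  have [K [K0 HK]] := coef_sum_growth He Hk.
  exists (expR K) => z.
  have fz : cabs (f z) <= expR (K + cabs z `^ eta).
    apply: ccvg_bounded (af z) _ => N; apply: le_trans (HK _ (cabs_ge0 z) N).
    apply: le_trans (cabs_sum _ _ _) _.
    by apply: ler_sum => k _; rewrite cabsM cabsX.
  rewrite uf cabsM cabs_real ger0_norm ?expR_ge0//.
  apply: le_trans (ler_wpM2l (expR_ge0 _) fz) _.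
  by rewrite -!expRD ler_expR; lra.
have [m0 [m1 me _ _]] := eta0_exponent He.
have [m [em m_eta m_ge0]] : exists m, [/\ eta0 R < m, m < eta & 0 <= m].
  exists ((eta0 R + eta) / 2); split; [lra|lra|].
  suff : 0 <= eta0 R by lra.
  by rewrite /eta0 invr_ge0 addr_ge0// mulr_ge0// divr_ge0// ln_ge0// ler1n.
have [K [K0 HK]] := coef_sum_growth em Hk.
have fn0 : exists z, f z <> 0.
  by have [z uz] := u0_neq0; exists z => /u0f.
have [C [C0 HC]] := zero_count af fn0 m_ge0 HK.
have nz r : 1 <= r -> (nb_zeros u0 r <= (C * r `^ m)%:E)%E.
  move=> r1; apply: counting_le => s us Hs; apply: HC => // z /Hs[/u0f fz zr].
  by split.
apply: (squeeze_cvge (f := fun=> 0%E) (h := fun r => (C * r `^ m / r `^ eta)%:E)).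
- near=> r; apply/andP; split.
    apply: mule_ge0; last by rewrite lee_fin invr_ge0 powR_ge0.
    by rewrite /nb_zeros /counting; case: asboolP; rewrite ?lee_fin// leey.
  rewrite EFinM; apply: lee_wpmul2r; first by rewrite lee_fin invr_ge0 powR_ge0.
  by apply: nz; near: r; exact: nbhs_pinfty_ge.
- exact: cvg_cst.
apply: cvg_EFin; first by near=> r.
exact: powR_ratio_cvg0.
Unshelve. all: by end_near.
Qed.
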